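(* Let $N\ge1$ and let $f$ be a non-constant generalized modular function of weight $0$ on $\Gamma_0(N)$ with $\mathrm{div}(f)=0$ and $q$-exponents $c(n)$ ($n\in\mathbb{N}$). Suppose that $g=\frac{1}{2\pi i}f'/f$ is a normalized Hecke eigenform. Let $K_f$ be the number field generated over $\mathbb{Q}$ by the $c(n)$ and $\mathcal{O}_{K_f}$ its ring of integers. Then there are only finitely many primes $p$ such that $c(p)\neq 0$ and $c(p)\in\mathcal{O}_{K_f}$.
   Context: A GMF of integral weight $k$ on $\Gamma_0(N)$ is a holomorphic $f$ on $\mathbb{H}$ with $f\left(\frac{az+b}{cz+d}\right)=\chi(\gamma)(cz+d)^kf(z)$ for all $\gamma\in\Gamma_0(N)$, for some (not necessarily unitary) character $\chi:\Gamma_0(N)\to\mathbb{C}^*$ with $\chi(\gamma)=1$ for parabolic $\gamma$ of trace $2$. $\mathrm{div}(f)=0$: no zeros or poles in $\mathbb{H}$ or at cusps. A nonzero weight-$0$ GMF expands as $c\,q^h\prod_{n\ge1}(1-q^n)^{c(n)}$ near $q=0$ ($q=e^{2\pi iz}$, $c\ne0$), the $c(n)$ being its uniquely determined $q$-exponents. Then $g=\frac{1}{2\pi i}f'/f=\sum b(n)q^n$ is a weight-$2$ cusp form on $\Gamma_0(N)$ with trivial character, $b(n)=-\sum_{d\mid n}dc(d)$ and $nc(n)=-\sum_{d\mid n}\mu(d)b(n/d)$; normalized means $b(1)=1$. (For a normalized eigenform the $b(n)$, hence the $c(n)$, generate a number field.) *)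

(* Defs.v *)
From HB Require Import structures.
From mathcomp Require Import all_boot all_order all_algebra.
From mathcomp Require Import all_classical all_reals all_analysis.
From mathcomp Require Import complex.
Set Implicit Arguments.
Unset Strict Implicit.
Unset Printing Implicit Defensive.
Import Order.TTheory GRing.Theory Num.Theory.
Import numFieldNormedType.Exports.
Local Open Scope ring_scope.
Local Open Scope complex_scope.
Local Open Scope classical_set_scope.

Section GMF.
Variable R : realType.
Notation C := (R[i]).

Definition reC (z : C) : R := complex.Re z.
Definition imC (z : C) : R := complex.Im z.

Definition inH (z : C) : Prop := 0 < imC z.

Definition mob (a b c d : int) (z : C) : C :=
  (a%:~R * z + b%:~R) / (c%:~R * z + d%:~R).

Definition inSL2 (a b c d : int) : Prop := a * d - b * c = 1.
Definition inGamma0 (N : nat) (a b c d : int) : Prop :=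
  inSL2 a b c d /\ (N%:Z %| c)%Z.

(* a (not necessarily unitary) character chi : Gamma_0(N) -> C^*, trivial on the
   parabolic elements of trace 2 *)
Definition gmf_character (N : nat) (chi : int -> int -> int -> int -> C) : Prop :=
  (forall a b c d, inGamma0 N a b c d -> chi a b c d != 0) /\
  (forall a1 b1 c1 d1 a2 b2 c2 d2,
      inGamma0 N a1 b1 c1 d1 -> inGamma0 N a2 b2 c2 d2 ->
      chi (a1 * a2 + b1 * c2) (a1 * b2 + b1 * d2)
          (c1 * a2 + d1 * c2) (c1 * b2 + d1 * d2)
      = chi a1 b1 c1 d1 * chi a2 b2 c2 d2) /\
  (forall a b c d, inGamma0 N a b c d -> a + d = 2 -> chi a b c d = 1).

Definition holomorphic_on_H (f : C -> C) : Prop :=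
  forall z, inH z -> derivable (f : C^o -> C^o) z 1.

Definition cderiv (f : C -> C) (z : C) : C := 'D_1 (f : C^o -> C^o) z.

Definition GMF0 (N : nat) (f : C -> C) : Prop :=
  holomorphic_on_H f /\
  exists chi, gmf_character N chi /\
    forall a b c d z, inGamma0 N a b c d -> inH z ->
      f (mob a b c d z) = chi a b c d * f z.

(* div(f) = 0 : no zeros (nor poles, f being holomorphic) in H, and at every cusp
   gamma(i oo), gamma in SL_2(Z), f(gamma z) tends to a nonzero limit as Im z -> +oo,
   i.e. f has order 0 at every cusp. *)
Definition div_zero (f : C -> C) : Prop :=
  (forall z, inH z -> f z != 0) /\
  (forall a b c d, inSL2 a b c d ->
     exists L : C, L != 0 /\
       forall eps : R, 0 < eps -> exists Y : R, forall z, inH z -> Y < imC z ->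
         `| f (mob a b c d z) - L | < eps%:C).

Definition nonconstant_on_H (f : C -> C) : Prop :=
  exists z1 z2, inH z1 /\ inH z2 /\ f z1 != f z2.

Definition cexp (w : C) : C :=
  (expR (reC w))%:C * (cos (imC w) +i* sin (imC w)).

(* principal logarithm on the right half plane Re w > 0 *)
Definition LogRH (w : C) : C :=
  (ln (reC w ^+ 2 + imC w ^+ 2) / 2) +i* atan (imC w / reC w).

Definition cpow (w s : C) : C := cexp (s * LogRH w).

Definition qz (z : C) : C := cexp ((2 * pi)%:C * 'i * z).

Definition q_exponents (f : C -> C) (C0 : C) (h : int) (c : nat -> C) : Prop :=
  C0 != 0 /\
  exists Y : R, forall z, inH z -> Y < imC z ->
    (fun M : nat => (C0 * qz z ^ h *
        \prod_(n < M) cpow (1 - qz z ^+ n.+1) (c n.+1) : C^o))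
      @ \oo --> (f z : C^o).

Definition logderiv (f : C -> C) (z : C) : C :=
  cderiv f z / ((2 * pi)%:C * 'i * f z).

(* Hecke operators on weight-2 forms of level N:
   T_p g(z) = p g(pz) + (1/p) sum_{j<p} g((z+j)/p)   for p not dividing N,
   U_p g(z) = (1/p) sum_{j<p} g((z+j)/p)            for p dividing N. *)
Definition hecke2 (N p : nat) (g : C -> C) (z : C) : C :=
  (if (p %| N)%N then 0 else p%:R * g (p%:R * z)) +
  p%:R^-1 * \sum_(j < p) g ((z + j%:R) / p%:R).

(* Fourier coefficients of g = (1/(2 pi i)) f'/f in terms of the q-exponents:
   b(n) = - sum_{d | n} d c(d) *)
Definition bcoef (c : nat -> C) (n : nat) : C :=
  - \sum_(d <- divisors n) d%:R * c d.

Definition normalized_hecke_eigenform (N : nat) (g : C -> C) (c : nat -> C) : Prop :=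
  bcoef c 1 = 1 /\
  forall p, prime p -> exists lam : C, forall z, inH z -> hecke2 N p g z = lam * g z.

(* algebraic integer: root of a monic polynomial with integer coefficients;
   for x in a number field K this is membership in O_K *)
Definition alg_integer (x : C) : Prop :=
  exists P : {poly int}, P \is monic /\ root (map_poly (fun k : int => k%:~R) P) x.

End GMF.

(* Main.v *)
(** Let [F] be a logarithm of [f] on the upper half plane. Integrating the
    Hecke relation gives [F (p z) + \sum_(j < p) F ((z + j) / p) = lam F z + K],
    and comparing [q]-expansions [lam = 1 - p c(p)], so that a prime [p] as in
    the statement yields a nonzero algebraic integer [(1 - lam) / p].

    Since [f] has nonzero limits at the cusps, [F] has limits too: normalized by
    [u(oo) = 0], they form a function [u] on P^1(Q) which takes finitely many
    differences on unimodular pairs (a modular symbol), satisfies the same Hecke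
    relation, and is nonzero, because otherwise [F] would be a Gamma_0(N)-invariant
    function vanishing at all cusps, hence constant by the maximum principle.
    The differences span a finite-dimensional rational vector space on which the
    Hecke relation acts by a rational matrix. Every eigenvalue [mu] of this matrix
    has [|mu| <= p + 1]: by Manin's continued fraction trick the values of an
    eigenfunction grow logarithmically with the denominator, whereas [r]-fold
    iteration expresses [mu ^ r] times a value by [(p + 1) ^ r] values.

    For [lam] itself there is a better bound. If [p] is large and [z] stays in a
    compact set, [p z] and many of the [(z + j) / p] lie near cusps, where [F] is
    almost constant on hyperbolic balls; hence [|lam| <= p - M / 2 + 1 / 2] for any
    given [M]. Now the numbers [(1 - mu) / p] are conjugates of the nonzero algebraic
    integer [(1 - lam) / p], and their product is a nonzero rational integer; but it
    is at most [(1 + 2 / p) ^ d (1 - 2 (d + 1) / p) < 1] in modulus. *)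
Require Import Defs.
From HB Require Import structures.
From mathcomp Require Import all_boot all_order all_algebra.
From mathcomp Require Import all_classical all_reals all_analysis.
From mathcomp Require Import complex.
From mathcomp Require Import ring lra zify.
Set Implicit Arguments.
Unset Strict Implicit.
Unset Printing Implicit Defensive.
Import Order.TTheory GRing.Theory Num.Theory.
Import numFieldNormedType.Exports.
Local Open Scope ring_scope.
Local Open Scope complex_scope.

(** The character may be non-unitary, so [|f|] need not be invariant under Gamma_0(N); only
    quotients [f w / f z] are, and with them differences of [F]. Hence the estimates concern such
    quotients and differences: they are proved on a strip for one matrix at a time and made uniform
    over the finitely many cosets of Gamma_0(N) in SL_2(Z). The constant [K] vanishes, because at
    the cusp oo all p + 1 terms of the relation for [u] are [u(oo) = 0]. The sharper bound for [lam]
    is forced by the final product. The d other eigenvalues may cost a factor (1 + 2 / p)^d, so the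
    factor of [lam] has to gain about 2 d / p. A gain of fixed size would fail for large d, whence
    the free parameter [M], finally 4 d + 8. A further obstacle is the q-product, which is only
    assumed to converge at each point. Comparing q-expansions needs geometric tails, so an
    exponential bound on c(n) has to be extracted from pointwise convergence. *)

Notation nm := (@ComplexField.Normc.normc _).

(** * The complex modulus as a real number *)

Section ComplexNorm.
Variable R : realType.
Notation C := (R[i]).
Implicit Types (z w : C) (x y : R).

Lemma nm_ge0 z : 0 <= nm z.
Proof. by case: z => a b /=; exact: sqrtr_ge0. Qed.

Lemma nm0 : nm (0 : C) = 0.
Proof. exact: ComplexField.Normc.normc0. Qed.

Lemma nm1 : nm (1 : C) = 1.
Proof. exact: ComplexField.Normc.normc1. Qed.

Lemma nmM z w : nm (z * w) = nm z * nm w.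
Proof. exact: ComplexField.Normc.normcM. Qed.

Lemma nmV z : nm z^-1 = (nm z)^-1.
Proof. exact: ComplexField.Normc.normcV. Qed.

Lemma nmN z : nm (- z) = nm z.
Proof. exact: normcN. Qed.

Lemma nmD z w : nm (z + w) <= nm z + nm w.
Proof. exact: le_normcD. Qed.

Lemma nmB z w : nm (z - w) = nm (w - z).
Proof. by rewrite -nmN opprB. Qed.

Lemma nm_triangle z w v : nm (z - v) <= nm (z - w) + nm (w - v).
Proof. by rewrite (_ : z - v = (z - w) + (w - v)) ?nmD//; ring. Qed.

Lemma nm_sub z w : nm z - nm w <= nm (z - w).
Proof. by have := nmD (z - w) w; rewrite subrK; lra. Qed.

Lemma nm_eq0 z : (nm z == 0) = (z == 0).
Proof.
apply/eqP/eqP => [/ComplexField.Normc.eq0_normc //|->]; exact: nm0.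
Qed.

Lemma nm_gt0 z : (0 < nm z) = (z != 0).
Proof. by rewrite lt_def nm_ge0 andbT nm_eq0. Qed.

Lemma nmX z n : nm (z ^+ n) = nm z ^+ n.
Proof. by elim: n => [|n IH]; rewrite ?expr0 ?nm1// !exprS nmM IH. Qed.

Lemma sqr_nm z : nm z ^+ 2 = complex.Re z ^+ 2 + complex.Im z ^+ 2.
Proof. by case: z => a b /=; rewrite sqr_sqrtr// addr_ge0// sqr_ge0. Qed.

Lemma nm_real x : nm (x%:C) = `|x|.
Proof. by rewrite /= expr0n/= addr0 sqrtr_sqr. Qed.

Lemma nm_nat n : nm (n%:R : C) = n%:R.
Proof. by rewrite -(rmorph_nat (real_complex R)) nm_real normr_nat. Qed.

Lemma nm_i : nm ('i : C) = 1.
Proof. by rewrite /= expr0n expr1n/= add0r sqrtr1. Qed.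

Lemma nmE z : `|z| = (nm z)%:C.
Proof. by rewrite normc_def; case: z. Qed.

Lemma ltr_nm z x : (`|z| < x%:C) = (nm z < x).
Proof. by rewrite nmE ltcR. Qed.

Lemma ler_nm z x : (`|z| <= x%:C) = (nm z <= x).
Proof. by rewrite nmE lecR. Qed.

Lemma nm_Re z : `|complex.Re z| <= nm z.
Proof. by rewrite -lecR -nmE normc_ge_Re. Qed.

Lemma nm_Im z : `|complex.Im z| <= nm z.
Proof.
rewrite -(ler_pXn2r (n := 2))// ?nnegrE ?nm_ge0//.
by rewrite sqr_nm real_normK ?num_real// lerDr sqr_ge0.
Qed.

Lemma nm_ReIm z : nm z <= `|complex.Re z| + `|complex.Im z|.
Proof.
rewrite -(ler_pXn2r (n := 2)) ?nnegrE ?nm_ge0 ?addr_ge0//.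
rewrite sqr_nm -[in leLHS](real_normK (num_real (complex.Re z))) -[in leLHS](real_normK (num_real (complex.Im z))).
by have := mulr_ge0 (normr_ge0 (complex.Re z)) (normr_ge0 (complex.Im z)); nra.
Qed.

Lemma ReD z w : complex.Re (z + w) = complex.Re z + complex.Re w.
Proof. by case: z w => a b [c d]. Qed.
Lemma ImD z w : complex.Im (z + w) = complex.Im z + complex.Im w.
Proof. by case: z w => a b [c d]. Qed.
Lemma ReN z : complex.Re (- z) = - complex.Re z.
Proof. by case: z. Qed.
Lemma ImN z : complex.Im (- z) = - complex.Im z.
Proof. by case: z. Qed.
Lemma ReM z w : complex.Re (z * w) =
  complex.Re z * complex.Re w - complex.Im z * complex.Im w.
Proof. by case: z w => a b [c d]. Qed.
Lemma ImM z w : complex.Im (z * w) =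
  complex.Re z * complex.Im w + complex.Im z * complex.Re w.
Proof. by case: z w => a b [c d]. Qed.
Lemma ImRM x z : complex.Im (x%:C * z) = x * complex.Im z.
Proof. by rewrite ImM /= mul0r addr0. Qed.
Lemma ReNat n : complex.Re (n%:R : C) = n%:R.
Proof. by rewrite -(rmorph_nat (real_complex R)). Qed.
Lemma ImNat n : complex.Im (n%:R : C) = 0.
Proof. by rewrite -(rmorph_nat (real_complex R)). Qed.
Lemma ReInt (n : int) : complex.Re (n%:~R : C) = n%:~R.
Proof. by rewrite -(rmorph_int (real_complex R)). Qed.
Lemma ImInt (n : int) : complex.Im (n%:~R : C) = 0.
Proof. by rewrite -(rmorph_int (real_complex R)). Qed.

Definition ReImE := (ReD, ImD, ReN, ImN, ReM, ImM, ReNat, ImNat, ReInt, ImInt).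

Lemma complexP z w : complex.Re z = complex.Re w -> complex.Im z = complex.Im w -> z = w.
Proof. by case: z w => a b [c d] /= -> ->. Qed.

Lemma nm_sum I (r : seq I) (P : pred I) (F : I -> C) :
  nm (\sum_(i <- r | P i) F i) <= \sum_(i <- r | P i) nm (F i).
Proof.
elim/big_ind2 : _ => [|a b c d h1 h2|//]; first by rewrite nm0.
exact: le_trans (nmD _ _) (lerD _ _).
Qed.

End ComplexNorm.

(** * Complex exponential and logarithm on the right half plane *)

Section ExpLog.
Variable R : realType.
Notation C := (R[i]).
Implicit Types (z w : C) (x y : R).

Lemma cexp0 : cexp (0 : C) = 1.
Proof. by rewrite /cexp /reC /imC/= expR0 cos0 sin0 mul1r. Qed.

Lemma cexpD z w : cexp (z + w) = cexp z * cexp w.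
Proof.
case: z w => a b [c d]; rewrite /cexp /reC /imC/= expRD cosD sinD.
by apply: complexP; rewrite !ReImE /=; ring.
Qed.

Lemma nm_cexp z : nm (cexp z) = expR (complex.Re z).
Proof.
rewrite /cexp nmM nm_real ger0_norm ?expR_ge0//=.
by rewrite cos2Dsin2 sqrtr1 mulr1.
Qed.

Lemma cexp_neq0 z : cexp z != 0.
Proof. by rewrite -nm_gt0 nm_cexp expR_gt0. Qed.

Lemma cexpN z : cexp (- z) = (cexp z)^-1.
Proof.
by apply: (mulfI (cexp_neq0 z)); rewrite -cexpD subrr cexp0 divff// cexp_neq0.
Qed.

Lemma cexpB z w : cexp (z - w) = cexp z / cexp w.
Proof. by rewrite cexpD cexpN. Qed.

Lemma cexpMn z n : cexp (n%:R * z) = cexp z ^+ n.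
Proof.
elim: n => [|n IH]; first by rewrite mul0r cexp0.
by rewrite -natr1 mulrDl mul1r cexpD IH exprSr.
Qed.

Lemma cexp_sum I (r : seq I) (P : pred I) (F : I -> C) :
  cexp (\sum_(i <- r | P i) F i) = \prod_(i <- r | P i) cexp (F i).
Proof.
by elim/big_rec2 : _ => [|i y1 y2 _ <-]; rewrite ?cexp0// cexpD.
Qed.

(* cos y = 1 and sin y = 0 force y = 0 when |y| < 2 pi: halve the angle. *)
Lemma cexp_eq1 z : cexp z = 1 -> `|complex.Im z| < 2 * pi -> z = 0.
Proof.
move=> h; have hr : complex.Re z = 0.
  by apply/expR_inj; rewrite -nm_cexp h nm1 expR0.
move: h; rewrite /cexp /reC /imC hr expR0 mul1r.
set y := complex.Im z => -[hc hs]; move=> hy.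
apply: complexP; first exact: hr.
rewrite -/y [RHS]/=.
have : sin (y / 2) ^+ 2 = 0.
  have e : cos y = cos (y / 2 *+ 2) by congr cos; rewrite -mulr_natr; field.
  move: hc; rewrite e cos_mulr2n cos2sin2 -mulr_natl; lra.
move/eqP; rewrite expf_eq0 /= => /eqP hs2.
have [hy0|hy0|//] := ltgtP y 0.
- have := @sin_gt0_pi R (- y / 2); rewrite (_ : - y / 2 = - (y / 2)) ?sinN ?hs2 ?oppr0 ?ltxx; last by field.
  have := hy; rewrite ltr0_norm// => hy' H; suff: false by []; apply: H.
  by apply/andP; split; lra.
- have := @sin_gt0_pi R (y / 2); rewrite hs2 ltxx.
  have := hy; rewrite gtr0_norm// => hy' H; suff: false by []; apply: H.
  by apply/andP; split; lra.
Qed.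

Lemma cexp_inj z w : cexp z = cexp w ->
  `|complex.Im z - complex.Im w| < 2 * pi -> z = w.
Proof.
move=> h hi; apply/eqP; rewrite -subr_eq0; apply/eqP/cexp_eq1.
  by rewrite cexpB h divff// cexp_neq0.
by rewrite !ReImE.
Qed.

Lemma cexp_LogRH w : 0 < complex.Re w -> cexp (LogRH w) = w.
Proof.
case: w => a b /= a0; rewrite /LogRH /cexp /reC /imC /=.
have p0 : 0 < a ^+ 2 + b ^+ 2 by rewrite ltr_wpDr ?sqr_ge0// exprn_gt0.
have -> : expR (ln (a ^+ 2 + b ^+ 2) / 2) = Num.sqrt (a ^+ 2 + b ^+ 2).
  apply/eqP; rewrite -(eqrXn2 (n := 2))// ?expR_ge0 ?sqrtr_ge0//.
  rewrite sqr_sqrtr; last exact: ltW.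
  by rewrite -expRM_natl mulrC divfK ?pnatr_eq0// lnK.
have c0 : 0 < cos (atan (b / a)).
  by apply: cos_gt0_pihalf; rewrite atan_gtNpi2 atan_ltpi2.
have hs : Num.sqrt (a ^+ 2 + b ^+ 2) * cos (atan (b / a)) = a.
  apply/eqP; rewrite -(eqrXn2 (n := 2))// ?mulr_ge0 ?sqrtr_ge0 ?ltW//.
  rewrite exprMn sqr_sqrtr; last exact: ltW.
  rewrite cos_atan exprVn sqr_sqrtr ?addr_ge0 ?sqr_ge0//; apply/eqP.
  by field; rewrite !gt_eqF.
have ht : sin (atan (b / a)) = b / a * cos (atan (b / a)).
  by rewrite -{2}(atanK (b / a)) /tan divfK// gt_eqF.
apply: complexP; rewrite !ReImE /= mul0r ?subr0 ?addr0 //.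
by rewrite ht mulrCA hs divfK// gt_eqF.
Qed.

Lemma LogRH_Im w : `|complex.Im (LogRH w)| < pi / 2.
Proof. by rewrite /LogRH /= ltr_norml atan_gtNpi2 atan_ltpi2. Qed.

Lemma LogRHK w : 0 < complex.Re (cexp w) -> `|complex.Im w| <= pi -> LogRH (cexp w) = w.
Proof.
move=> h1 h2; apply: cexp_inj; first by rewrite cexp_LogRH.
have := LogRH_Im (cexp w); have := @pi_gt0 R.
have := ler_normB (complex.Im (LogRH (cexp w))) (complex.Im w).
by lra.
Qed.

Lemma LogRH1 : LogRH (1 : C) = 0.
Proof. by rewrite -cexp0 LogRHK // ?cexp0 /= ?ltr01// normr0 pi_ge0. Qed.

(** With all three points in the right half plane, the imaginary parts of the two sides differ by
    less than 3 pi / 2, so the period 2 pi of [cexp] cannot intervene. *)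
Lemma LogRHM z w : 0 < complex.Re z -> 0 < complex.Re w -> 0 < complex.Re (z * w) ->
  LogRH (z * w) = LogRH z + LogRH w.
Proof.
move=> hz hw hzw; apply: cexp_inj; first by rewrite cexpD !cexp_LogRH.
rewrite ImD.
have := LogRH_Im (z * w); have := LogRH_Im z; have := LogRH_Im w.
rewrite !ltr_norml => /andP[? ?] /andP[? ?] /andP[? ?].
by have := @pi_gt0 R; move=> ?; apply/andP; split; lra.
Qed.

End ExpLog.

(** * Explicit Taylor estimates for exponential and logarithm *)

Section ExpLogBounds.
Variable R : realType.
Notation C := (R[i]).
Implicit Types (z w : C) (x y : R).

(** The mean value theorem between 0 and [y] for either sign of [y]; bounding [c] by [|y|] spares
    every later estimate the case distinction. *)
Lemma MVT_from0 (f df : R -> R) y : (forall x : R, is_derive x 1 f (df x)) ->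
  exists2 c, `|c| <= `|y| & f y - f 0 = df c * y.
Proof.
move=> hf.
have cf : continuous f.
  by move=> x; apply/differentiable_continuous/derivable1_diffP; case: (hf x).
have [y0|y0] := leP 0 y.
  have [] := MVT_segment y0 (fun x _ => hf x); first exact: continuous_subspaceT.
  move=> c; rewrite in_itv/= => /andP[c0 cy] ->; exists c; last by rewrite subr0.
  by rewrite !ger0_norm.
have [] := MVT_segment (ltW y0) (fun x _ => hf x); first exact: continuous_subspaceT.
move=> c; rewrite in_itv/= => /andP[yc c0] h; exists c; last first.
  by rewrite -opprB h; ring.
by rewrite !ler0_norm ?lerN2//; lra.
Qed.

Lemma abs_sin_le y : `|sin y| <= `|y|.
Proof.
have [c _] := MVT_from0 y (@is_derive_sin R).
rewrite sin0 subr0 => ->; rewrite normrM ler_piMl//.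
by rewrite ler_norml cos_geN1 cos_le1.
Qed.

Lemma abs_cos_sub1_le y : `|cos y - 1| <= y ^+ 2.
Proof.
have [c hc] := MVT_from0 y (@is_derive_cos R).
rewrite cos0 => ->; rewrite normrM normrN -(real_normK (num_real y)) expr2.
by rewrite ler_wpM2r// (le_trans (abs_sin_le c)).
Qed.

Lemma abs_sin_sub_le y : `|y| <= 1 -> `|sin y - y| <= y ^+ 2.
Proof.
move=> y1; have [c hc] := MVT_from0 y (@is_derive_sin R).
rewrite sin0 subr0 => ->; rewrite -{2}(mul1r y) -mulrBl normrM.
rewrite -(real_normK (num_real y)) expr2 ler_wpM2r//.
apply: le_trans (abs_cos_sub1_le c) _; rewrite -(real_normK (num_real c)).
by have := normr_ge0 c; nra.
Qed.

Lemma abs_atan_le y : `|atan y| <= `|y|.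
Proof.
have [c _] := MVT_from0 y (@is_derive1_atan R).
rewrite atan0 subr0 => ->; rewrite normrM ler_piMl// normfV.
have := sqr_ge0 c => c0; rewrite ger0_norm; last lra.
by rewrite invf_le1; lra.
Qed.

(** Both sides come from exp t >= 1 + t, taken at t = x and at t = - x. *)
Lemma expR_bounds x : `|x| <= 1 / 2 -> 0 <= expR x - 1 - x <= 2 * x ^+ 2.
Proof.
rewrite ler_norml => /andP[h1 h2]; have e1 := expR_ge1Dx x.
have := expR_ge1Dx (- x); rewrite expRN => e2.
have : expR x * (1 - x) <= 1.
  by rewrite -ler_pdivlMl ?expR_gt0// mulr1.
by move=> h; apply/andP; split; nra.
Qed.

Lemma cexp_sub1_sub_le w : nm w <= 1 / 2 -> nm (cexp w - 1 - w) <= 8 * nm w ^+ 2.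
Proof.
move=> h; have hre := le_trans (nm_Re w) h; have him := le_trans (nm_Im w) h.
apply: le_trans (nm_ReIm _) _; rewrite sqr_nm.
rewrite /cexp /reC /imC; case: w h hre him => x y _ /= hx hy.
rewrite !mul0r ?subr0 ?addr0 ?oppr0 ?addr0.
have /andP[e1 e2] := expR_bounds hx.
have hs : `|sin y - y| <= y ^+ 2 by apply: abs_sin_sub_le; lra.
have hc := abs_cos_sub1_le y.
move: (hx) (hy) (hs) (hc); rewrite !ler_norml => /andP[hx1 hx2] /andP[hy1 hy2] /andP[s1 s2] /andP[c1 c2].
have E2 : expR x <= 2 by nra.
have E0 := expR_gt0 x.
have hA : `|expR x * cos y - 1 - x| <= 2 * x ^+ 2 + 2 * y ^+ 2.
  rewrite ler_norml; apply/andP; split; nra.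
have hB : `|expR x * sin y - y| <= 4 * `|x| * `|y| + 2 * y ^+ 2.
  have -> : expR x * sin y - y = (expR x - 1) * y + expR x * (sin y - y) by ring.
  apply: le_trans (ler_normD _ _) _; rewrite !normrM; apply: lerD.
    have x2 : x ^+ 2 <= `|x|.
      by rewrite -(real_normK (num_real x)); have := normr_ge0 x; nra.
    have := ler_norm x; have := ler_norm (- x); rewrite normrN => n1 n2; have n0 := normr_ge0 x.
    by rewrite ler_wpM2r// ler_norml; apply/andP; split; lra.
  by rewrite (gtr0_norm E0); apply: ler_pM => //; exact: ltW.
apply: le_trans (lerD hA hB) _.
have := sqr_ge0 (`|x| - `|y|); rewrite -(real_normK (num_real x)) -(real_normK (num_real y)).
by have := normr_ge0 x; have := normr_ge0 y; nra.
Qed.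

Lemma LogRH_nm_le z : nm (z - 1) <= 1 / 2 -> nm (LogRH z) <= 6 * nm (z - 1).
Proof.
move=> h; have hre := nm_Re (z - 1); have him := nm_Im (z - 1).
have hre2 := le_trans hre h.
have a0 : 1 / 2 <= complex.Re z.
  by move: hre2; rewrite !ReImE /= ler_norml => /andP[? ?]; lra.
set d := nm (z - 1) in h hre him *.
have d0 : 0 <= d := nm_ge0 _.
apply: le_trans (nm_ReIm _) _; rewrite /LogRH /reC /imC /=.
have p0 : 0 < complex.Re z ^+ 2 + complex.Im z ^+ 2.
  by have := sqr_ge0 (complex.Im z); nra.
have n1 : 1 / 2 <= nm z by apply: le_trans a0 _; apply: le_trans (ler_norm _) (nm_Re z).
have hl : `|ln (complex.Re z ^+ 2 + complex.Im z ^+ 2) / 2| <= 2 * d.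
  rewrite -sqr_nm lnXn; last lra.
  rewrite -[X in X / 2]mulr_natr mulfK ?pnatr_eq0//.
  have := le_ln1Dx (_ : -1 < nm z - 1); rewrite subrKC => l1.
  have l2 := @le_ln1Dx _ ((nm z)^-1 - 1); move: l2; rewrite subrKC lnV ?posrE; last lra.
  move=> l2.
  have hd : `|nm z - 1| <= d.
    by rewrite ler_norml; have := nm_sub z 1; have := nm_sub 1 z; rewrite nm1 (nmB 1 z) -/d => ? ?; apply/andP; split; lra.
  move: hd; rewrite ler_norml => /andP[d1 d2].
  have iv : (nm z)^-1 - 1 <= 2 * d.
    rewrite lerBlDr -[leLHS]mul1r ler_pdivrMr; last lra.
    nra.
  have iv0 : 0 < (nm z)^-1 by rewrite invr_gt0; lra.
  rewrite ler_norml; apply/andP; split.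
    by have := l2 (_ : -1 < _); lra.
  by have := l1 (_ : -1 < _); lra.
have ha : `|atan (complex.Im z / complex.Re z)| <= 2 * d.
  apply: le_trans (abs_atan_le _) _; rewrite normrM normfV (ger0_norm (_ : 0 <= complex.Re z)); last lra.
  rewrite ler_pdivrMr; last lra.
  by move: him; rewrite !ReImE /= oppr0 addr0 => him; nra.
by lra.
Qed.

Lemma Re_near1 z : nm (z - 1) < 1 -> 0 < complex.Re z.
Proof.
move=> h; have := le_lt_trans (nm_Re (z - 1)) h; rewrite !ReImE /= ltr_norml.
by move=> /andP[? ?]; lra.
Qed.

(** The estimate for [cexp] is applied at the point [LogRH z], whose modulus is at most 6 |z - 1|:
    hence 288 = 8 * 6 ^ 2, and hence 1 / 12, which keeps that modulus below 1 / 2. *)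
Lemma LogRH_sub_le z : nm (z - 1) <= 1 / 12 ->
  nm (LogRH z - (z - 1)) <= 288 * nm (z - 1) ^+ 2.
Proof.
move=> h; have h1 := LogRH_nm_le (_ : nm (z - 1) <= 1 / 2).
have {}h1 : nm (LogRH z) <= 6 * nm (z - 1) by apply: h1; lra.
have := cexp_sub1_sub_le (_ : nm (LogRH z) <= 1 / 2).
rewrite cexp_LogRH; last by apply: Re_near1; lra.
rewrite nmB => h2; apply: le_trans (h2 _) _; first lra.
by have := nm_ge0 (LogRH z); nra.
Qed.

Lemma LogRH_mono_near1 z : nm (z - 1) <= 1 / 2 -> nm (LogRH z) <= 3.
Proof. by move=> h; have := LogRH_nm_le h; lra. Qed.

End ExpLogBounds.

(** * Compactness of squares by repeated quartering *)

Section SquareInduction.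
Variable R : realType.
Implicit Types (x y s : R).

Lemma nested_sup (u s : nat -> R) : (forall n, u n <= u n.+1) ->
  (forall n, u n.+1 + s n.+1 <= u n + s n) -> (forall n, 0 <= s n) ->
  exists l, forall n, u n <= l <= u n + s n.
Proof.
move=> hu hs s0.
have mono m n : (m <= n)%N -> u m <= u n.
  elim: n => [|n IH]; first by rewrite leqn0 => /eqP->.
  by rewrite leq_eqVlt ltnS => /orP[/eqP->//|/IH h]; exact: le_trans h (hu n).
have mono2 m n : (m <= n)%N -> u n + s n <= u m + s m.
  elim: n => [|n IH]; first by rewrite leqn0 => /eqP->.
  by rewrite leq_eqVlt ltnS => /orP[/eqP->//|/IH h]; exact: le_trans (hs n) h.
have ub n m : u m <= u n + s n.
  have [h|/ltnW h] := leqP m n.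
    by apply: le_trans (mono _ _ h) _; rewrite lerDl.
  by apply: le_trans (mono2 _ _ h); rewrite lerDl.
exists (sup (range u)) => n; apply/andP; split.
  apply: (@ub_le_sup _ (range u)); last by exists n.
  by exists (u 0%N + s 0%N) => _ [m _ <-].
by apply: ge_sup; [exists (u 0%N), 0%N|move=> _ [m _ <-]].
Qed.

(* Compactness of a square by quartering; unlike Cousin's lemma for arbitrary
   partitions it keeps the pieces square, as Goursat's argument requires. *)
Lemma square_induction (P : R -> R -> R -> Prop) x y s : 0 < s ->
  (forall x' y' s', 0 < s' -> P x' y' (s' / 2) -> P (x' + s' / 2) y' (s' / 2) ->
     P x' (y' + s' / 2) (s' / 2) -> P (x' + s' / 2) (y' + s' / 2) (s' / 2) ->
     P x' y' s') ->
  (forall x0 y0, x <= x0 <= x + s -> y <= y0 <= y + s ->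
     exists2 d, 0 < d & forall x' y' s', 0 < s' -> s' < d ->
       x' <= x0 <= x' + s' -> y' <= y0 <= y' + s' -> P x' y' s') ->
  P x y s.
Proof.
move=> s0 quart loc; apply: contrapT => nP.
pose bad (q : R * R * R) := 0 < q.2 /\ ~ P q.1.1 q.1.2 q.2.
pose quarter (q q' : R * R * R) := q'.2 = q.2 / 2 /\
  (q'.1.1 = q.1.1 \/ q'.1.1 = q.1.1 + q.2 / 2) /\
  (q'.1.2 = q.1.2 \/ q'.1.2 = q.1.2 + q.2 / 2).
have next (q : R * R * R) : {q' : R * R * R | bad q -> bad q' /\ quarter q q'}.
  apply: cid; have [bq|nbq] := pselect (bad q); last by exists q.
  case: q bq => [[a b] t] [/= t0 nPt].
  have t20 : 0 < t / 2 by rewrite divr_gt0.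
  apply: contrapT => H; apply: nPt; apply: quart => //; apply: contrapT => nQ; apply: H.
  - by exists (a, b, t / 2) => _; split; split => //=; split; left.
  - by exists (a + t / 2, b, t / 2) => _; split; split => //=; split; [right|left].
  - by exists (a, b + t / 2, t / 2) => _; split; split => //=; split; [left|right].
  - by exists (a + t / 2, b + t / 2, t / 2) => _; split; split => //=; split; right.
pose q n := iter n (fun q => sval (next q)) (x, y, s).
have qbad n : bad (q n).
  by elim: n => [|n IH]; [split|have [] := svalP (next (q n)) IH].
have qq n : quarter (q n) (q n.+1) by have [] := svalP (next (q n)) (qbad n).
have qs n : (q n).2 = s / 2 ^+ n.
  elim: n => [|n IH]; first by rewrite expr0 divr1.
  by have [-> _] := qq n; rewrite IH exprSr invfM mulrA.
have q0 n : 0 <= (q n).2 by case: (qbad n) => /ltW.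
have [x0 hx0] : exists l, forall n, (q n).1.1 <= l <= (q n).1.1 + (q n).2.
  apply: nested_sup => // n; have [e [[e1|e1] _]] := qq n; rewrite ?e ?e1; have := q0 n; lra.
have [y0 hy0] : exists l, forall n, (q n).1.2 <= l <= (q n).1.2 + (q n).2.
  apply: nested_sup => // n; have [e [_ [e1|e1]]] := qq n; rewrite ?e ?e1; have := q0 n; lra.
have [d d0 hd] := loc x0 y0 (hx0 0%N) (hy0 0%N).
have [n hn] : exists n, s / 2 ^+ n < d.
  exists (Num.Def.archi_bound (s / d)).
  rewrite ltr_pdivrMr ?exprn_gt0// mulrC -ltr_pdivrMr//.
  apply: (lt_le_trans (archi_boundP (ltW (divr_gt0 s0 d0)))).
  by rewrite -natrX ler_nat ltnW// ltn_expl.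
have [qn0] := qbad n; apply; apply: hd => //.
by rewrite qs.
Qed.

End SquareInduction.

(** * Complex differentiability in epsilon-delta form *)

Section Differentiability.
Variable R : realType.
Notation C := (R[i]).
Implicit Types (F G : C -> C) (z w l : C).

(** [l] is the complex derivative of [F] at [z]. The difference quotient is cleared of its
    denominator, so [w = z] needs no exclusion and compositions need no case distinction. *)
Definition cdiff F z l := forall e : R, 0 < e -> exists2 d : R, 0 < d &
  forall w, nm (w - z) < d -> nm (F w - F z - l * (w - z)) <= e * nm (w - z).

Definition ccont F z := forall e : R, 0 < e -> exists2 d : R, 0 < d &
  forall w, nm (w - z) < d -> nm (F w - F z) < e.

Lemma cdiff_derivable F z : derivable (F : C^o -> C^o) z 1 -> cdiff F z (cderiv F z).
Proof.
move=> hd e e0; set l := cderiv F z.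
have hcvg : ((fun h : C^o => h^-1 *: (((F : C^o -> C^o) \o shift (z : C^o)) (h *: (1 : C^o)) - F z))
    @ (0 : C^o)^' --> (l : C^o))%classic by exact: hd.
move/cvgrPdist_le : hcvg => /(_ (e%:C)); rewrite ltcR => /(_ e0).
move=> /nbhs_ballP [d /= d0 hb].
have [d1 hd1] : exists d1, d = d1%:C.
  by exists (complex.Re d); apply/esym/RRe_real/gtr0_real.
move: d0; rewrite hd1 ltcR => d10; exists d1 => // w hw.
have [->|wz] := eqVneq w z.
  by rewrite !subrr mulr0 subrr nm0 mulr0.
have := hb (w - z); rewrite /ball /= sub0r normrN hd1 ltr_nm hw => /(_ isT).
rewrite subr_eq0 wz => /(_ isT); rewrite ler_nm.
rewrite /GRing.scale /= mulr1 subrK => hle.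
have wz0 : w - z != 0 by rewrite subr_eq0.
rewrite (_ : _ - _ - _ = - ((l - (w - z)^-1 * (F w - F z)) * (w - z))); last first.
  by field.
by rewrite nmN nmM ler_wpM2r ?nm_ge0.
Qed.

Lemma cdiff_cont F z l : cdiff F z l -> ccont F z.
Proof.
move=> hF e e0; have [d d0 hd] := hF 1 ltr01.
have l0 := nm_ge0 l.
exists (Num.min d (e / (nm l + 2))).
  by rewrite lt_min d0 divr_gt0//; lra.
move=> w; rewrite lt_min ltr_pdivlMr; last lra.
move=> /andP[/hd h1 h2]; rewrite mul1r in h1.
have := nmD (F w - F z - l * (w - z)) (l * (w - z)); rewrite subrK nmM => h3.
by have := nm_ge0 (w - z); nra.
Qed.

Lemma cdiff_cst (k : C) z : cdiff (fun=> k) z 0.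
Proof.
move=> e e0; exists 1 => // w _.
by rewrite subrr mul0r subrr nm0 mulr_ge0 ?nm_ge0// ltW.
Qed.

Lemma cdiff_affine (a b : C) z : cdiff (fun w => a * w + b) z a.
Proof.
move=> e e0; exists 1 => // w _.
by rewrite (_ : _ - _ - _ = 0) ?nm0 ?mulr_ge0 ?nm_ge0// 1?ltW//; ring.
Qed.

Lemma cdiffD F G z l m : cdiff F z l -> cdiff G z m ->
  cdiff (fun w => F w + G w) z (l + m).
Proof.
move=> hF hG e e0; have e20 : 0 < e / 2 by lra.
have [d1 d10 h1] := hF _ e20; have [d2 d20 h2] := hG _ e20.
exists (Num.min d1 d2); first by rewrite lt_min d10.
move=> w; rewrite lt_min => /andP[/h1 {}h1 /h2 {}h2].
rewrite (_ : _ - _ - _ = (F w - F z - l * (w - z)) + (G w - G z - m * (w - z))); last by ring.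
by apply: le_trans (nmD _ _) _; lra.
Qed.

Lemma cdiff_sum (I : Type) (r : seq I) (Fs : I -> C -> C) z (ls : I -> C) :
  (forall i, cdiff (Fs i) z (ls i)) ->
  cdiff (fun w => \sum_(i <- r) Fs i w) z (\sum_(i <- r) ls i).
Proof.
move=> h; elim: r => [|i r IH].
  rewrite big_nil (_ : (fun w => _) = fun=> 0); first exact: cdiff_cst.
  by apply/funext => w; rewrite big_nil.
rewrite big_cons (_ : (fun w => _) = fun w => Fs i w + \sum_(j <- r) Fs j w).
  exact: cdiffD.
by apply/funext => w; rewrite big_cons.
Qed.

Lemma cdiff_comp F G z l m : cdiff G z m -> cdiff F (G z) l ->
  cdiff (fun w => F (G w)) z (l * m).
Proof.
move=> hG hF e e0.
have l0 := nm_ge0 l; have m0 := nm_ge0 m.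
have e10 : 0 < e / (2 * (nm m + 1)) by rewrite divr_gt0//; lra.
have e20 : 0 < e / (2 * (nm l + 1)) by rewrite divr_gt0//; lra.
have [d1 d10 h1] := hF _ e10; have [d2 d20 h2] := hG _ e20.
have [d3 d30 h3] := hG _ ltr01; have [d4 d40 h4] := cdiff_cont hG d10.
exists (Num.min (Num.min d2 d3) d4); first by rewrite !lt_min d20 d30.
move=> w; rewrite !lt_min => /andP[/andP[/h2 {}h2 /h3 {}h3] /h4 {}h4].
rewrite (_ : _ - _ - _ = (F (G w) - F (G z) - l * (G w - G z)) +
   l * (G w - G z - m * (w - z))); last by ring.
apply: le_trans (nmD _ _) _; rewrite nmM.
have hGm : nm (G w - G z) <= (nm m + 1) * nm (w - z).
  have := nmD (G w - G z - m * (w - z)) (m * (w - z)); rewrite subrK nmM; lra.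
have w0 := nm_ge0 (w - z).
have A : nm (F (G w) - F (G z) - l * (G w - G z)) <= e / 2 * nm (w - z).
  apply: le_trans (h1 _ h4) _.
  apply: le_trans (ler_wpM2l (ltW e10) hGm) _.
  by rewrite le_eqVlt; apply/orP; left; apply/eqP; field; lra.
have B : nm l * nm (G w - G z - m * (w - z)) <= e / 2 * nm (w - z).
  apply: le_trans (ler_wpM2l l0 h2) _; rewrite mulrA ler_wpM2r//.
  rewrite mulrA ler_pdivrMr; last lra.
  by nra.
by lra.
Qed.

Lemma cdiffZ F z l (k : C) : cdiff F z l -> cdiff (fun w => k * F w) z (k * l).
Proof.
move=> hF; have := cdiff_comp hF (cdiff_affine k 0 (F z)).
by under eq_fun do rewrite addr0.
Qed.

Lemma cdiff_eqd F z l m : cdiff F z l -> l = m -> cdiff F z m.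
Proof. by move=> h <-. Qed.

Lemma cdiff_near F G z l : (exists2 d : R, 0 < d & forall w, nm (w - z) < d -> F w = G w) ->
  cdiff F z l -> cdiff G z l.
Proof.
move=> [d0 d00 h] hF e e0; have [d d1 hd] := hF _ e0.
exists (Num.min d d0); first by rewrite lt_min d1.
move=> w; rewrite lt_min => /andP[/hd h1 /h h2].
by rewrite -h2 -(h z) ?subrr ?nm0.
Qed.

End Differentiability.

(** * Segments and local-to-global arguments in the upper half plane *)

Section UpperHalfPlane.
Variable R : realType.
Notation C := (R[i]).
Implicit Types (F G : C -> C) (z w l : C).

Definition seg z w (t : R) : C := z + t%:C * (w - z).

Lemma seg0 z w : seg z w 0 = z.
Proof. by rewrite /seg mul0r addr0. Qed.

Lemma seg1 z w : seg z w 1 = w.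
Proof. by rewrite /seg mul1r; ring. Qed.

Lemma segB z w s t : seg z w s - seg z w t = (s - t)%:C * (w - z).
Proof. by rewrite /seg rmorphB /=; ring. Qed.

Lemma nm_segB z w s t : nm (seg z w s - seg z w t) = `|s - t| * nm (w - z).
Proof. by rewrite segB nmM nm_real. Qed.

Lemma Im_seg z w t :
  complex.Im (seg z w t) = (1 - t) * complex.Im z + t * complex.Im w.
Proof. by rewrite /seg ImD ImRM !ReImE; ring. Qed.

Lemma inH_seg z w t : inH z -> inH w -> 0 <= t <= 1 -> inH (seg z w t).
Proof.
rewrite /inH /imC Im_seg => hz hw /andP[t0 t1].
by have [->|tn] := eqVneq t 0; [lra|have : 0 < t by rewrite lt_def tn; nra]; nra.
Qed.

Lemma cdiff0_cst G z w : (forall v, inH v -> cdiff G v 0) ->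
  inH z -> inH w -> G z = G w.
Proof.
move=> hG hz hw; apply/eqP; rewrite eq_sym -subr_eq0 -nm_eq0.
rewrite eq_le nm_ge0 andbT; apply/ler_addgt0Pr => e e0; rewrite add0r.
set k := nm (w - z) + 1.
have k0 : 0 < k by have := nm_ge0 (w - z); rewrite /k; lra.
(* The second coordinate is a dummy: squares serve to bisect the parameter interval. Near [x0] both
   endpoints of a small interval around [x0] are compared with [x0], and their distances to it add
   up to [s]. *)
pose P (x y s : R) := 0 <= x -> x + s <= 1 ->
  nm (G (seg z w (x + s)) - G (seg z w x)) <= e * s.
suff : P 0 0 1.
  by rewrite /P add0r seg0 seg1 mulr1; apply.
apply: square_induction => //.
- move=> x y s s0 h1 h2 _ _ x0 x1; apply: le_trans (nm_triangle _ (G (seg z w (x + s / 2))) _) _.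
  have := h1 x0 _; have := h2 _ _.
  by rewrite (_ : x + s / 2 + s / 2 = x + s); [move=> a b; have := a _ _; have := b _; lra|field].
- move=> x0 y0 hx0 hy0; rewrite add0r in hx0.
  have e1 : 0 < e / k by rewrite divr_gt0.
  have [d d0 hd] := hG _ (inH_seg hz hw hx0) _ e1.
  exists (d / k); first by rewrite divr_gt0.
  move=> x y s s0; rewrite ltr_pdivlMr// => sd /andP[xl xr] _ xge xle.
  have bnd t : `|t - x0| <= s -> nm (G (seg z w t) - G (seg z w x0)) <= e * `|t - x0|.
    move=> ht; have := hd (seg z w t); rewrite mul0r subr0 nm_segB.
    have := nm_ge0 (w - z) => n0; have t0 := normr_ge0 (t - x0).
    move=> h; apply: le_trans (h _) _; first by rewrite /k in sd; nra.
    rewrite (_ : e / k * _ = e * `|t - x0| * (nm (w - z) / k)); last by ring.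
    by rewrite ler_piMr ?mulr_ge0 ?(ltW e0)// ler_pdivrMr// /k; lra.
  have A := bnd (x + s); have B := bnd x.
  apply: le_trans (nm_triangle _ (G (seg z w x0)) _) _; rewrite (nmB (G (seg z w x0))).
  have hA : `|x + s - x0| = x + s - x0 by rewrite ger0_norm; lra.
  have hB : `|x - x0| = x0 - x by rewrite ler0_norm; lra.
  rewrite hA hB in A B.
  have := A _; have := B _; lra.
Qed.

Definition onsquare (x y s : R) z :=
  (x <= complex.Re z <= x + s) /\ (y <= complex.Im z <= y + s).

(** [T b z] is an estimate near [z] that weakens as [b] grows. Besides boundedness this covers
    uniform continuity, with radius 1 / b, and staying below a supremum by 1 / b. *)
Lemma square_bounded (T : R -> C -> Prop) x y s : 0 < s ->
  (forall z b b', b <= b' -> T b z -> T b' z) ->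
  (forall z, onsquare x y s z -> exists2 d : R, 0 < d & exists b, forall w, nm (w - z) < d -> T b w) ->
  exists b, forall z, onsquare x y s z -> T b z.
Proof.
move=> s0 mono loc.
pose P (x' y' s' : R) := exists b, forall z, onsquare x' y' s' z -> T b z.
apply: (@square_induction _ P) => //.
- move=> x' y' s' s'0 [b1 h1] [b2 h2] [b3 h3] [b4 h4].
  exists (Num.max (Num.max b1 b2) (Num.max b3 b4)) => z [/andP[z1 z2] /andP[z3 z4]].
  have [q1|q1] := leP (complex.Re z) (x' + s' / 2);
  have [q2|q2] := leP (complex.Im z) (y' + s' / 2).
  + apply: (mono _ b1); first by rewrite !le_max lexx.
    by apply: h1; split; apply/andP; split; lra.
  + apply: (mono _ b3); first by rewrite !le_max lexx ?orbT.
    by apply: h3; split; apply/andP; split; lra.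
  + apply: (mono _ b2); first by rewrite !le_max lexx ?orbT.
    by apply: h2; split; apply/andP; split; lra.
  + apply: (mono _ b4); first by rewrite !le_max lexx ?orbT.
    by apply: h4; split; apply/andP; split; lra.
- move=> x0 y0 hx hy; have [|d d0 [b hb]] := loc (x0 +i* y0); first by split.
  exists (d / 3); first by lra.
  move=> x' y' s' s'0 sd /andP[a1 a2] /andP[a3 a4]; exists b => w [/andP[w1 w2] /andP[w3 w4]].
  apply: hb; apply: le_lt_trans (nm_ReIm _) _; rewrite !ReImE /=.
  have : `|complex.Re w - x0| <= s' by rewrite ler_norml; apply/andP; split; lra.
  have : `|complex.Im w - y0| <= s' by rewrite ler_norml; apply/andP; split; lra.
  by lra.
Qed.

End UpperHalfPlane.

(** * Moebius action, hyperbolic distance and reduction to a strip *)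

Section Moebius.
Variable R : realType.
Notation C := (R[i]).
Implicit Types (z w v : C) (a b c d : int).

(** The automorphy factor of the bottom row (c, d); with the top row it is also the numerator of
    [mob]. *)
Definition den c d z : C := c%:~R * z + d%:~R.

Lemma den_eq0 c d z : inH z -> den c d z = 0 -> c = 0 /\ d = 0.
Proof.
move=> hz h; have := congr1 (@complex.Im R) h; have := congr1 (@complex.Re R) h.
rewrite /den !ReImE /= !mul0r !addr0 subr0 => hr /eqP.
rewrite mulf_eq0 intr_eq0 (gt_eqF hz) orbF => /eqP c0; split=> //.
by move: hr; rewrite c0 mul0r add0r => /eqP; rewrite intr_eq0 => /eqP.
Qed.

Lemma den_neq0 a b c d z : inH z -> 0 < a * d - b * c -> den c d z != 0.
Proof.
move=> hz h; apply/eqP => /(den_eq0 hz)[c0 d0].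
by move: h; rewrite c0 d0 !mulr0 subr0 ltxx.
Qed.

Lemma mobE a b c d z : mob a b c d z = den a b z / den c d z.
Proof. by []. Qed.

(** Stated for every positive determinant, since the Hecke operator acts through matrices of
    determinant p. *)
Lemma Im_mob a b c d z : inH z -> 0 < a * d - b * c ->
  complex.Im (mob a b c d z) = (a * d - b * c)%:~R * complex.Im z / nm (den c d z) ^+ 2.
Proof.
move=> hz h; have d0 := den_neq0 hz h.
have nd0 : nm (den c d z) ^+ 2 != 0 by rewrite expf_neq0// nm_eq0.
apply: (canRL (mulfK nd0)); rewrite sqr_nm.
have hw : mob a b c d z * den c d z = den a b z by rewrite mobE divfK.
move: (mob a b c d z) hw => w hw.
have := congr1 (@complex.Im R) hw; have := congr1 (@complex.Re R) hw.
rewrite /den !ReImE !mul0r !addr0 !subr0 => e1 e2.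
set x := complex.Re z in e1 e2 *; set y := complex.Im z in e1 e2 *.
set u := complex.Re w in e1 e2 *; set t := complex.Im w in e1 e2 *.
rewrite rmorphB !rmorphM /=.
have -> : (a%:~R * d%:~R - b%:~R * c%:~R) * y =
  (c%:~R * x + d%:~R) * (a%:~R * y) - c%:~R * y * (a%:~R * x + b%:~R) :> R by ring.
by rewrite -e1 -e2; ring.
Qed.

Lemma inH_mob a b c d z : inH z -> 0 < a * d - b * c -> inH (mob a b c d z).
Proof.
move=> hz h; rewrite /inH /imC Im_mob//.
by rewrite divr_gt0 ?mulr_gt0 ?ltr0z ?exprn_gt0 ?nm_gt0 ?(den_neq0 hz h).
Qed.

(** The cocycle relation of the automorphy factor, for an arbitrary row (e, f); applied to both rows
    it gives the composition law of [mob]. *)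
Lemma den_mob e f a' b' c' d' z : den c' d' z != 0 ->
  den e f (mob a' b' c' d' z) * den c' d' z =
  den (e * a' + f * c') (e * b' + f * d') z.
Proof.
move=> d0; rewrite {1}/den mobE mulrDl -mulrA divfK//.
by rewrite /den !rmorphD !rmorphM /=; ring.
Qed.

Lemma mob_comp a b c d a' b' c' d' z : inH z -> 0 < a' * d' - b' * c' ->
  mob a b c d (mob a' b' c' d' z) =
  mob (a * a' + b * c') (a * b' + b * d') (c * a' + d * c') (c * b' + d * d') z.
Proof.
move=> hz h; have d0 := den_neq0 hz h.
rewrite [LHS]mobE [RHS]mobE -!(den_mob _ _ _ _ d0).
by rewrite invfM mulrACA divff// mulr1.
Qed.

Lemma mob1 z : mob 1 0 0 1 z = z.
Proof. by rewrite /mob mul1r addr0 mul0r add0r divr1. Qed.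

Lemma mobB a b c d z w : den c d z != 0 -> den c d w != 0 ->
  mob a b c d z - mob a b c d w =
  (a * d - b * c)%:~R * (z - w) / (den c d z * den c d w).
Proof.
rewrite !mobE /den rmorphB !rmorphM /= => z0 w0.
by field; rewrite z0 w0.
Qed.

(* Up to a monotone reparametrisation this is the hyperbolic distance. *)
Definition rho z w : R := nm (z - w) ^+ 2 / (complex.Im z * complex.Im w).

Lemma rho_mob a b c d z w : inH z -> inH w -> 0 < a * d - b * c ->
  rho (mob a b c d z) (mob a b c d w) = rho z w.
Proof.
move=> hz hw h; have z0 := den_neq0 hz h; have w0 := den_neq0 hw h.
rewrite /rho mobB// !Im_mob// !nmM nmV nmM.
have -> : nm ((a * d - b * c)%:~R : C) = (a * d - b * c)%:~R.
  by rewrite -(rmorph_int (real_complex R)) nm_real gtr0_norm// ltr0z.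
have D0 : (a * d - b * c)%:~R != 0 :> R by rewrite gt_eqF// ltr0z.
move: z0 w0; rewrite -!nm_eq0; move: (nm _) (nm _) => m n z0 w0.
move: hz hw; rewrite /inH /imC => /gt_eqF/negbT hz /gt_eqF/negbT hw.
move: (_%:~R) D0 => D D0.
by field; rewrite z0 w0 D0 hz hw.
Qed.

Lemma rhoC z w : rho z w = rho w z.
Proof. by rewrite /rho nmB mulrC [complex.Im z * _]mulrC mulrC. Qed.

Lemma rho_le z w (k : R) : inH z -> inH w ->
  (rho z w <= k) = (nm (z - w) ^+ 2 <= k * (complex.Im z * complex.Im w)).
Proof. by move=> hz hw; rewrite /rho ler_pdivrMr// mulr_gt0. Qed.

Lemma SL2_det a b c d : inSL2 a b c d -> 0 < a * d - b * c.
Proof. by rewrite /inSL2 => ->. Qed.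

Lemma inH_SL2 a b c d z : inH z -> inSL2 a b c d -> inH (mob a b c d z).
Proof. by move=> hz /SL2_det; exact: inH_mob. Qed.

Lemma SL2_mul a b c d a' b' c' d' : inSL2 a b c d -> inSL2 a' b' c' d' ->
  inSL2 (a * a' + b * c') (a * b' + b * d') (c * a' + d * c') (c * b' + d * d').
Proof.
rewrite /inSL2 => h1 h2.
rewrite (_ : _ - _ = (a * d - b * c) * (a' * d' - b' * c')); last by ring.
by rewrite h1 h2.
Qed.

Lemma SL2_inv a b c d : inSL2 a b c d -> inSL2 d (- b) (- c) a.
Proof. by rewrite /inSL2 => <-; ring. Qed.

Lemma mobK a b c d z : inH z -> inSL2 a b c d ->
  mob d (- b) (- c) a (mob a b c d z) = z.
Proof.
move=> hz h; rewrite mob_comp ?SL2_det//; move: h; rewrite /inSL2 => h.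
rewrite -[RHS]mob1; congr mob; [|ring|ring|]; rewrite -h; ring.
Qed.

Lemma translate_strip z : exists n : int, `|complex.Re (z + n%:~R)| <= 1 / 2.
Proof.
exists (- Num.floor (complex.Re z + 1 / 2)).
have := floor_itv (complex.Re z + 1 / 2); rewrite intrD /=.
rewrite ReD rmorphN /= ReN ReInt.
by rewrite ler_norml => /andP[h1 h2]; apply/andP; split; lra.
Qed.

Lemma mob_translate (m : int) z : mob 1 m 0 1 z = z + m%:~R.
Proof. by rewrite /mob mul1r mul0r add0r divr1. Qed.

Lemma mob_S z : mob 0 (-1) 1 0 z = - z^-1.
Proof. by rewrite /mob mul0r add0r mul1r addr0 mulN1r. Qed.

(* If Im z < 1/2 in the strip then |z|^2 <= 1/2, so z -> -1/z doubles the imaginary part. *)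
Lemma fundamental_reduction z : inH z -> exists a b c d, inSL2 a b c d /\
  `|complex.Re (mob a b c d z)| <= 1 / 2 /\ 1 / 2 <= complex.Im (mob a b c d z).
Proof.
move=> hz; have [n hn] : exists n : nat, 1 / 2 <= 2 ^+ n * complex.Im z.
  exists (Num.Def.archi_bound (complex.Im z)^-1).
  have := archi_boundP (ltW (_ : 0 < (complex.Im z)^-1)); rewrite invr_gt0 => /(_ hz).
  set m := Num.Def.archi_bound _ => h.
  have h2 : (complex.Im z)^-1 <= 2 ^+ m.
    by apply: le_trans (ltW h) _; rewrite -natrX ler_nat ltnW// ltn_expl.
  by move: h2; rewrite -[leLHS]mul1r ler_pdivrMr// => h2; lra.
elim: n z hz hn => [|n IH] z hz hn; have [m hm] := translate_strip z.
  exists 1, m, 0, 1; split; first by rewrite /inSL2 !mulr0 subr0 mulr1.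
  rewrite mob_translate; split=> //; rewrite ImD ImInt addr0.
  by move: hn; rewrite expr0; lra.
set z1 := z + m%:~R in hm.
have e1 : complex.Im z1 = complex.Im z by rewrite ImD ImInt addr0.
have h1 : inH z1 by rewrite /inH /imC e1.
have [h|h] := leP (1 / 2) (complex.Im z).
  exists 1, m, 0, 1; split; first by rewrite /inSL2 !mulr0 subr0 mulr1.
  by rewrite mob_translate; split=> //; rewrite e1.
have sd : 0 < 0 * 0 - (-1) * 1 :> int by [].
have hS : 2 * complex.Im z <= complex.Im (mob 0 (-1) 1 0 z1).
  rewrite Im_mob// e1 (_ : (_ * _ - _)%:~R = 1) ?mul1r; last first.
    by rewrite !mul0r mulN1r opprK.
  rewrite ler_pdivlMr; last by rewrite exprn_gt0// nm_gt0 (den_neq0 h1 sd).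
  rewrite mulrAC ler_piMl//; first exact: ltW.
  rewrite /den mul1r addr0 sqr_nm e1.
  move: hm; rewrite -(real_normK (num_real (complex.Re z1))) => hm.
  have := normr_ge0 (complex.Re z1); have : 0 < complex.Im z by [].
  by nra.
have h2 := inH_mob h1 sd.
have [] := IH _ h2.
  have : 0 < 2 ^+ n :> R by rewrite exprn_gt0.
  by move: hn; rewrite exprS => hn ?; apply: le_trans hn _; rewrite -mulrA mulrCA ler_wpM2l// ltW.
move=> a [b [c [d [hs [hr hi]]]]].
have s1 : inSL2 0 (-1) 1 m by rewrite /inSL2 mul0r mulN1r opprK add0r.
have E : mob a b c d (mob 0 (-1) 1 0 z1) =
  mob (a * 0 + b * 1) (a * (-1) + b * m) (c * 0 + d * 1) (c * (-1) + d * m) z.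
  rewrite -mob_comp ?SL2_det//; congr mob; rewrite mob_S.
  by rewrite /mob mul0r add0r mul1r mulN1r.
by exists (a * 0 + b * 1), (a * (-1) + b * m), (c * 0 + d * 1), (c * (-1) + d * m);
  split; [exact: SL2_mul|rewrite -E].
Qed.

End Moebius.

(** * Finiteness of Gamma_0(N) in SL_2(Z) and uniform constants *)

Section Cosets.
Implicit Types (a b c d : int) (N : nat).

(** The level is [N.+1] here, so that residues modulo the level are elements of 'I_N.+1. *)
Definition bottom_key N (c d : int) : 'I_N.+1 * 'I_N.+1 :=
  (inord `|(c %% N.+1)%Z|, inord `|(d %% N.+1)%Z|).

Lemma bottom_keyP N c d c' d' : bottom_key N c d = bottom_key N c' d' ->
  (N.+1%:Z %| c - c')%Z /\ (N.+1%:Z %| d - d')%Z.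
Proof.
have H x y : inord `|(x %% N.+1)%Z| = inord `|(y %% N.+1)%Z| :> 'I_N.+1 -> (N.+1%:Z %| x - y)%Z.
  move=> /(congr1 (@nat_of_ord _)).
  have lt z : (`|(z %% N.+1)%Z| < N.+1)%N.
    by rewrite -ltz_nat abszE ger0_norm ?modz_ge0// ltz_pmod.
  rewrite !inordK// => h; rewrite -eqz_mod_dvd; apply/eqP.
  by rewrite -[LHS]gez0_abs ?modz_ge0// h gez0_abs ?modz_ge0.
by move=> [] h1 h2; split; exact: H.
Qed.

(** The witness is the first matrix times the inverse of the second. Its lower left entry c d' - d
    c' equals (c - c') d' - (d - d') c', so the level divides it. *)
Lemma Gamma0_quotient N a b c d a' b' c' d' : inSL2 a b c d -> inSL2 a' b' c' d' ->
  (N%:Z %| c - c')%Z -> (N%:Z %| d - d')%Z ->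
  exists a1 b1 c1 d1, inGamma0 N a1 b1 c1 d1 /\
    a = a1 * a' + b1 * c' /\ b = a1 * b' + b1 * d' /\
    c = c1 * a' + d1 * c' /\ d = c1 * b' + d1 * d'.
Proof.
move=> h h' hc hd.
exists (a * d' - b * c'), (b * a' - a * b'), (c * d' - d * c'), (d * a' - c * b').
split; last first.
  move: h'; rewrite /inSL2 => h'.
  split; [|split; [|split]]; rewrite -[LHS]mulr1 -h'; ring.
split.
  move: h h'; rewrite /inSL2 => h h'.
  rewrite (_ : _ - _ = (a * d - b * c) * (a' * d' - b' * c')); last by ring.
  by rewrite h h'.
rewrite (_ : _ - _ = (c - c') * d' - (d - d') * c'); last by ring.
by rewrite rpredB// dvdz_mulr.
Qed.

Variable R : realType.

(* SL_2(Z) has finitely many cosets modulo Gamma_0(N), indexed by bottom rows mod N. *)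
Lemma coset_seq (T : eqType) N (P : int -> int -> int -> int -> T -> Prop) (x0 : T) : (0 < N)%N ->
  (forall a b c d a' b' c' d' x, inGamma0 N a b c d -> inSL2 a' b' c' d' ->
     P a' b' c' d' x ->
     P (a * a' + b * c') (a * b' + b * d') (c * a' + d * c') (c * b' + d * d') x) ->
  (forall a b c d, inSL2 a b c d -> exists x, P a b c d x) ->
  exists s : seq T, forall a b c d, inSL2 a b c d -> exists2 x, x \in s & P a b c d x.
Proof.
case: N => // N _ inv ex.
have H k : {x : T | forall a b c d, inSL2 a b c d -> bottom_key N c d = k -> P a b c d x}.
  apply: cid.
  have [[a' [b' [c' [d' [h' hk]]]]]|no] := pselect (exists a b c d, inSL2 a b c d /\ bottom_key N c d = k).
    have [x hx] := ex _ _ _ _ h'; exists x => a b c d h; rewrite -hk => /bottom_keyP[hc hd].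
    have [a1 [b1 [c1 [d1 [h1 [-> [-> [-> ->]]]]]]]] := Gamma0_quotient h h' hc hd.
    exact: inv.
  (* Residue pairs that are no bottom row receive the default [x0], so the resulting list may
     contain values that belong to no matrix. *)
  by exists x0 => a b c d h hk; exfalso; apply: no; exists a, b, c, d.
exists [seq sval (H k) | k <- enum {: 'I_N.+1 * 'I_N.+1}] => a b c d h.
exists (sval (H (bottom_key N c d))); last exact: (svalP (H _)).
by apply/map_f; rewrite mem_enum.
Qed.

(** The source of uniformity over all cusps: an estimate compatible with left multiplication by
    Gamma_0(N) holds with the maximum of the constants found for finitely many representatives. *)
Lemma coset_uniform N (P : int -> int -> int -> int -> R -> Prop) : (0 < N)%N ->
  (forall a b c d x y, x <= y -> P a b c d x -> P a b c d y) ->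
  (forall a b c d a' b' c' d' x, inGamma0 N a b c d -> inSL2 a' b' c' d' ->
     P a' b' c' d' x ->
     P (a * a' + b * c') (a * b' + b * d') (c * a' + d * c') (c * b' + d * d') x) ->
  (forall a b c d, inSL2 a b c d -> exists x, P a b c d x) ->
  exists x, forall a b c d, inSL2 a b c d -> P a b c d x.
Proof.
move=> N0 mono inv ex; have [s hs] := coset_seq (0 : R) N0 inv ex.
exists (\big[Num.max/0]_(x <- s) x) => a b c d h; have [x xs hx] := hs _ _ _ _ h.
by apply: mono hx; rewrite le_bigmax_seq.
Qed.

End Cosets.

(** * Uniform multiplicative continuity of f in the hyperbolic metric *)

Section RatioBounds.
Variable R : realType.
Notation C := (R[i]).
Implicit Types (z w v L : C) (a b c d : int) (e x y : R).

Lemma ratio_near L z w e : L != 0 -> 0 < e -> e <= 1 ->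
  nm (z - L) < nm L * (e / 4) -> nm (w - L) < nm L * (e / 4) -> nm (w / z - 1) < e.
Proof.
rewrite -nm_gt0 => L0 e0 e1 hz hw.
have z0 : nm L * (3 / 4) < nm z.
  by have := nm_sub L (L - z); rewrite subKr (nmB L z); nra.
have zn0 : z != 0 by rewrite -nm_gt0; nra.
rewrite (_ : w / z - 1 = (w - z) / z); last by field.
rewrite nmM nmV ltr_pdivrMr; last by rewrite nm_gt0.
have := nm_triangle w L z; rewrite (nmB L z); nra.
Qed.

Lemma mob_cont a b c d z : inH z -> 0 < a * d - b * c -> ccont (mob a b c d) z.
Proof.
move=> hz h e e0; have d0 := den_neq0 hz h.
set m := nm (den c d z); have m0 : 0 < m by rewrite nm_gt0.
set D : R := (a * d - b * c)%:~R; have D0 : 0 < D by rewrite ltr0z.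
set k : R := `|c%:~R| + 1; have k0 : 0 < k by rewrite ltr_pwDr.
exists (Num.min (m / (2 * k)) (e * m ^+ 2 / (2 * D))).
  by rewrite lt_min !divr_gt0 ?mulr_gt0 ?exprn_gt0.
move=> w; rewrite lt_min => /andP[h1 h2].
have hw : m / 2 <= nm (den c d w).
  have e1 : den c d z - den c d w = c%:~R * (z - w) by rewrite /den; ring.
  have := nm_sub (den c d z) (den c d w); rewrite e1 nmM -/m.
  have -> : nm (c%:~R : C) = `|c%:~R| by rewrite -(rmorph_int (real_complex R)) nm_real.
  move: h1; rewrite ltr_pdivlMr ?mulr_gt0// (nmB z w) => h1.
  by have := nm_ge0 (w - z); rewrite /k in h1; nra.
have w0 : den c d w != 0 by rewrite -nm_gt0; apply: lt_le_trans hw; lra.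
rewrite mobB// !nmM nmV nmM -/m.
have -> : nm ((a * d - b * c)%:~R : C) = D.
  by rewrite -(rmorph_int (real_complex R)) nm_real gtr0_norm.
move: h2; rewrite ltr_pdivlMr ?mulr_gt0// => h2.
rewrite ltr_pdivrMr; last by rewrite mulr_gt0// nm_gt0.
apply: (@lt_le_trans _ _ (e * (m / 2 * m))); first by have := nm_ge0 (w - z); nra.
by rewrite ler_wpM2l ?(ltW e0)// ler_wpM2r// ltW.
Qed.

Lemma ccont_comp (F G : C -> C) z : ccont G z -> ccont F (G z) -> ccont (fun w => F (G w)) z.
Proof.
by move=> hG hF e e0; have [d d0 hd] := hF _ e0; have [d' d'0 hd'] := hG _ d0;
  exists d' => // w /hd' /hd.
Qed.

Variables (N : nat) (f : C -> C).
Hypothesis N0 : (0 < N)%N.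
Hypothesis f_gmf : GMF0 N f.
Hypothesis f_div : div_zero f.

Lemma f_cdiff z : inH z -> cdiff f z (cderiv f z).
Proof. by move=> hz; apply: cdiff_derivable; case: f_gmf => h _; exact: h. Qed.

Lemma f_neq0 z : inH z -> f z != 0.
Proof. by case: f_div => h _; exact: h. Qed.

Lemma f_Gamma_ratio a b c d z w : inGamma0 N a b c d -> inH z -> inH w ->
  f (mob a b c d w) / f (mob a b c d z) = f w / f z.
Proof.
case: f_gmf => _ [chi [[chi0 _] hchi]] hg hz hw; rewrite !(hchi _ _ _ _ _ hg)//.
rewrite -mulf_div divff ?mul1r//; exact: chi0 hg.
Qed.

Lemma ratio_cusp e : 0 < e -> exists Y : R, forall a b c d, inSL2 a b c d ->
  forall z w, inH z -> inH w -> Y < complex.Im z -> Y < complex.Im w ->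
  nm (f (mob a b c d w) / f (mob a b c d z) - 1) < e.
Proof.
move=> e0; pose P a b c d (Y : R) := forall z w, inH z -> inH w -> Y < complex.Im z -> Y < complex.Im w ->
  nm (f (mob a b c d w) / f (mob a b c d z) - 1) < e.
apply: (@coset_uniform R N P) => //.
- by move=> a b c d x y xy h z w hz hw h1 h2; apply: h => //; apply: le_lt_trans xy _.
- move=> a b c d a' b' c' d' x hg h' h z w hz hw h1 h2.
  by rewrite -!mob_comp ?SL2_det// (f_Gamma_ratio hg) ?h//; apply: inH_SL2.
- move=> a b c d h; have [_ /(_ _ _ _ _ h)[L [L0 hL]]] := f_div.
  pose e' := Num.min e 1; have e'0 : 0 < e' by rewrite lt_min e0 ltr01.
  have e'1 : e' <= 1 by rewrite ge_min lexx orbT.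
  have e'e : e' <= e by rewrite ge_min lexx.
  have [|Y hY] := hL (nm L * (e' / 4)); first by rewrite mulr_gt0 ?nm_gt0//; lra.
  exists Y => z w hz hw h1 h2; apply: lt_le_trans e'e.
  by apply: (@ratio_near L) => //; rewrite -ltr_nm; apply: hY.
Qed.

(** The radius of continuity is written as 1 / x, so that a larger [x] is a weaker claim, as
    [coset_uniform] and [square_bounded] require. *)
Lemma ratio_compact e (Y : R) : 0 < e -> 1 <= Y -> exists x, forall a b c d, inSL2 a b c d ->
  forall z w, inH w -> `|complex.Re z| <= 1 / 2 -> 1 / 2 <= complex.Im z <= Y ->
  nm (w - z) * x < 1 -> nm (f (mob a b c d w) / f (mob a b c d z) - 1) < e.
Proof.
move=> e0 Y1; pose P a b c d x := forall z w, inH w -> `|complex.Re z| <= 1 / 2 -> 1 / 2 <= complex.Im z <= Y ->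
  nm (w - z) * x < 1 -> nm (f (mob a b c d w) / f (mob a b c d z) - 1) < e.
apply: (@coset_uniform R N P) => //.
- move=> a b c d x y xy h z w hw h1 h2 h3; apply: h => //; apply: le_lt_trans h3.
  by rewrite ler_wpM2l// nm_ge0.
- move=> a b c d a' b' c' d' x hg h' h z w hw h1 h2 h3.
  have hz : inH z by rewrite /inH /imC; case/andP: h2; lra.
  by rewrite -!mob_comp ?SL2_det// (f_Gamma_ratio hg) ?h//; apply: inH_SL2.
- move=> a b c d h.
  pose g z := f (mob a b c d z).
  pose T x z := forall w, inH w -> nm (w - z) * x < 1 -> nm (g w / g z - 1) < e.
  (* The square [-Y, Y] x [1/2, 1/2 + 2 Y] contains the part of the strip in question, because [Y]
     is at least 1. *)
  have [|||x hx] := @square_bounded R (fun x => T x) (- Y) (1 / 2) (2 * Y).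
  + by lra.
  + move=> z x x' xx' hT w hw hwx; apply: hT => //; apply: le_lt_trans hwx.
    by rewrite ler_wpM2l// nm_ge0.
  + move=> z [_ /andP[hz _]].
    have {}hz : inH z by rewrite /inH /imC; lra.
    have hm := inH_SL2 hz h; have g0 : g z != 0 by apply: f_neq0.
    pose e' := Num.min e 1; have e'0 : 0 < e' by rewrite lt_min e0 ltr01.
    have e'1 : e' <= 1 by rewrite ge_min lexx orbT.
    have e'e : e' <= e by rewrite ge_min lexx.
    have [|k k0 hk] := ccont_comp (mob_cont hz (SL2_det h)) (cdiff_cont (f_cdiff hm)) (e := nm (g z) * (e' / 4)).
      by rewrite mulr_gt0 ?nm_gt0//; lra.
    exists (k / 2); first by lra.
    exists (2 / k) => v hv w hw; rewrite mulrA ltr_pdivrMr// mul1r => hwv.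
    apply: lt_le_trans e'e; apply: (@ratio_near (g z)) => //; apply: hk; first lra.
    by have := nm_triangle w v z; lra.
  exists x => z w hw /ler_normlP[h1 h2] /andP[h3 h4] h5; apply: hx => //.
  by split; apply/andP; split; lra.
Qed.

(** For heights p and q the hypothesis gives (p - q)^2 <= p q / 4, which is impossible if one height
    exceeds twice the other. *)
Lemma rho_Im z w x : inH z -> inH w -> rho z w <= x -> x <= 1 / 4 ->
  complex.Im z <= 2 * complex.Im w /\ complex.Im w <= 2 * complex.Im z.
Proof.
rewrite /inH /imC => hz hw; rewrite rho_le// => h h2.
have : (complex.Im z - complex.Im w) ^+ 2 <= nm (z - w) ^+ 2.
  by rewrite sqr_nm !ReImE lerDr sqr_ge0.
move: (complex.Im z) (complex.Im w) hz hw h => p q p0 q0 h h3.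
have {h3}h : (p - q) ^+ 2 <= p * q / 4.
  by apply: le_trans h3 (le_trans h _); have := mulr_gt0 p0 q0; nra.
by split; rewrite leNgt; apply/negP => hlt; nra.
Qed.

(** Since [rho] is invariant, both points may be moved so that the first lies in the strip. High
    points are handled by the limit at the cusp, the remaining ones by compactness. *)
Lemma ratio_uniform e : 0 < e -> exists2 k : R, 0 < k & forall z w, inH z -> inH w ->
  rho z w <= k -> nm (f w / f z - 1) < e.
Proof.
move=> e0; have [Y0 hY0] := ratio_cusp e0.
pose Y := Num.max Y0 1.
have Y1 : 1 <= Y by rewrite le_max lexx orbT.
have YY : Y0 <= Y by rewrite le_max lexx.
have Y2 : 1 <= 2 * Y by lra.
have [x0 hx0] := ratio_compact e0 Y2; pose x := Num.max x0 1.
have x1 : 1 <= x by rewrite le_max lexx orbT.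
have xx : x0 <= x by rewrite le_max lexx.
have p0 : 0 < (16 * (x * Y) ^+ 2)^-1.
  by rewrite invr_gt0 mulr_gt0// exprn_gt0// mulr_gt0//; lra.
(* If Im z' <= 2 Y, then Im w' <= 4 Y, and this choice gives |z' - w'|^2 <= 8 Y^2 / (16 x^2 Y^2) < 1
   / x^2. *)
exists (Num.min (1 / 4) (16 * (x * Y) ^+ 2)^-1).
  by rewrite lt_min p0 andbT; lra.
move=> z w hz hw; rewrite le_min => /andP[r1 r2].
have [a [b [c [d [h [hr hi]]]]]] := fundamental_reduction hz.
have -> : f z = f (mob d (- b) (- c) a (mob a b c d z)) by rewrite mobK.
have -> : f w = f (mob d (- b) (- c) a (mob a b c d w)) by rewrite mobK.
have hz' := inH_SL2 hz h; have hw' := inH_SL2 hw h.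
rewrite -(rho_mob hz hw (SL2_det h)) in r1 r2.
move: (mob a b c d z) (mob a b c d w) hr hi hz' hw' r1 r2 => z' w' hr hi hz' hw' r1 r2.
have hV := SL2_inv h.
have [i1 i2] := rho_Im hz' hw' r1 (lexx _).
(* The cut is at 2 Y because the height of [w'] is only known to be at least half that of [z']; both
   must exceed Y in the cusp case. *)
have [hY|hY] := leP (complex.Im z') (2 * Y).
  apply: hx0 => //; first by rewrite hi.
  apply: (@le_lt_trans _ _ (nm (w' - z') * x)); first by rewrite ler_wpM2l// nm_ge0.
  have xY : 0 < (x * Y) ^+ 2 by rewrite exprn_gt0// mulr_gt0//; lra.
  move: r2; rewrite rho_le// ler_pdivlMl; last by rewrite mulr_gt0.
  move=> r2.
  have hb : nm (z' - w') ^+ 2 * x ^+ 2 * Y ^+ 2 <= (complex.Im z' * complex.Im w') / 16.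
    by move: r2; rewrite exprMn; lra.
  have hc : complex.Im z' * complex.Im w' <= 8 * Y ^+ 2.
    by rewrite /inH /imC in hz' hw'; nra.
  have Y20 : 0 < Y ^+ 2 by rewrite exprn_gt0//; lra.
  have hd : nm (z' - w') ^+ 2 * x ^+ 2 < 1 by rewrite -(ltr_pM2r Y20); lra.
  rewrite nmB -(ltr_pXn2r (n := 2)) ?nnegrE ?mulr_ge0 ?nm_ge0//; last lra.
  by rewrite exprMn expr1n.
by apply: hY0 => //; lra.
Qed.

End RatioBounds.

(** * Construction of a global logarithm F of f *)

Section LogLift.
Variable R : realType.
Notation C := (R[i]).
Implicit Types (z w v : C) (k e x y s t : R).

(** Replaces the triangle inequality, which [rho] does not satisfy: the 8 consists of a 2 from
    squaring a sum and of the factors 2 by which the heights may differ. *)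
Lemma rho_quasi z w v k : inH z -> inH w -> inH v -> k <= 1 / 4 ->
  rho z w <= k -> rho w v <= k -> rho z v <= 8 * k.
Proof.
move=> hz hw hv k4 h1 h2.
have [_ i1] := rho_Im hz hw h1 k4; have [i2 _] := rho_Im hw hv h2 k4.
have k0 : 0 <= k by apply: le_trans h1; rewrite /rho divr_ge0 ?sqr_ge0// mulr_ge0// ltW.
move: h1 h2; rewrite !rho_le// => h1 h2.
have h3 := nm_triangle z w v.
have h4 : nm (z - v) ^+ 2 <= 2 * (nm (z - w) ^+ 2 + nm (w - v) ^+ 2).
  have := nm_ge0 (z - v); have := nm_ge0 (z - w); have := nm_ge0 (w - v).
  move: (nm (z - v)) (nm (z - w)) (nm (w - v)) h3 => p q r hp r0 q0 p0.
  have := sqr_ge0 (q - r).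
  have : p ^+ 2 <= (q + r) ^+ 2 by rewrite ler_pXn2r ?nnegrE ?addr_ge0.
  by lra.
apply: (le_trans h4); rewrite /inH /imC in hz hw hv.
move: (complex.Im z) (complex.Im w) (complex.Im v) hz hw hv i1 i2 h1 h2 => p q r p0 q0 r0 i1 i2 h1 h2.
have : p * q <= p * (2 * r) by rewrite ler_pM2l.
have : q * r <= 2 * p * r by rewrite ler_pM2r.
move=> a1 a2; have a3 : k * (q * r) <= k * (2 * p * r) by rewrite ler_wpM2l.
have a4 : k * (p * q) <= k * (p * (2 * r)) by rewrite ler_wpM2l.
by lra.
Qed.

Lemma Im_seg_ge z w t y : y <= complex.Im z -> y <= complex.Im w -> 0 <= t <= 1 ->
  y <= complex.Im (seg z w t).
Proof.
move=> h1 h2 /andP[r0 r1]; rewrite Im_seg.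
have : 0 <= (1 - t) * (complex.Im z - y) by rewrite mulr_ge0//; lra.
have : 0 <= t * (complex.Im w - y) by rewrite mulr_ge0//; lra.
by lra.
Qed.

Lemma Im_seg_gt z w t y : y < complex.Im z -> y < complex.Im w -> 0 <= t <= 1 ->
  y < complex.Im (seg z w t).
Proof.
move=> h1 h2 ht; apply: (@lt_le_trans _ _ (Num.min (complex.Im z) (complex.Im w))).
  by rewrite lt_min h1.
by apply: Im_seg_ge => //; rewrite ge_min lexx ?orbT.
Qed.

Lemma seg_mesh z w k : inH z -> inH w -> 0 < k -> exists m0 : nat, forall m, (m0 <= m)%N ->
  forall s t, 0 <= s <= 1 -> 0 <= t <= 1 -> `|s - t| <= m%:R^-1 ->
  rho (seg z w s) (seg z w t) <= k.
Proof.
move=> hz hw k0; pose eta := Num.min (complex.Im z) (complex.Im w).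
have eta0 : 0 < eta by rewrite lt_min hz.
have etaz : eta <= complex.Im z by rewrite ge_min lexx.
have etaw : eta <= complex.Im w by rewrite ge_min lexx orbT.
pose q := nm (w - z) ^+ 2 / (k * eta ^+ 2).
have ke : 0 < k * eta ^+ 2 by rewrite mulr_gt0// exprn_gt0.
have q0 : 0 <= q by rewrite divr_ge0 ?sqr_ge0// ltW.
exists (Num.Def.archi_bound q).+1 => m hm s t hs ht hst.
have m1 : 1 <= m%:R :> R by rewrite ler1n (leq_trans _ hm).
have qm : q <= m%:R.
  by apply: ltW; apply: lt_le_trans (archi_boundP q0) _; rewrite ler_nat; apply: leq_trans hm.
have hI r : 0 <= r <= 1 -> eta <= complex.Im (seg z w r) by exact: Im_seg_ge.
have hIs := hI _ hs; have hIt := hI _ ht.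
rewrite rho_le; try exact: inH_seg.
rewrite nm_segB exprMn.
apply: (@le_trans _ _ (k * eta ^+ 2)); last first.
  by rewrite ler_wpM2l ?(ltW k0)// expr2 ler_pM// ltW.
move: qm; rewrite ler_pdivrMr// => qm.
apply: le_trans (_ : m%:R^-1 * (m%:R * (k * eta ^+ 2)) <= _); last first.
  by rewrite mulKf// gt_eqF//; lra.
apply: ler_pM; rewrite ?sqr_ge0//.
apply: (@le_trans _ _ (m%:R^-1 ^+ 2)).
  by rewrite ler_pXn2r// nnegrE invr_ge0.
by rewrite expr2 ler_piMl ?invr_ge0// invf_le1//; lra.
Qed.

Lemma grid_in01 (j n : nat) : (j <= n)%N -> 0 <= (j%:R / n%:R : R) <= 1.
Proof.
case: n => [|n] jn; first by rewrite invr0 mulr0 lexx ler01.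
by rewrite divr_ge0//= ler_pdivrMr// mul1r ler_nat.
Qed.

Lemma grid_step (j n : nat) : `|j.+1%:R / n%:R - j%:R / n%:R| <= n%:R^-1 :> R.
Proof.
by rewrite -mulrBl -natrB// subSnn mul1r ger0_norm// invr_ge0.
Qed.

(** The half plane above height [Y] is convex, so two of its points are joined along a segment by
    finitely many steps with [rho <= k]. *)
Lemma local_cst_cst (T : Type) (G : C -> T) (Y k : R) : 0 <= Y -> 0 < k ->
  (forall z w, Y < complex.Im z -> Y < complex.Im w -> rho z w <= k -> G z = G w) ->
  forall z w, Y < complex.Im z -> Y < complex.Im w -> G z = G w.
Proof.
move=> Y0 k0 loc z w hz hw.
have hz' : inH z by apply: le_lt_trans hz. have hw' : inH w by apply: le_lt_trans hw.
have [m0 hm0] := seg_mesh hz' hw' k0.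
pose m := m0.+1.
have H j : (j <= m)%N -> G (seg z w (j%:R / m%:R)) = G z.
  elim: j => [|j IH] jm; first by rewrite mul0r seg0.
  rewrite -IH ?(ltnW jm)//; apply/esym/loc.
  - by apply: Im_seg_gt => //; exact/grid_in01/ltnW.
  - by apply: Im_seg_gt => //; exact: grid_in01.
  - rewrite rhoC; apply: (hm0 m) => //; [exact: grid_in01|exact/grid_in01/ltnW|exact: grid_step].
by rewrite -(H m)// divff ?seg1// pnatr_eq0.
Qed.

Variable f : C -> C.
Hypothesis f0 : forall z, inH z -> f z != 0.
Variable kappa : R.
Hypothesis kappa0 : 0 < kappa.
Hypothesis fk : forall z w, inH z -> inH w -> rho z w <= kappa -> nm (f w / f z - 1) < 1 / 2.

Definition dlog z w := LogRH (f w / f z).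

Lemma dlog_add z w v : inH z -> inH w -> inH v ->
  0 < complex.Re (f w / f z) -> 0 < complex.Re (f v / f w) -> 0 < complex.Re (f v / f z) ->
  dlog z v = dlog z w + dlog w v.
Proof.
move=> hz hw hv h1 h2 h3.
have E : f v / f z = f w / f z * (f v / f w) by field; rewrite !f0.
by rewrite /dlog E LogRHM// -E.
Qed.

Lemma ratio_Re z w : inH z -> inH w -> rho z w <= kappa -> 0 < complex.Re (f w / f z).
Proof. by move=> hz hw h; apply: Re_near1; have := fk hz hw h; lra. Qed.

Lemma dlog_add_near z w v : inH z -> inH w -> inH v ->
  rho z w <= kappa -> rho w v <= kappa -> rho z v <= kappa ->
  dlog z v = dlog z w + dlog w v.
Proof. by move=> hz hw hv h1 h2 h3; apply: dlog_add => //; exact: ratio_Re. Qed.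

(** Stands for the integral of f' / f along the segment from i to z. Its terms are exact increments
    of a logarithm once the mesh is fine, so the sums become stationary under doubling of [n] and no
    limit is taken. *)
Let S n z := \sum_(j < n) dlog (seg 'i z (j%:R / n%:R)) (seg 'i z (j.+1%:R / n%:R)).

Let inHi : inH ('i : C). Proof. by rewrite /inH /imC /= ltr01. Qed.

Let S_double z : inH z -> exists n0, forall n, (n0 <= n)%N -> S (2 * n) z = S n z.
Proof.
move=> hz; have [n0 hn0] := seg_mesh inHi hz kappa0.
exists n0.+1 => n hn; have n_gt0 : (0 < n)%N by apply: leq_trans hn.
have nR : n%:R != 0 :> R by rewrite pnatr_eq0 -lt0n.
have {}hn0 := hn0 _ (ltnW hn).
have E (a : nat -> C) m : \sum_(j < 2 * m) a j = \sum_(j < m) (a (2 * j)%N + a (2 * j).+1).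
  elim: m => [|m IH]; first by rewrite !big_ord0.
  by rewrite mulnS !big_ord_recr /= IH addrA.
rewrite /S (E (fun j => dlog (seg 'i z (j%:R / (2 * n)%:R)) (seg 'i z (j.+1%:R / (2 * n)%:R)))).
apply: eq_bigr => j _.
have jn : (j.+1 <= n)%N by [].
have e1 : (2 * j)%:R / (2 * n)%:R = j%:R / n%:R :> R.
  by rewrite !natrM; field.
have e2 : (2 * j).+2%:R / (2 * n)%:R = j.+1%:R / n%:R :> R.
  by rewrite (_ : (2 * j).+2 = (2 * j.+1)%N) ?mulnS// !natrM; field.
rewrite e1 e2; apply/esym.
have g1 : 0 <= ((2 * j).+1%:R / (2 * n)%:R : R) <= 1 by apply: grid_in01; lia.
have g0 : 0 <= (j%:R / n%:R : R) <= 1 by apply: grid_in01; lia.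
have g2 : 0 <= (j.+1%:R / n%:R : R) <= 1 by apply: grid_in01; lia.
have d2n : (2 * n)%:R^-1 <= n%:R^-1 :> R.
  by rewrite lef_pV2 ?posrE ?ltr0n ?muln_gt0// ler_nat; lia.
apply: dlog_add_near; try exact: inH_seg.
- by rewrite rhoC; apply: hn0 => //; apply: le_trans d2n; rewrite -e1; exact: grid_step.
- by rewrite rhoC; apply: hn0 => //; apply: le_trans d2n; rewrite -e2; exact: grid_step.
- by rewrite rhoC; apply: hn0 => //; exact: grid_step.
Qed.

Let S_limit : exists F : C -> C, forall z, inH z ->
  exists j0 : nat, forall j : nat, (j0 <= j)%N -> S (2 ^ j) z = F z.
Proof.
have H z : {l : C | inH z -> exists j0 : nat, forall j : nat, (j0 <= j)%N -> S (2 ^ j) z = l}.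
  apply: cid; have [hz|nz] := pselect (inH z); last by exists 0.
  have [n0 hn0] := S_double hz; exists (S (2 ^ n0) z) => _; exists n0 => k.
  elim: k => [|k IH]; first by rewrite leqn0 => /eqP->.
  rewrite leq_eqVlt ltnS => /orP[/eqP->//|h].
  rewrite expnS hn0 ?IH//; apply: leq_trans h _; exact/ltnW/ltn_expl.
by exists (fun z => sval (H z)) => z hz; exact: svalP (H z) hz.
Qed.

(** Moving both points towards i multiplies |z - w|^2 by t^2, while each height stays at least t
    times the old one. *)
Lemma rho_seg z w t : inH z -> inH w -> 0 <= t <= 1 ->
  rho (seg 'i z t) (seg 'i w t) <= rho z w.
Proof.
move=> hz hw ht; rewrite rho_le; try exact: inH_seg.
have -> : seg 'i z t - seg 'i w t = t%:C * (z - w) by rewrite /seg; ring.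
rewrite nmM nm_real exprMn real_normK ?num_real// !Im_seg /= mulr1.
have := rho_le (rho z w) hz hw; rewrite lexx => /esym.
have r0 : 0 <= rho z w by rewrite /rho divr_ge0 ?sqr_ge0// mulr_ge0// ltW.
case/andP: ht => t0 t1.
rewrite /inH /imC in hz hw; move: (complex.Im z) (complex.Im w) hz hw => p q p0 q0 h.
apply: le_trans (ler_wpM2l (sqr_ge0 t) h) _.
rewrite mulrCA ler_wpM2l// expr2 mulrACA ler_pM ?mulr_ge0 ?(ltW p0) ?(ltW q0)//; lra.
Qed.

(** The segments from i to z and to w form a ladder with rungs of size at most k. Each quadrilateral
    of the ladder closes up under [dlog], so the two sums differ by the last rung. The division by 8
    in [k] pays for [rho_quasi] on the diagonals. *)
Lemma log_lift : exists F : C -> C, exists2 k : R, 0 < k & k <= 1 / 4 /\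
  forall z w, inH z -> inH w -> rho z w <= k ->
  nm (f w / f z - 1) < 1 / 2 /\ F w - F z = LogRH (f w / f z).
Proof.
have [F hF] := S_limit; exists F.
pose k := Num.min kappa (1 / 4) / 8.
have k0 : 0 < k by rewrite divr_gt0// lt_min kappa0; lra.
have kk : 8 * k <= kappa by rewrite /k mulrC divfK// ge_min lexx.
have kk' : k <= kappa by lra.
have k4 : k <= 1 / 4.
  have : 8 * k <= 1 / 4 by rewrite /k mulrC divfK// ge_min lexx orbT.
  by lra.
exists k => //; split=> // z w hz hw hzw; split; first by apply: fk => //; lra.
have [k1 hk1] := hF _ hz; have [k2 hk2] := hF _ hw.
have [m1 hm1] := seg_mesh inHi hz k0; have [m2 hm2] := seg_mesh inHi hw k0.
pose K := maxn (maxn k1 k2) (maxn m1 m2).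
have nK : (K <= 2 ^ K)%N by apply/ltnW/ltn_expl.
rewrite -(hk1 K) -?(hk2 K) ?leq_max ?leqnn ?orbT//.
have {}hm1 := hm1 (2 ^ K)%N (leq_trans (leq_trans (leq_trans (leq_maxl _ _) (leq_maxr _ _)) (leqnn _)) nK).
have {}hm2 := hm2 (2 ^ K)%N (leq_trans (leq_trans (leq_trans (leq_maxr _ _) (leq_maxr _ _)) (leqnn _)) nK).
move: (2 ^ K)%N (expn_gt0 2 K) hm1 hm2 => n n_gt0 hm1 hm2.
have nR : n%:R != 0 :> R by rewrite pnatr_eq0 -lt0n.
pose s j := seg 'i z (j%:R / n%:R); pose s' j := seg 'i w (j%:R / n%:R).
suff H J : (J <= n)%N -> \sum_(j < J) dlog (s' j) (s' j.+1) - \sum_(j < J) dlog (s j) (s j.+1)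
    = dlog (s J) (s' J).
  by rewrite /S H// /s /s' divff// !seg1.
elim: J => [|J IH] Jn.
  by rewrite !big_ord0 subrr /s /s' mul0r !seg0 /dlog divff ?f0// LogRH1.
rewrite !big_ord_recr /= opprD addrACA IH; last exact: ltnW.
have g0 := grid_in01 (ltnW Jn); have g1 := grid_in01 Jn.
have hs0 : inH (s J) by exact: inH_seg. have hs1 : inH (s J.+1) by exact: inH_seg.
have ht0 : inH (s' J) by exact: inH_seg. have ht1 : inH (s' J.+1) by exact: inH_seg.
have r1 : rho (s J) (s' J) <= k by apply: le_trans hzw; exact: rho_seg.
have r2 : rho (s J.+1) (s' J.+1) <= k by apply: le_trans hzw; exact: rho_seg.
have r3 : rho (s J) (s J.+1) <= k by rewrite rhoC; apply: hm1 => //; exact: grid_step.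
have r4 : rho (s' J) (s' J.+1) <= k by rewrite rhoC; apply: hm2 => //; exact: grid_step.
have r5 := rho_quasi hs0 ht0 ht1 k4 r1 r4.
have A : dlog (s J) (s' J.+1) = dlog (s J) (s' J) + dlog (s' J) (s' J.+1).
  by apply: dlog_add_near => //; lra.
have B : dlog (s J) (s' J.+1) = dlog (s J) (s J.+1) + dlog (s J.+1) (s' J.+1).
  by apply: dlog_add_near => //; lra.
by rewrite addrA -A B addrC addKr.
Qed.

End LogLift.

(** * Derivative, transformation, cusp limits and Hecke relation of F *)

Section LogProperties.
Variable R : realType.
Notation C := (R[i]).
Implicit Types (z w v L U : C) (a b c d : int) (e x y : R).

Lemma rho_near z x : inH z -> 0 < x -> exists2 e : R, 0 < e &
  forall w, nm (w - z) < e -> inH w /\ rho z w <= x.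
Proof.
move=> hz x0; have iz : 0 < complex.Im z by [].
pose q := Num.min x 1; have q0 : 0 < q by rewrite lt_min x0 ltr01.
have q1 : q <= 1 by rewrite ge_min lexx orbT.
have qx : q <= x by rewrite ge_min lexx.
exists (complex.Im z * q / 2); first by rewrite divr_gt0// mulr_gt0.
move=> w hw; have hI : complex.Im z / 2 < complex.Im w.
  have := nm_Im (w - z); rewrite ImD ImN ler_norml => /andP[h1 h2].
  by nra.
have hwH : inH w by rewrite /inH /imC; lra.
split=> //; rewrite rho_le// nmB; have := nm_ge0 (w - z); move: (nm _) hw => n hn n0.
move: (complex.Im z) (complex.Im w) iz hI hn => p r p0 hr hn.
apply: (@le_trans _ _ ((p * q / 2) ^+ 2)); first by rewrite ler_pXn2r ?nnegrE ?(ltW hn)//; lra.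
have : q * q <= x by nra.
have : p * (p / 2) <= p * r by rewrite ler_pM2l// ltW.
move=> h1 h2; apply: (@le_trans _ _ (x * (p * (p / 2)))).
  have : 0 <= p * p by rewrite mulr_ge0// ltW.
  rewrite (_ : (p * q / 2) ^+ 2 = q * q * (p * p) / 4); last by field.
  by nra.
by rewrite ler_wpM2l// ltW.
Qed.

Lemma cdiff_LogRH1 : cdiff (@LogRH R) 1 1.
Proof.
move=> e e0; exists (Num.min (1 / 12) (e / 288)); first by rewrite lt_min; apply/andP; split; lra.
move=> w; rewrite LogRH1 subr0 (mul1r (w - 1)) lt_min => /andP[h1 h2].
apply: le_trans (LogRH_sub_le (ltW h1)) _.
by have := nm_ge0 (w - 1); nra.
Qed.

Variables (N : nat) (f : C -> C).
Hypothesis N0 : (0 < N)%N.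
Hypothesis f_gmf : GMF0 N f.
Hypothesis f_div : div_zero f.

Variables (F : C -> C) (k : R).
Hypothesis k0 : 0 < k.
Hypothesis k4 : k <= 1 / 4.
Hypothesis hF : forall z w, inH z -> inH w -> rho z w <= k ->
  nm (f w / f z - 1) < 1 / 2 /\ F w - F z = LogRH (f w / f z).

Let f0 := f_neq0 f_div.

Lemma F_cdiff z : inH z -> cdiff F z (cderiv f z / f z).
Proof.
move=> hz.
have h1 : cdiff (fun w => (f z)^-1 * f w) z ((f z)^-1 * cderiv f z).
  by apply: cdiffZ; exact: (f_cdiff f_gmf).
have h2 : cdiff (fun w => LogRH ((f z)^-1 * f w)) z (1 * ((f z)^-1 * cderiv f z)).
  by apply: cdiff_comp h1 _; rewrite mulVf ?f0//; exact: cdiff_LogRH1.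
have h3 := cdiffD h2 (cdiff_cst (F z) z).
apply: cdiff_eqd (cdiff_near _ h3) _; last by rewrite addr0 mul1r mulrC.
have [e e0 he] := rho_near hz k0; exists e => // w /he[hw hr].
by have [_ E] := hF hz hw hr; rewrite mulrC -E subrK.
Qed.

(** [F] and its transform have the same local increments, since these depend only on quotients of
    values of [f]; their difference is therefore locally constant. *)
Lemma F_Gamma a b c d : inGamma0 N a b c d -> exists phi, forall z, inH z ->
  F (mob a b c d z) = F z + phi.
Proof.
move=> hg; have h : inSL2 a b c d by case: hg.
have inHi : inH ('i : C) by rewrite /inH /imC /= ltr01.
exists (F (mob a b c d 'i) - F 'i) => z hz.
suff : F (mob a b c d z) - F z = F (mob a b c d 'i) - F 'i by move=> <-; rewrite subrKC.
apply: (@local_cst_cst R _ (fun z => F (mob a b c d z) - F z) 0 k) => // {hz}z w hz hw hr.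
have [_ e1] := hF hz hw hr.
have [] := hF (inH_SL2 hz h) (inH_SL2 hw h); first by rewrite rho_mob ?SL2_det.
rewrite (f_Gamma_ratio f_gmf hg)// -e1 => _ e2.
apply/eqP; rewrite -subr_eq0; apply/eqP.
transitivity ((F w - F z) - (F (mob a b c d w) - F (mob a b c d z))); first by ring.
by rewrite e2 subrr.
Qed.

(** Between far apart points of a horoball F could differ from the principal logarithm by a multiple
    of 2 pi i. This is excluded because all quotients of [f] on the horoball stay in the right half
    plane, where [LogRH] is additive. *)
Lemma F_horoball_log a b c d Y : inSL2 a b c d -> 0 <= Y ->
  (forall z w, Y < complex.Im z -> Y < complex.Im w ->
    nm (f (mob a b c d w) / f (mob a b c d z) - 1) < 1 / 2) ->
  forall z w, Y < complex.Im z -> Y < complex.Im w ->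
    F (mob a b c d w) - F (mob a b c d z) = LogRH (f (mob a b c d w) / f (mob a b c d z)).
Proof.
move=> h Y0 hY z w hz hw.
have H v : Y < complex.Im v -> inH v by move=> hv; apply: le_lt_trans hv.
pose G v := F (mob a b c d v) - LogRH (f (mob a b c d v) / f (mob a b c d z)).
suff E : G w = G z.
  by move: E; rewrite /G (divff (f0 (inH_SL2 (H _ hz) h))) LogRH1 subr0 => <-; ring.
apply: (@local_cst_cst R _ G Y k Y0 k0 _ w z hw hz); rewrite /G.
move=> v v' hv hv' hr.
have hm u : Y < complex.Im u -> inH (mob a b c d u) by move=> hu; apply: inH_SL2 => //; exact: H.
have [] := hF (hm _ hv) (hm _ hv'); first by rewrite (rho_mob (H _ hv) (H _ hv') (SL2_det h)).
move=> _ e2.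
have := @dlog_add R f f0 _ _ _ (hm _ hz) (hm _ hv) (hm _ hv').
rewrite /dlog -e2 => ->.
- by ring.
- by apply: Re_near1; have := hY z v hz hv; lra.
- by apply: Re_near1; have := hY v v' hv hv'; lra.
- by apply: Re_near1; have := hY z v' hz hv'; lra.
Qed.

Lemma F_cusp_uniform e : 0 < e -> exists2 Y : R, 0 <= Y & forall a b c d, inSL2 a b c d ->
  forall z w, Y < complex.Im z -> Y < complex.Im w ->
  nm (F (mob a b c d w) - F (mob a b c d z)) < e.
Proof.
move=> e0; pose e' := Num.min (1 / 2) (e / 6).
have e'0 : 0 < e' by rewrite lt_min; apply/andP; split; lra.
have e'1 : e' <= 1 / 2 by rewrite ge_min lexx.
have e'2 : e' <= e / 6 by rewrite ge_min lexx orbT.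
have [Y0 hY0] := ratio_cusp N0 f_gmf f_div e'0.
pose Y := Num.max Y0 0; have YY : Y0 <= Y by rewrite le_max lexx.
have Yp : 0 <= Y by rewrite le_max lexx orbT.
exists Y => // a b c d h z w hz hw.
have H z' w' : Y < complex.Im z' -> Y < complex.Im w' ->
    nm (f (mob a b c d w') / f (mob a b c d z') - 1) < e'.
  by move=> h1 h2; apply: hY0 => //; [rewrite /inH /imC; lra|rewrite /inH /imC; lra|lra|lra].
rewrite (F_horoball_log h Yp)//; last by move=> z' w' h1 h2; apply: lt_le_trans (H _ _ h1 h2) _.
have := H _ _ hz hw => hh.
by apply: le_lt_trans (LogRH_nm_le _) _; lra.
Qed.

Definition cusp_lim a b c d U := forall e, 0 < e -> exists Y : R, forall z, inH z ->
  Y < complex.Im z -> nm (F (mob a b c d z) - U) < e.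

Lemma cusp_lim_SL2 a b c d : inSL2 a b c d -> exists U, cusp_lim a b c d U.
Proof.
move=> h; have [_ /(_ _ _ _ _ h)[L [L0 hL]]] := f_div.
have near e : 0 < e -> exists2 Y : R, 0 <= Y & forall z, Y < complex.Im z -> nm (f (mob a b c d z) - L) < e.
  move=> e0; have [Y hY] := hL _ e0; exists (Num.max Y 0); first by rewrite le_max lexx orbT.
  by move=> z; rewrite gt_max => /andP[h1 h2]; rewrite -ltr_nm; apply: hY.
have [|Y0 Y00 hY0] := near (nm L * ((1 / 2) / 4)); first by rewrite mulr_gt0 ?nm_gt0//; lra.
pose z0 : C := 0 +i* (Y0 + 1); have z0Y : Y0 < complex.Im z0 by rewrite /=; lra.
have r z w : nm (z - L) < nm L * ((1 / 2) / 4) -> nm (w - L) < nm L * ((1 / 2) / 4) -> nm (w / z - 1) < 1 / 2.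
  by move=> h1 h2; apply: (ratio_near L0) => //; lra.
have rL : nm (L - L) < nm L * ((1 / 2) / 4) by rewrite subrr nm0 mulr_gt0 ?nm_gt0//; lra.
have logE := F_horoball_log h Y00 (fun z w hz hw => r _ _ (hY0 z hz) (hY0 w hw)).
(* The increment from the base point [z0] to [z] is split at the limit value [L] of [f]; the second
   summand tends to [LogRH 1 = 0]. *)
exists (F (mob a b c d z0) + LogRH (L / f (mob a b c d z0))) => e e0.
pose e' := Num.min (1 / 2) (e / 6).
have e'0 : 0 < e' by rewrite lt_min; apply/andP; split; lra.
have e'1 : e' <= 1 / 2 by rewrite ge_min lexx.
have e'2 : e' <= e / 6 by rewrite ge_min lexx orbT.
have [|Y1 Y10 hY1] := near (nm L * (e' / 4)); first by rewrite mulr_gt0 ?nm_gt0//; lra.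
exists (Num.max Y0 Y1) => z hz; rewrite gt_max => /andP[h0 h1].
have hz0 : inH z0 by rewrite /inH /imC; lra.
have fz0 : f (mob a b c d z0) != 0 by apply/f0/inH_SL2.
have E : F (mob a b c d z) - F (mob a b c d z0) = LogRH (L / f (mob a b c d z0)) + LogRH (f (mob a b c d z) / L).
  rewrite logE// -LogRHM.
  - by congr LogRH; field; rewrite fz0 L0.
  - by apply: Re_near1; have := r _ _ (hY0 z0 z0Y) rL; lra.
  - by apply: Re_near1; have := r _ _ rL (hY0 z h0); lra.
  - rewrite mulrC mulrA divfK//.
    by apply: Re_near1; have := r _ _ (hY0 z0 z0Y) (hY0 z h0); lra.
rewrite opprD addrA E addrC addKr.
have hh : nm (f (mob a b c d z) / L - 1) < e'.
  apply: (ratio_near L0) => //; first lra; last exact: hY1.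
  by rewrite subrr nm0 mulr_gt0 ?nm_gt0//; lra.
by apply: le_lt_trans (LogRH_nm_le _) _; lra.
Qed.

(** An antiderivative of 2 pi i [hecke2] when p does not divide N: the chain rule produces the
    weights p and 1 / p. *)
Definition TF p z := F (p%:R * z) + \sum_(j < p) F ((z + j%:R) / p%:R).

Lemma TF_eigen p lam : prime p -> ~~ (p %| N)%N ->
  (forall z, inH z -> hecke2 N p (logderiv f) z = lam * logderiv f z) ->
  exists K, forall z, inH z -> TF p z = lam * F z + K.
Proof.
move=> pp pN hh.
have p0 : (0 < p)%N by exact: prime_gt0.
have pC : p%:R != 0 :> C by rewrite pnatr_eq0 -lt0n.
have pR : 0 < p%:R :> R by rewrite ltr0n.
have inHp z : inH z -> inH (p%:R * z).
  by rewrite /inH /imC !ReImE mul0r addr0 => hz; rewrite mulr_gt0.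
have inHd z j : inH z -> inH ((z + j%:R) / p%:R).
  move=> hz; rewrite /inH /imC -[p%:R](rmorph_nat (real_complex R)) -fmorphV mulrC ImRM ImD ImNat addr0.
  by rewrite mulr_gt0// invr_gt0.
have inHi : inH ('i : C) by rewrite /inH /imC /= ltr01.
exists (TF p 'i - lam * F 'i) => z hz.
suff : TF p z - lam * F z = TF p 'i - lam * F 'i by move=> <-; rewrite subrKC.
apply: (@cdiff0_cst R (fun z => TF p z - lam * F z)) => // {hz}z hz.
pose D z := cderiv f z / f z.
have h1 : cdiff (fun w => F (p%:R * w)) z (D (p%:R * z) * p%:R).
  apply: (@cdiff_comp R F (fun w => p%:R * w)).
    by have := @cdiff_affine R p%:R 0 z; under eq_fun do rewrite addr0.
  by apply: F_cdiff; exact: inHp.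
have h2 (j : 'I_p) : cdiff (fun w => F ((w + j%:R) / p%:R)) z (D ((z + j%:R) / p%:R) * p%:R^-1).
  apply: (@cdiff_comp R F (fun w => (w + j%:R) / p%:R)).
    have := @cdiff_affine R p%:R^-1 (j%:R / p%:R) z.
    by under eq_fun do rewrite [_^-1 * _]mulrC -mulrDl.
  by apply: F_cdiff; exact: inHd.
have h3 := cdiffZ (- lam) (F_cdiff hz).
have h4 := cdiffD (cdiffD h1 (cdiff_sum (index_enum 'I_p) h2)) h3.
have -> : (fun z => TF p z - lam * F z) = (fun w => F (p%:R * w) + \sum_(i < p) F ((w + i%:R) / p%:R) + - lam * F w).
  by apply/funext => w; rewrite /TF mulNr.
apply: cdiff_eqd h4 _.
have tpi : (2 * pi)%:C * 'i != 0 :> C.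
  by rewrite -nm_gt0 nmM nm_i mulr1 nm_real normr_gt0 gt_eqF// mulr_gt0// pi_gt0.
have gD v : logderiv f v = ((2 * pi)%:C * 'i)^-1 * D v.
  by rewrite /logderiv /D invfM mulrCA mulrA.
have := hh _ hz; rewrite /hecke2 (negbTE pN) !gD.
under eq_bigr do rewrite gD.
rewrite -mulr_sumr -/(D z) => E.
rewrite -mulr_suml; apply: (mulfI (invr_neq0 tpi)); rewrite mulr0 mulrDr mulrDr.
rewrite mulNr mulrN [_ * (lam * _)]mulrCA -E.
by rewrite mulrCA mulrC -!addrA; ring.
Qed.

End LogProperties.

(** * The function u of limits at the cusps, on integer columns *)

Section CuspFunction.
Variable R : realType.
Notation C := (R[i]).
Implicit Types (z w v U : C) (a b c d : int) (e x y : R) (h : C -> C).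

Definition ilim h U := forall e, 0 < e -> exists Y : R, forall z, inH z ->
  Y < complex.Im z -> nm (h z - U) < e.

Lemma ilim_unique h U U' : ilim h U -> ilim h U' -> U = U'.
Proof.
move=> h1 h2; apply/eqP; rewrite -subr_eq0 -nm_eq0 eq_le nm_ge0 andbT.
apply/ler_addgt0Pr => e e0; rewrite add0r; have e20 : 0 < e / 2 by lra.
have [Y1 H1] := h1 _ e20; have [Y2 H2] := h2 _ e20.
pose z : C := 0 +i* (Num.max (Num.max Y1 Y2) 0 + 1).
have m1 : Y1 <= Num.max (Num.max Y1 Y2) 0 by rewrite !le_max lexx.
have m2 : Y2 <= Num.max (Num.max Y1 Y2) 0 by rewrite !le_max lexx orbT.
have m3 : 0 <= Num.max (Num.max Y1 Y2) 0 by rewrite le_max lexx orbT.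
have hz : inH z by rewrite /inH /imC /=; lra.
have z1 : Y1 < complex.Im z by rewrite /=; lra.
have z2 : Y2 < complex.Im z by rewrite /=; lra.
have A := H1 z hz z1; have B := H2 z hz z2.
by have := nm_triangle U (h z) U'; rewrite (nmB U (h z)); lra.
Qed.

Lemma ilim_eq h h' U : (forall z, inH z -> h z = h' z) -> ilim h U -> ilim h' U.
Proof. by move=> E H e /H[Y hY]; exists Y => z hz hi; rewrite -E//; exact: hY. Qed.

Lemma ilim_cst U : ilim (fun=> U) U.
Proof. by move=> e e0; exists 0 => z _ _; rewrite subrr nm0. Qed.

Lemma ilimD h h' U U' : ilim h U -> ilim h' U' -> ilim (fun z => h z + h' z) (U + U').
Proof.
move=> H H' e e0; have e20 : 0 < e / 2 by lra.
have [Y1 H1] := H _ e20; have [Y2 H2] := H' _ e20.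
exists (Num.max Y1 Y2) => z hz; rewrite gt_max => /andP[/(H1 z hz) A /(H2 z hz) B].
by rewrite opprD addrACA; apply: le_lt_trans (nmD _ _) _; lra.
Qed.

Lemma ilimZ h U (m : C) : ilim h U -> ilim (fun z => m * h z) (m * U).
Proof.
move=> H e e0; have m0 := nm_ge0 m.
have [|Y hY] := H (e / (nm m + 1)); first by rewrite divr_gt0//; lra.
exists Y => z hz hi; rewrite -mulrBr nmM; have := hY z hz hi.
rewrite ltr_pdivlMr; last lra.
by have := nm_ge0 (h z - U); nra.
Qed.

Lemma ilim_sum (I : Type) (r : seq I) (hs : I -> C -> C) (Us : I -> C) :
  (forall i, ilim (hs i) (Us i)) -> ilim (fun z => \sum_(i <- r) hs i z) (\sum_(i <- r) Us i).
Proof.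
move=> H; elim: r => [|i r IH].
  by rewrite big_nil; apply: ilim_eq (ilim_cst _) => z _; rewrite big_nil.
by rewrite big_cons; apply: ilim_eq (ilimD (H i) IH) => z _; rewrite big_cons.
Qed.

Lemma mob_scale m a b c d z : m != 0 -> mob (m * a) (m * b) (m * c) (m * d) z = mob a b c d z.
Proof.
move=> m0; rewrite /mob !rmorphM /= -!mulrA -!mulrDr invfM mulrACA divff ?mul1r//.
by rewrite intr_eq0.
Qed.

Lemma col_decomp a c : (a != 0) || (c != 0) -> exists g a' c' x y : int,
  [/\ 0 < g, a = a' * g, c = c' * g & a' * x + y * c' = 1].
Proof.
move=> ac; have g0 : gcdz a c != 0 by rewrite gcdz_eq0 negb_and.
have /dvdzP[a' ea] := dvdz_gcdl a c; have /dvdzP[c' ec] := dvdz_gcdr a c.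
have [x [y hxy]] := Bezoutz a c.
have gp : 0 < gcdz a c by rewrite lt_def g0.
move: (gcdz a c) g0 ea ec hxy gp => g g0 ea ec hxy gp.
exists g, a', c', x, y; split => //.
by apply: (mulIf g0); rewrite mul1r -[RHS]hxy [in RHS]ea [in RHS]ec; ring.
Qed.

(** Every matrix with first column (a, c) and positive determinant is one fixed SL_2(Z) matrix times
    an upper triangular one. The latter fixes i oo and scales heights, so the limit depends on the
    first column only; the column 0 is vacuous and gets the value 0. *)
Lemma cusp_lim_col (F : C -> C) a c :
  (forall a b c d, inSL2 a b c d -> exists U, cusp_lim F a b c d U) ->
  exists U, forall b d, 0 < a * d - b * c -> cusp_lim F a b c d U.
Proof.
move=> hS; have [/andP[/eqP-> /eqP->]|] := boolP ((a == 0) && (c == 0)).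
  by exists 0 => b d; rewrite mul0r mulr0 subr0 ltxx.
rewrite negb_and => ac; have [g [a' [c' [x [y [g0 ea ec hxy]]]]]] := col_decomp ac.
have h : inSL2 a' (- y) c' x by rewrite /inSL2 mulNr opprK.
have [U hU] := hS _ _ _ _ h; exists U => b d hbd.
pose t := x * b + y * d; pose s := a' * d - c' * b.
have gs : a * d - b * c = g * s by rewrite ea ec /s; ring.
have s0 : 0 < s by rewrite gs pmulr_rgt0 in hbd.
have det : 0 < g * s - t * 0 by rewrite mulr0 subr0 mulr_gt0.
have s0R : 0 < s%:~R :> R by rewrite ltr0z.
have g0R : 0 < g%:~R :> R by rewrite ltr0z.
have E z : inH z -> mob a b c d z = mob a' (- y) c' x (mob g t 0 s z).
  move=> hz; rewrite mob_comp//; congr mob.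
  - by rewrite ea; ring.
  - rewrite -[LHS]mul1r -hxy /t /s; ring.
  - by rewrite ec; ring.
  - rewrite -[LHS]mul1r -hxy /t /s; ring.
move=> e e0; have [Y hY] := hU _ e0; exists (Y * s%:~R / g%:~R) => z hz hi.
rewrite E//; apply: hY; first exact: inH_mob.
rewrite Im_mob// mulr0 subr0 rmorphM /= {1}/den mul0r add0r.
have -> : nm (s%:~R : C) = s%:~R by rewrite -(rmorph_int (real_complex R)) nm_real gtr0_norm.
rewrite ltr_pdivrMr// in hi.
rewrite ltr_pdivlMr ?exprn_gt0//.
have -> : g%:~R * s%:~R * complex.Im z = s%:~R * (complex.Im z * g%:~R) by ring.
by rewrite expr2 mulrA mulrC ltr_pM2l.
Qed.

Variables (N : nat) (F : C -> C) (u : int -> int -> C).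
Hypothesis N0 : (0 < N)%N.
Hypothesis hu : forall a b c d, 0 < a * d - b * c -> cusp_lim F a b c d (u a c).
Hypothesis hGamma : forall a b c d, inGamma0 N a b c d -> exists phi, forall z, inH z ->
  F (mob a b c d z) = F z + phi.

(** The matrix with columns (a, c) and (-c, a) completes a column to positive determinant uniformly,
    without Bezout coefficients. *)
Lemma det_perp a c : (a != 0) || (c != 0) -> 0 < a * a - (- c) * c.
Proof.
move=> ac; rewrite mulNr opprK lt_def addr_ge0 -?expr2 ?sqr_ge0// andbT.
by rewrite paddr_eq0 ?sqr_ge0// !sqrf_eq0 negb_and.
Qed.

Lemma u_scale m a c : m != 0 -> (a != 0) || (c != 0) -> u (m * a) (m * c) = u a c.
Proof.
move=> m0 ac; have d1 := det_perp ac.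
have d2 : 0 < m * a * (m * a) - m * (- c) * (m * c).
  rewrite (_ : _ - _ = m ^+ 2 * (a * a - - c * c)); last by ring.
  by rewrite mulr_gt0// lt_def sqrf_eq0 m0 sqr_ge0.
apply: (@ilim_unique (fun z => F (mob a (- c) c a z))); last exact: hu.
by apply: ilim_eq (hu d2) => z hz; rewrite mob_scale.
Qed.

(** The p + 1 terms of [TF] come from the matrices (p, 0; 0, 1) and (1, j; 0, p); multiplied by a
    completion of (a, c), they have the first columns on the left-hand side. *)
Lemma u_hecke p lam K : (0 < p)%N ->
  (forall z, inH z -> TF F p z = lam * F z + K) ->
  forall a c, (a != 0) || (c != 0) ->
  u (p%:Z * a) c + \sum_(j < p) u (a + j%:Z * c) (p%:Z * c) = lam * u a c + K.
Proof.
move=> p0 hT a c ac; have d1 := det_perp ac.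
have pZ : 0 < p%:Z by [].
apply: (@ilim_unique (fun z => TF F p (mob a (- c) c a z))); last first.
  apply: ilim_eq (ilimD (ilimZ lam (hu d1)) (ilim_cst K)) => z hz.
  by rewrite hT//; exact: inH_mob.
apply: ilimD.
  apply: (@ilim_eq (fun z => F (mob (p%:Z * a) (p%:Z * (- c)) c a z))).
    move=> z hz; congr F; rewrite /mob mulrA; congr (_ / _).
    by rewrite !rmorphM /=; ring.
  by apply: hu; rewrite -!mulrA -mulrBr mulr_gt0.
apply: ilim_sum => j.
apply: (@ilim_eq (fun z => F (mob (a + j%:Z * c) (- c + j%:Z * a) (p%:Z * c) (p%:Z * a) z))).
  move=> z hz; congr F; have := den_neq0 hz d1; rewrite /mob /den => D0.
  rewrite !rmorphD !rmorphM /=.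
  have P0 : p%:R != 0 :> C by rewrite pnatr_eq0 -lt0n.
  have -> : p%:R * c%:~R * z + p%:R * a%:~R = p%:R * (c%:~R * z + a%:~R) :> C by ring.
  rewrite invfM [p%:R^-1 * _]mulrC mulrA; congr (_ / _).
  by field.
apply: hu; rewrite (_ : _ - _ = p%:Z * (a * a - - c * c)); last by ring.
by rewrite mulr_gt0.
Qed.

Lemma u_Gamma a b c d : inGamma0 N a b c d -> exists phi, forall a' c',
  (a' != 0) || (c' != 0) -> u (a * a' + b * c') (c * a' + d * c') = u a' c' + phi.
Proof.
move=> hg; have [phi hphi] := hGamma hg; exists phi => a' c' ac.
have h : inSL2 a b c d by case: hg.
have d1 := det_perp ac.
apply: (@ilim_unique (fun z => F (mob a b c d (mob a' (- c') c' a' z)))); last first.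
  apply: ilim_eq (ilimD (hu d1) (ilim_cst phi)) => z hz.
  by rewrite hphi//; exact: inH_mob.
apply: (@ilim_eq (fun z => F (mob (a * a' + b * c') (a * (- c') + b * a') (c * a' + d * c') (c * (- c') + d * a') z))).
  by move=> z hz; rewrite mob_comp.
apply: hu; rewrite (_ : _ - _ = (a * d - b * c) * (a' * a' - - c' * c')); last by ring.
by rewrite mulr_gt0// SL2_det.
Qed.

Lemma SL2_col a b c d : inSL2 a b c d -> ((a != 0) || (c != 0)) /\ ((b != 0) || (d != 0)).
Proof.
move=> h; split; rewrite -negb_and; apply/negP => /andP[/eqP e1 /eqP e2]; move: h.
  by rewrite /inSL2 e1 e2 mul0r mulr0 subr0.
by rewrite /inSL2 e1 e2 mulr0 mul0r subr0.
Qed.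

End CuspFunction.

(** * Rational linear algebra inside C, and the rational root theorem *)

Section RationalBasis.
Variable K : numFieldType.

(** The field is viewed as a vector space over the rationals: [x] are the coordinates of a number
    with respect to [e], on which rational matrices act from the right. *)
Definition rlin d (e : 'I_d -> K) (x : 'rV[rat]_d) : K := \sum_i ratr (x 0 i) * e i.

Lemma rlinD d (e : 'I_d -> K) x y : rlin e (x + y) = rlin e x + rlin e y.
Proof. by rewrite /rlin -big_split; apply: eq_bigr => i _ /=; rewrite !mxE rmorphD mulrDl. Qed.

Lemma rlinZ d (e : 'I_d -> K) q x : rlin e (q *: x) = ratr q * rlin e x.
Proof. by rewrite /rlin mulr_sumr; apply: eq_bigr => i _ /=; rewrite !mxE rmorphM mulrA. Qed.

Lemma rlinN d (e : 'I_d -> K) x : rlin e (- x) = - rlin e x.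
Proof. by rewrite -scaleN1r rlinZ rmorphN rmorph1 mulN1r. Qed.

Lemma rlinB d (e : 'I_d -> K) x y : rlin e (x - y) = rlin e x - rlin e y.
Proof. by rewrite rlinD rlinN. Qed.

Lemma rlin0 d (e : 'I_d -> K) : rlin e 0 = 0.
Proof. by rewrite -(scale0r 0) rlinZ rmorph0 mul0r. Qed.

Lemma rlin_sum d (e : 'I_d -> K) (I : Type) (r : seq I) (xs : I -> 'rV[rat]_d) :
  rlin e (\sum_(i <- r) xs i) = \sum_(i <- r) rlin e (xs i).
Proof. by apply: (big_morph (rlin e)); [exact: rlinD|exact: rlin0]. Qed.

Lemma rlin_delta d (e : 'I_d -> K) i : rlin e (delta_mx 0 i) = e i.
Proof.
rewrite /rlin (bigD1 i)//= mxE !eqxx rmorph1 mul1r big1 ?addr0// => j ji.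
by rewrite mxE eqxx (negbTE ji) rmorph0 mul0r.
Qed.

Definition rfree d (e : 'I_d -> K) := forall x, rlin e x = 0 -> x = 0.

Lemma rational_basis (s : seq K) : exists d (e : 'I_d -> K),
  [/\ forall i, e i \in s, rfree e & forall m, m \in s -> exists x, m = rlin e x].
Proof.
elim: s => [|m s [d [e [es ef em]]]].
  exists 0%N, (fun=> 0); split => [[]//|x _|//]; apply/rowP; case=> //.
have [[x hx]|hno] := pselect (exists x, m = rlin e x).
  exists d, e; split=> // [i|m']; first by rewrite inE es orbT.
  by rewrite inE => /orP[/eqP->|/em//]; exists x.
pose e' (i : 'I_(d + 1)) := match fintype.split i with inl j => e j | inr _ => m end.
have E x : rlin e' x = rlin e (lsubmx x) + ratr (x 0 (rshift d ord0)) * m.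
  rewrite /rlin big_split_ord /= big_ord_recl big_ord0 addr0; congr (_ + _).
    by apply: eq_bigr => i _; rewrite mxE /e' -[lshift _ i]/(unsplit (inl i)) unsplitK.
  by rewrite /e' -[rshift d ord0]/(unsplit (inr ord0)) unsplitK.
exists (d + 1)%N, e'; split.
- by move=> i; rewrite /e' inE; case: fintype.split => j; rewrite ?es ?orbT ?eqxx.
- move=> x; rewrite E => h.
  have x0 : x 0 (rshift d ord0) = 0.
    apply/eqP/negP => /negP x0; apply: hno.
    exists (- (x 0 (rshift d ord0))^-1 *: lsubmx x); rewrite rlinZ rmorphN fmorphV.
    have r0 : ratr (x 0 (rshift d ord0)) != 0 :> K by rewrite fmorph_eq0.
    apply: (mulfI r0); rewrite mulrA mulrN divff// mulN1r.
    by apply/eqP; rewrite -addr_eq0 addrC h.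
  move: h; rewrite x0 rmorph0 mul0r addr0 => /ef h.
  rewrite -[x]hsubmxK h; apply/rowP => i; rewrite !mxE; case: fintype.split => j; rewrite !mxE//.
  by rewrite ord1 x0.
- move=> m'; rewrite inE => /orP[/eqP->|/em[x ->]].
    exists (row_mx 0 1); rewrite E row_mxKl rlin0 add0r row_mxEr mxE eqxx rmorph1 mul1r//.
  exists (row_mx x 0); rewrite E row_mxKl row_mxEr mxE rmorph0 mul0r addr0//.
Qed.

End RationalBasis.

(** Isolating the leading term and clearing denominators shows that the denominator of [q] divides a
    power of the coprime numerator. *)
Lemma rational_integral (P : {poly int}) (q : rat) : P \is monic ->
  root (map_poly (intr : int -> rat) P) q -> exists n : int, q = n%:~R.
Proof.
move=> Pm /rootP; rewrite horner_coef size_map_inj_poly ?rmorph0//; last exact: intr_inj.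
have s0 : (0 < size P)%N by rewrite lt0n size_poly_eq0 monic_neq0.
move E : (size P) s0 => [//|n] _; rewrite big_ord_recr /=.
have -> : (map_poly intr P)`_n = 1 :> rat.
  rewrite coef_map_id0 ?rmorph0//; move/monicP : Pm; rewrite /lead_coef E /= => ->.
  by [].
rewrite mul1r => h.
have D0 : (denq q)%:~R != 0 :> rat by rewrite intr_eq0 denq_eq0.
have qE : q = (numq q)%:~R / (denq q)%:~R by rewrite divq_num_den.
have : (denq q %| numq q ^+ n)%Z.
  apply/dvdzP; exists (- \sum_(i < n) P`_i * numq q ^+ i * denq q ^+ (n - i).-1).
  apply: (@intr_inj rat); rewrite rmorphM rmorphN rmorphXn /= rmorph_sum /=.
  have -> : (numq q)%:~R ^+ n = q ^+ n * (denq q)%:~R ^+ n :> rat.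
    by rewrite -exprMn {2}qE divfK.
  have -> : q ^+ n = - \sum_(i < n) (map_poly intr P)`_i * q ^+ i.
    by apply/eqP; rewrite -addr_eq0 addrC h.
  rewrite !mulNr; congr (- _); rewrite !mulr_suml; apply: eq_bigr => i _.
  rewrite coef_map_id0 ?rmorph0// !rmorphM /= !rmorphXn /= -!mulrA; congr (_ * _).
  rewrite -exprSr prednK ?subn_gt0// {1}qE exprMn exprVn -mulrA; congr (_ * _).
  move: (nat_of_ord i) (ltnW (ltn_ord i)) => j jn.
  rewrite -{1}(subnK jn) exprD mulrCA mulVf ?mulr1//.
  by rewrite expf_neq0.
rewrite dvdzE abszX => hdvd.
have cop : coprime `|denq q| (`|numq q| ^ n) by rewrite coprimeXr// coprime_sym coprime_num_den.
have d1 : `|denq q|%N = 1%N.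
  by apply/eqP; rewrite -dvdn1 -(eqP cop) dvdn_gcd dvdnn.
have d1' : denq q = 1 by rewrite -[denq q]gtz0_abs ?denq_gt0// d1.
by exists (numq q); rewrite {1}qE d1' divr1.
Qed.

(** * Manin's continued fraction descent on columns *)

Section ManinTrick.
Implicit Types (a b c d : int).

Lemma half_residue (x m : int) : m != 0 -> exists n : int, (2 * `|(x + n * m)%R| <= `|m|)%N.
Proof.
move=> m0; have e := divz_eq x m; have r0 := modz_ge0 x m0; have r1 := ltz_mod x m0.
have [h|h] := leP (2 * (x %% m)%Z) `|m|%Z.
  exists (- (x %/ m)%Z); rewrite (_ : x + _ = (x %% m)%Z); last by rewrite {1}e; ring.
  by lia.
have [m1|m1] := leP 0 m.
  exists (- (x %/ m)%Z - 1); rewrite (_ : x + _ = (x %% m)%Z - m); last by rewrite {1}e; ring.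
  by lia.
exists (- (x %/ m)%Z + 1); rewrite (_ : x + _ = (x %% m)%Z + m); last by rewrite {1}e; ring.
by lia.
Qed.

(** One step of the nearest-integer continued fraction: the second column is determined up to
    multiples of the first, which allows its lower entry to be reduced to at most half of [c']. *)
Lemma manin_step a c : c != 0 -> exists g a' c' b d,
  [/\ 0 < g, a = g * a', c = g * c', inSL2 a' b c' d & (2 * `|d| <= `|c'|)%N].
Proof.
move=> c0; have ac : (a != 0) || (c != 0) by rewrite c0 orbT.
have [g [a' [c' [x [y [g0 ea ec h]]]]]] := col_decomp ac.
have c'0 : c' != 0 by apply/eqP => c'0; move: c0; rewrite ec c'0 mul0r eqxx.
have [n hn] := half_residue x c'0.
exists g, a', c', (- y + n * a'), (x + n * c'); split=> //; rewrite ?ea ?ec 1?mulrC//.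
by rewrite /inSL2 -h; ring.
Qed.

(* Manin's continued fraction argument: every value at a column is a sum of
   logarithmically many values on unimodular pairs of columns. *)
Lemma manin_induction (Q : nat -> int -> int -> Prop) :
  (forall n g a c, g != 0 -> (a != 0) || (c != 0) -> Q n a c -> Q n (g * a) (g * c)) ->
  (forall n, Q n 1 0) ->
  (forall n a b c d, inSL2 a b c d -> Q n b d -> Q n.+1 a c) ->
  forall n a c, (a != 0) || (c != 0) -> (`|c| < 2 ^ n)%N -> Q n a c.
Proof.
move=> sc base step; elim=> [|n IH] a c ac hc; have [c0|c0] := eqVneq c 0.
- rewrite c0 eqxx orbF in ac; rewrite c0 -[a]mulr1 -(mulr0 a); exact: sc.
- by move: hc c0; rewrite expn0 ltnS leqn0 absz_eq0 => ->.
- rewrite c0 eqxx orbF in ac; rewrite c0 -[a]mulr1 -(mulr0 a); exact: sc.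
have [g [a' [c' [b [d [g0 ea ec h hd]]]]]] := manin_step a c0.
have [ac' bd] := SL2_col h.
rewrite ea ec; apply: sc => //; first by rewrite gt_eqF.
apply: (step _ _ _ _ _ h); apply: IH => //.
have : (`|c'| <= `|c|)%N by rewrite ec abszM leq_pmull// absz_gt0 gt_eqF.
by move: hc; rewrite expnS; lia.
Qed.

End ManinTrick.

(** * The bound p + 1 for Hecke eigenvalues on cusp functions *)

Section EigenBound.
Variable R : realType.
Notation C := (R[i]).

(** Exponential growth is needed only to second order: a quadratic lower bound already beats the
    linear upper bound. *)
Lemma quadratic_contra (h A B D : R) : 0 < A -> 0 < h -> 0 <= B -> 0 <= D ->
  (forall k : nat, A * (1 + k%:R * h) ^+ 2 <= B + k%:R * D) -> False.
Proof.
move=> A0 h0 B0 D0 H.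
pose q := (B + D) / (A * h ^+ 2).
have Ah : 0 < A * h ^+ 2 by rewrite mulr_gt0// exprn_gt0.
have q0 : 0 <= q by rewrite divr_ge0 ?addr_ge0// ltW.
pose k := (Num.Def.archi_bound q).+1.
have hk : q < k%:R.
  by apply: lt_le_trans (archi_boundP q0) _; rewrite ler_nat.
have k1 : 1 <= k%:R :> R by rewrite ler1n.
move: (k) hk k1 => {}k hk k1.
rewrite ltr_pdivrMr// in hk; have := H k; apply/negP; rewrite -ltNge.
apply: (@lt_le_trans _ _ (k%:R * (A * h ^+ 2) * k%:R)); last first.
  rewrite (_ : _ * k%:R = A * (k%:R * h) ^+ 2); last by ring.
  rewrite ler_wpM2l ?(ltW A0)// ler_pXn2r ?nnegrE ?addr_ge0 ?mulr_ge0 ?(ltW h0)//.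
  by rewrite lerDr.
apply: (@le_lt_trans _ _ ((B + D) * k%:R)); last by rewrite ltr_pM2r//; lra.
by rewrite mulrDl (mulrC D) lerD2r ler_peMr.
Qed.

(* Iterating the Hecke relation multiplies the number of terms by p+1 each time,
   while the Manin bound grows only linearly in the number of iterations. *)
Lemma hecke_eigen_bound (y : int -> int -> C) (B : R) p mu :
  (0 < p)%N -> 0 <= B ->
  (forall g a c, g != 0 -> (a != 0) || (c != 0) -> y (g * a) (g * c) = y a c) ->
  y 1 0 = 0 ->
  (forall a b c d, inSL2 a b c d -> nm (y a c - y b d) <= B) ->
  (forall a c, (a != 0) || (c != 0) ->
     y (p%:Z * a) c + \sum_(j < p) y (a + j%:Z * c) (p%:Z * c) = mu * y a c) ->
  (exists a c, ((a != 0) || (c != 0)) /\ y a c != 0) ->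
  nm mu <= p%:R + 1.
Proof.
move=> p0 B0 sc y10 hB hecke [a0 [c0 [ac0 y0]]]; rewrite leNgt; apply/negP => hmu.
have bound n a c : (a != 0) || (c != 0) -> (`|c| < 2 ^ n)%N -> nm (y a c) <= B * n%:R.
  apply: (@manin_induction (fun n a c => nm (y a c) <= B * n%:R)) => {n a c}.
  - by move=> n g a c g0 ac; rewrite sc.
  - by move=> n; rewrite y10 nm0 mulr_ge0.
  - move=> n a b c d h hn; have := hB _ _ _ _ h; have := nm_sub (y a c) (y b d).
    by rewrite -natr1 mulrDr mulr1; lra.
have pp1 : 0 < p%:R + 1 :> R by rewrite addr_gt0// ltr0n.
(* One application of the relation multiplies denominators by at most [p < 2 ^ p], so each of the
   [m] iterations adds [p] to the exponent [n]. *)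
have iter m : forall n a c, (a != 0) || (c != 0) -> (`|c| < 2 ^ n)%N ->
    nm mu ^+ m * nm (y a c) <= (p%:R + 1) ^+ m * (B * (n + m * p)%N%:R).
  elim: m => [|m IH] n a c ac hc.
    by rewrite !expr0 !mul1r mul0n addn0; exact: bound.
  rewrite !exprSr -mulrA -nmM -hecke// -mulrA.
  have hc2 : (`|(p%:Z * c)%R| < 2 ^ (n + p))%N.
    rewrite abszM expnD mulnC ltn_mul//; exact: ltn_expl.
  have hc1 : (`|c| < 2 ^ (n + p))%N.
    by apply: leq_trans hc _; rewrite leq_exp2l// leq_addr.
  have pZ : p%:Z != 0 by rewrite eqz_nat -lt0n.
  have A1 : (p%:Z * a != 0) || (c != 0) by rewrite mulf_eq0 (negbTE pZ).
  have A2 j : (a + j%:Z * c != 0) || (p%:Z * c != 0).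
    have [cz|cn0] := eqVneq c 0; last by rewrite mulf_neq0 ?orbT.
    by move: ac; rewrite cz !mulr0 addr0.
  apply: (@le_trans _ _ ((p%:R + 1) * ((p%:R + 1) ^+ m * (B * (n + p + m * p)%N%:R)))); last first.
    by rewrite mulSn addnA mulrCA mulrA -!mulrA.
  rewrite [leRHS](_ : _ = (p%:R + 1) ^+ m * (B * (n + p + m * p)%N%:R) + p%:R * ((p%:R + 1) ^+ m * (B * (n + p + m * p)%N%:R))); last by ring.
  apply: (@le_trans _ _ (nm mu ^+ m * nm (y (p%:Z * a) c) +
     \sum_(j < p) nm mu ^+ m * nm (y (a + j%:Z * c) (p%:Z * c)))).
    rewrite -mulr_sumr -mulrDr ler_wpM2l ?exprn_ge0 ?nm_ge0//.
    by apply: le_trans (nmD _ _) _; rewrite lerD2l nm_sum.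
  apply: lerD; first exact: IH.
  apply: (@le_trans _ _ (\sum_(j < p) (p%:R + 1) ^+ m * (B * (n + p + m * p)%N%:R))).
    by apply: ler_sum => j _; apply: IH.
  by rewrite sumr_const card_ord mulr_natl.
have [h h0 hm] : exists2 h, 0 < h & nm mu / (p%:R + 1) = 1 + h.
  exists (nm mu / (p%:R + 1) - 1); last by rewrite subrKC.
  by rewrite subr_gt0 ltr_pdivlMr// mul1r.
pose n := `|c0|%N.
have hn : (`|c0| < 2 ^ n)%N by exact: ltn_expl.
apply: (@quadratic_contra h (nm (y a0 c0)) (B * n%:R) (B * (2 * p)%:R)) => //.
- by rewrite nm_gt0.
- by rewrite mulr_ge0.
- by rewrite mulr_ge0.
(* The even number of iterations gives (1 + h)^(2 k), the square of a Bernoulli bound and thus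
   quadratic in [k]. *)
move=> k; have := iter (2 * k)%N n _ _ ac0 hn.
rewrite -ler_pdivrMl ?exprn_gt0// [_ ^- _ * _]mulrA -exprVn -exprMn [_^-1 * _]mulrC hm.
rewrite [_ * nm _]mulrC exprM => hk; apply: (@le_trans _ _ (nm (y a0 c0) * ((1 + h) ^+ 2) ^+ k)).
  rewrite ler_wpM2l ?nm_ge0// -!exprM mulnC exprM.
  rewrite ler_pXn2r ?nnegrE ?exprn_ge0 ?addr_ge0 ?mulr_ge0 ?(ltW h0)//.
  elim: (k) => [|j IH]; first by rewrite mul0r addr0 expr0.
  rewrite exprS; have j0 : 0 <= j%:R * h by rewrite mulr_ge0// ltW.
  by rewrite -natr1; nra.
apply: (le_trans hk); rewrite (_ : B * _ = B * n%:R + k%:R * (B * (2 * p)%:R))//.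
by rewrite natrD !natrM; ring.
Qed.

End EigenBound.

(** * The rational period space and the norm of c(p) *)

Section NormBound.
Variable R : realType.
Notation C := (R[i]).
Variables (N : nat) (u : int -> int -> C).
Hypothesis N0 : (0 < N)%N.
Hypothesis u_sc : forall g a c, g != 0 -> (a != 0) || (c != 0) -> u (g * a) (g * c) = u a c.
Hypothesis u10 : u 1 0 = 0.
Hypothesis u_inv : forall a b c d a' b' c' d', inGamma0 N a b c d -> inSL2 a' b' c' d' ->
  u (a * a' + b * c') (c * a' + d * c') - u (a * b' + b * d') (c * b' + d * d') = u a' c' - u b' d'.
Hypothesis u_nz : exists a c, ((a != 0) || (c != 0)) /\ u a c != 0.

Let V (a b c d : int) : C := u a c - u b d.

Lemma period_basis : exists d (e : 'I_d.+1 -> C), [/\ rfree e,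
  forall i, exists a b c d, inSL2 a b c d /\ e i = u a c - u b d &
  forall a c, (a != 0) || (c != 0) -> exists x, u a c = rlin e x].
Proof.
have [s hs] : exists s : seq C, forall a b c d, inSL2 a b c d -> exists2 x, x \in s &
    x = V a b c d /\ (x != 0 -> exists a b c d, inSL2 a b c d /\ x = V a b c d).
  apply: (@coset_seq _ N (fun a b c d x => x = V a b c d /\ (x != 0 -> exists a b c d, inSL2 a b c d /\ x = V a b c d)) 0) => //.
  - by move=> a b c d a' b' c' d' x h h' [-> hx]; split=> //; rewrite /V u_inv.
  - by move=> a b c d h; exists (V a b c d); split=> // _; exists a, b, c, d.
(* Filtering removes default values of empty residue classes, so that every basis vector is itself a
   period; this is used twice in [norm_bound]. *)
pose t := [seq x <- s | `[< exists a b c d, inSL2 a b c d /\ x = V a b c d >]].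
have [d [e [et ef em]]] := rational_basis t.
have es : forall i, exists a b c d, inSL2 a b c d /\ e i = u a c - u b d.
  by move=> i; have := et i; rewrite mem_filter => /andP[/asboolP].
have span : forall a c, (a != 0) || (c != 0) -> exists x, u a c = rlin e x.
  move=> a c ac; apply: (@manin_induction (fun _ a c => exists x, u a c = rlin e x) _ _ _ `|c|%N) => //.
  - by move=> _ g {ac}a {}c g0 ac [x hx]; exists x; rewrite u_sc.
  - by move=> _; exists 0; rewrite u10 rlin0.
  - move=> _ {ac}a b {}c d' h [x hx].
    have [x' x's [x'E _]] := hs _ _ _ _ h.
    have [|x'' hx''] := em x'.
      by rewrite mem_filter x's andbT; apply/asboolP; exists a, b, c, d'.
    exists (x'' + x); rewrite rlinD -hx'' -hx x'E /V subrK//.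
  - exact: ltn_expl.
case: d e ef em es span {et} => [|d] e ef em es span; last by exists d, e.
have [a [c [ac]]] := u_nz; have [x ->] := span _ _ ac.
by rewrite /rlin big_ord0 eqxx.
Qed.

Let toC := (ratr : rat -> C).

(** Rational independence of the periods plays the part of Galois conjugation. A rational matrix
    that kills [E] is zero; as [E] is an eigenvector of [B] for [cc], an integer polynomial
    vanishing at [cc] also annihilates [B]. Thus all eigenvalues of [B] are integral, and [B] is
    invertible because [cc] is nonzero. *)
Lemma norm_bound : exists d : nat, forall p lam, prime p ->
  (forall a c, (a != 0) || (c != 0) ->
     u (p%:Z * a) c + \sum_(j < p) u (a + j%:Z * c) (p%:Z * c) = lam * u a c) ->
  alg_integer ((1 - lam) / p%:R) -> (1 - lam) / p%:R != 0 ->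
  1 <= nm ((1 - lam) / p%:R) * ((p%:R + 2) / p%:R) ^+ d.
Proof.
have [d [e [ef es span]]] := period_basis; exists d => p lam pp hecke [P [Pm Pc]] c0.
set cc := (1 - lam) / p%:R in c0 Pc *.
have p0 : (0 < p)%N by exact: prime_gt0.
have pC : p%:R != 0 :> C by rewrite pnatr_eq0 -lt0n.
have pQ : p%:R != 0 :> rat by rewrite pnatr_eq0 -lt0n.
have ehom x y : rlin e x = rlin e y -> x = y.
  by move=> h; apply/eqP; rewrite -subr_eq0; apply/eqP/ef; rewrite rlinB h subrr.
have HX a c : {x : 'rV[rat]_d.+1 | (a != 0) || (c != 0) -> u a c = rlin e x}.
  by apply: cid; case: (boolP ((a != 0) || (c != 0))) => [/span[x hx]|_]; [exists x|exists 0].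
pose X a c := sval (HX a c).
have XE a c : (a != 0) || (c != 0) -> u a c = rlin e (X a c) := svalP (HX a c).
have colp a c : (a != 0) || (c != 0) -> (p%:Z * a != 0) || (c != 0).
  by move=> ac; rewrite mulf_eq0 eqz_nat negb_or -lt0n p0.
have colj a c j : (a != 0) || (c != 0) -> (a + j%:Z * c != 0) || (p%:Z * c != 0).
  move=> ac; have [cz|cn0] := eqVneq c 0; last by rewrite mulf_neq0 ?orbT// eqz_nat -lt0n.
  by move: ac; rewrite cz !mulr0 addr0.
(* Since [e i] is a difference of values of [u], the Hecke relation itself expresses [lam * e i]
   through rational coordinates. *)
have HA i : {x : 'rV[rat]_d.+1 | lam * e i = rlin e x}.
  apply: cid; have [a [b [c [d' [h ->]]]]] := es i; have [ac bd] := SL2_col h.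
  exists ((X (p%:Z * a) c + \sum_(j < p) X (a + j%:Z * c) (p%:Z * c)) -
          (X (p%:Z * b) d' + \sum_(j < p) X (b + j%:Z * d') (p%:Z * d'))).
  rewrite rlinB !rlinD !rlin_sum mulrBr -!hecke//.
  congr (_ + _ - (_ + _)); rewrite ?XE ?colp//; apply: eq_bigr => j _; rewrite XE ?colj//.
pose A : 'M[rat]_d.+1 := \matrix_i sval (HA i).
pose B : 'M[rat]_d.+1 := p%:R^-1 *: (1 - A).
pose E : 'cV[C]_d.+1 := \col_i e i.
have rE (x : 'rV[rat]_d.+1) : map_mx toC x *m E = (rlin e x)%:M.
  by apply/matrixP => i j; rewrite !ord1 !mxE eqxx mulr1n; apply: eq_bigr => k _; rewrite !mxE.
have AE : map_mx toC A *m E = lam *: E.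
  apply/row_matrixP => i; rewrite row_mul -map_row rowK rE -(svalP (HA i)).
  by apply/matrixP => k l; rewrite !ord1 !mxE eqxx mulr1n.
have BE : map_mx toC B *m E = cc *: E.
  rewrite /B map_mxZ map_mxB map_mx1 fmorphV rmorph_nat -scalemxAl mulmxBl mul1mx AE.
  by rewrite -[X in X - _]scale1r -scalerBl scalerA mulrC.
have kerE (M : 'M[rat]_d.+1) : map_mx toC M *m E = 0 -> M = 0.
  move=> h; apply/row_matrixP => i; rewrite row0; apply: ef.
  have := congr1 (row i) h; rewrite row_mul -map_row rE row0 => /matrixP /(_ 0 0).
  by rewrite !mxE eqxx mulr1n.
pose PQ : {poly rat} := map_poly intr P.
have toCint : toC \o (intr : int -> rat) =1 intr by move=> n /=; rewrite /toC ratr_int.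
have PC : map_poly toC PQ = map_poly intr P.
  by rewrite /PQ -map_poly_comp; apply: eq_map_poly.
have powE (M : 'M[C]_d.+1) (w : 'cV[C]_d.+1) s (Q : {poly C}) : M *m w = s *: w -> horner_mx M Q *m w = Q.[s] *: w.
  move=> hM; elim/poly_ind : Q => [|Q k IH].
    by rewrite rmorph0 horner0 scale0r mul0mx.
  rewrite rmorphD rmorphM /= horner_mx_X horner_mx_C hornerMXaddC mulmxDl -mulmxE.
  by rewrite -mulmxA hM -scalemxAr IH scalerA mul_scalar_mx scalerDl [s * _]mulrC.
have PB : horner_mx B PQ = 0.
  apply: kerE; rewrite map_horner_mx PC (powE _ _ _ _ BE).
  by move/rootP : Pc => ->; rewrite scale0r.
pose BC := map_mx toC B.
have BCdet : \det BC = toC (\det B) by rewrite det_map_mx.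
have detB0 : \det B != 0.
  apply/negP => /det0P[v v0 vB]; move: v0; apply/negP; rewrite negbK; apply/eqP/ef.
  have : map_mx toC (v *m B) *m E = 0 by rewrite vB map_mx0 mul0mx.
  rewrite map_mxM -mulmxA BE -scalemxAr rE => /matrixP /(_ 0 0).
  by rewrite !mxE eqxx mulr1n => /eqP; rewrite mulf_eq0 (negbTE c0) => /eqP.
have eig s : root (char_poly BC) s -> integralOver (intr : int -> C) s /\ nm s <= (p%:R + 2) / p%:R.
  rewrite -eigenvalue_root_char => /eigenvalueP[v0 hv0 v0n].
  (* [eigenvalue] supplies a row vector; a column eigenvector is obtained through the determinant of
     the transpose. *)
  have [w hw wn0] : exists2 w : 'cV[C]_d.+1, BC *m w = s *: w & w != 0.
    have : \det (BC - s%:M)^T == 0.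
      rewrite det_tr; apply/det0P; exists v0 => //.
      by rewrite mulmxBr hv0 mul_mx_scalar subrr.
    case/det0P => v vn0; rewrite -[v]trmxK -trmx_mul => /(congr1 trmx); rewrite trmxK trmx0.
    rewrite mulmxBl mul_scalar_mx => /eqP; rewrite subr_eq0 => /eqP h.
    by exists v^T => //; rewrite -trmx0 (inj_eq trmx_inj).
  have [i wi] : exists i, w i 0 != 0.
    apply/existsP; rewrite -negb_forall; apply/negP => /forallP h; move: wn0; apply/negP.
    by rewrite negbK; apply/eqP/colP => i; rewrite mxE; apply/eqP/(h i).
  split.
    exists P => //; apply/rootP; rewrite -PC.
    have := powE _ _ _ (map_poly toC PQ) hw; rewrite -map_horner_mx PB map_mx0 mul0mx.
    move=> /matrixP /(_ i 0); rewrite !mxE => /esym/eqP.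
    by rewrite mulf_eq0 (negbTE wi) orbF => /eqP.
  pose mu := 1 - p%:R * s.
  have Aw : map_mx toC A *m w = mu *: w.
    have AB : A = 1 - p%:R *: B by rewrite /B scalerA divff// scale1r opprB subrKC.
    rewrite AB map_mxB map_mx1 map_mxZ rmorph_nat mulmxBl mul1mx -scalemxAl hw scalerA.
    by rewrite -[X in X - _]scale1r -scalerBl.
  (* Keeping the rational coordinates [X a c] but replacing the periods [e i] by the entries of [w]
     turns [u] into a cusp function satisfying the same relation with eigenvalue [mu], to which the
     growth argument applies. *)
  pose wf (i : 'I_d.+1) := w i 0.
  have wE (x : 'rV[rat]_d.+1) : map_mx toC x *m w = (rlin wf x)%:M.
    by apply/matrixP => k l; rewrite !ord1 !mxE eqxx mulr1n; apply: eq_bigr => j _; rewrite !mxE.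
  have XA a c : (a != 0) || (c != 0) ->
      X (p%:Z * a) c + \sum_(j < p) X (a + j%:Z * c) (p%:Z * c) = X a c *m A.
    move=> ac; apply: ehom.
    have -> : rlin e (X a c *m A) = lam * u a c.
      have := rE (X a c *m A); rewrite map_mxM -mulmxA AE -scalemxAr rE -XE// => /matrixP /(_ 0 0).
      by rewrite !mxE eqxx !mulr1n.
    rewrite -hecke// rlinD rlin_sum XE ?colp//; congr (_ + _).
    by apply: eq_bigr => j _; rewrite XE ?colj.
  have [Bd hBd] : exists x : R, forall a b c d', inSL2 a b c d' ->
      nm (rlin wf (X a c) - rlin wf (X b d')) <= x.
    apply: (@coset_uniform R N (fun a b c d' x => nm (rlin wf (X a c) - rlin wf (X b d')) <= x)); first exact: N0.
    - by move=> a b c d' x y xy h; apply: le_trans xy.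
    - move=> a b c d' a1 b1 c1 d1 x h h1 hx; rewrite -rlinB.
      have [hs1 hs2] := SL2_col h1.
      have [ht1 ht2] := SL2_col (SL2_mul (proj1 h) h1).
      set x1 := (_ - _); suff -> : x1 = X a1 c1 - X b1 d1 by rewrite rlinB.
      by apply: ehom; rewrite !rlinB -!XE//; exact: u_inv.
    - by move=> a b c d' _; exists (nm (rlin wf (X a c) - rlin wf (X b d'))).
  have hmu : nm mu <= p%:R + 1.
    apply: (@hecke_eigen_bound R (fun a c => rlin wf (X a c)) (Num.max Bd 0)) => //.
    - by rewrite le_max lexx orbT.
    - move=> g a c g0 ac; congr rlin; apply: ehom; rewrite -!XE ?u_sc//.
      by rewrite !mulf_eq0 !negb_or g0.
    - by rewrite (ehom (X 1 0) 0) ?rlin0// -XE.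
    - by move=> a b c d' h; rewrite le_max hBd.
    - move=> a c ac; rewrite -rlin_sum -rlinD XA//.
      have := wE (X a c *m A); rewrite map_mxM -mulmxA Aw -scalemxAr wE => /matrixP /(_ 0 0).
      by rewrite !mxE eqxx !mulr1n.
    (* The new function is nonzero: on the unimodular pair whose period is [e i] it takes the
       difference [w i 0]. *)
    - have [a [b [c [d' [h hi]]]]] := es i; have [ac bd] := SL2_col h.
      have Ei : X a c - X b d' = delta_mx 0 i.
        by apply: ehom; rewrite rlinB -!XE// rlin_delta.
      have : rlin wf (X a c) - rlin wf (X b d') != 0 by rewrite -rlinB Ei rlin_delta.
      have [->|n0 _] := eqVneq (rlin wf (X a c)) 0; last by exists a, c.
      by rewrite sub0r oppr_eq0 => n0; exists b, d'.
  have -> : s = (1 - mu) / p%:R by rewrite /mu opprB subrKC mulrC mulKf.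
  rewrite nmM nmV nm_nat ler_wpM2r ?invr_ge0//.
  by apply: le_trans (nmD _ _) _; rewrite nmN nm1; lra.
have [r hr] := closed_field_poly_normal (char_poly BC).
rewrite (monicP (char_poly_monic BC)) scale1r in hr.
have rr s : s \in r -> root (char_poly BC) s by rewrite hr root_prod_XsubC.
have szr : size r = d.+1.
  by have := size_char_poly BC; rewrite hr size_prod_XsubC => -[].
have detr : nm (\det BC) = \prod_(z <- r) nm z.
  have := char_poly_det BC; rewrite hr -horner_coef0 horner_prod => /(congr1 (@ComplexField.Normc.normc R)).
  rewrite nmM nmX nmN nm1 expr1n mul1r => <-.
  elim: (r) => [|z r' IH]; first by rewrite !big_nil nm1.
  by rewrite !big_cons nmM IH hornerXsubC sub0r nmN.
have cr : cc \in r.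
  rewrite -root_prod_XsubC -hr -eigenvalue_root_char.
  have [|] := boolP (\det (BC - cc%:M) == 0).
    case/det0P => v vn0; rewrite mulmxBr mul_mx_scalar => /eqP; rewrite subr_eq0 => /eqP h.
    by apply/eigenvalueP; exists v.
  rewrite -unitfE -/(_ \in unitmx) => un; exfalso.
  have E0 : E = 0.
    apply: (can_inj (mulKmx un)); rewrite mulmx0 mulmxBl BE mul_scalar_mx subrr//.
  have : rlin e (delta_mx 0 0) = 0.
    by rewrite rlin_delta; have /matrixP /(_ 0 0) := E0; rewrite !mxE.
  by move/ef/matrixP => /(_ 0 0); rewrite !mxE !eqxx => /eqP; rewrite oner_eq0.
have det1 : 1 <= nm (\det BC).
  have hint : integralOver (intr : int -> C) (\det BC).
    have -> : \det BC = (-1) ^+ d.+1 * ((-1) ^+ d.+1 * \det BC) by rewrite mulrA -exprMn mulrNN mulr1 expr1n mul1r.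
    rewrite -char_poly_det hr -horner_coef0 horner_prod.
    apply: (@integral_mul int C intr).
      by elim: d.+1 => [|n IH]; rewrite ?expr0 ?exprS; [exact: integral1|apply: integral_mul => //; apply: integral_opp; exact: integral1].
    have : {subset r <= r} by []. move: {1 3}r => r1 hr1.
    elim: r1 hr1 => [|z r' IH] hr1; first by rewrite big_nil; exact: integral1.
    rewrite big_cons; apply: integral_mul; last by apply: IH => y hy; apply: hr1; rewrite inE hy orbT.
    rewrite hornerXsubC sub0r; apply: integral_opp.
    by have [] := eig z _; first by apply: rr; apply: hr1; rewrite inE eqxx.
  have [n hn] : exists n : int, \det B = n%:~R.
    case: hint => Q Qm; rewrite BCdet => Qr; apply: (rational_integral Qm).
    rewrite -(fmorph_root (ratr : {rmorphism rat -> C})).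
    by rewrite -map_poly_comp (eq_map_poly toCint).
  rewrite BCdet hn /toC ratr_int -(rmorph_int (real_complex R)) nm_real -intr_norm ler1z.
  rewrite -gtz0_ge1 normr_gt0; apply/eqP => n0; move: detB0.
  by rewrite hn n0 eqxx.
(* The root [cc] keeps its own modulus; only the [d] remaining roots are estimated by (p + 2) /
   p. *)
apply: (le_trans det1); rewrite detr (perm_big _ (perm_to_rem cr)) big_cons /=.
rewrite ler_wpM2l ?nm_ge0//.
have -> : d = size (rem cc r) by rewrite size_rem// szr.
have : {subset rem cc r <= r} by exact: mem_rem.
elim: (rem cc r) => [|z r' IH] hsub; first by rewrite big_nil expr0.
rewrite big_cons exprS ler_pM ?nm_ge0//.
- by rewrite prodr_ge0// => i _; rewrite nm_ge0.
- by have [] := eig z _; first by apply: rr; apply: hsub; rewrite inE eqxx.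
- by apply: IH => y hy; apply: hsub; rewrite inE hy orbT.
Qed.

End NormBound.

(** * The improved bound for lam from the oscillation of F *)

Section OwnBound.
Variable R : realType.
Notation C := (R[i]).
Implicit Types (z w v : C) (a b c d : int) (x y : R).

Lemma inH_scale (m : nat) z : (0 < m)%N -> inH z -> inH (m%:R * z).
Proof.
move=> m0; rewrite /inH /imC !ReImE mul0r addr0 => hz.
by rewrite mulr_gt0// ltr0n.
Qed.

Lemma mob_shiftE (p j : nat) z : mob 1 j%:Z 0 p%:Z z = (z + j%:R) / p%:R.
Proof. by rewrite /mob mul1r mul0r add0r. Qed.

Variables (N : nat) (F : C -> C) (k : R).
Hypothesis N0 : (0 < N)%N.
Hypothesis k4 : k <= 1 / 4.
Hypothesis F_bound : exists B : R, forall z w, inH z -> inH w -> rho z w <= k -> nm (F w - F z) <= B.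
Hypothesis F_nonconst : exists z w, [/\ inH z, inH w, rho z w <= k & F z != F w].
Hypothesis F_Gam : forall a b c d, inGamma0 N a b c d -> exists phi, forall z, inH z ->
  F (mob a b c d z) = F z + phi.
Hypothesis F_cusp : forall e : R, 0 < e -> exists2 Y : R, 0 <= Y & forall a b c d, inSL2 a b c d ->
  forall z w, Y < complex.Im z -> Y < complex.Im w ->
  nm (F (mob a b c d w) - F (mob a b c d z)) < e.

(** [Om], the supremum of [E], is the oscillation of F over hyperbolic balls. Moebius maps of
    positive determinant preserve [rho], so each term of a Hecke sum changes by at most [Om]. *)
Let E : set R := [set r : R | exists z w, [/\ inH z, inH w, rho z w <= k & r = nm (F w - F z)]].
Let Om := sup E.

Let Om_ub z w : inH z -> inH w -> rho z w <= k -> nm (F w - F z) <= Om.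
Proof.
move=> hz hw h; apply: (@ub_le_sup _ E); last by exists z, w.
by have [B hB] := F_bound; exists B => _ [z' [w' [h1 h2 h3 ->]]]; exact: hB.
Qed.

Let Om_gt0 : 0 < Om.
Proof.
have [z [w [hz hw h n0]]] := F_nonconst; apply: lt_le_trans (Om_ub hz hw h).
by rewrite nm_gt0 subr_eq0 eq_sym.
Qed.

Let Om_adh x : x < Om -> exists z w, [/\ inH z, inH w, rho z w <= k & x < nm (F w - F z)].
Proof.
move=> xO; apply: contrapT => H; move: xO; apply/negP; rewrite -leNgt; apply: ge_sup.
  by have [z [w [hz hw h _]]] := F_nonconst; exists (nm (F w - F z)), z, w.
move=> _ [z [w [hz hw h ->]]]; rewrite leNgt; apply/negP => hx; apply: H.
by exists z, w.
Qed.

(* For z in a fixed compact set and p large, the points pz and (z+j)/p, j < M, all lie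
   high in cusps, where F is nearly constant, so M+1 terms of T_p F almost cancel. *)
Let hecke_gain (M : nat) (X y : R) : 0 < y -> exists x, forall p lam K, (0 < p)%N -> x <= p%:R ->
  (forall z, inH z -> TF F p z = lam * F z + K) ->
  forall z w, inH z -> inH w -> rho z w <= k -> nm z <= X -> y <= complex.Im z ->
  nm lam * nm (F w - F z) <= (p%:R - M%:R / 2 + 1 / 2) * Om.
Proof.
move=> y0; have Om20 : 0 < Om / 2 by have := Om_gt0; lra.
have [Y Y0 hY] := F_cusp Om20.
(* The height of -p / (v + j) is p Im v / |v + j|^2, with Im v >= y / 2 and |v + j| <= 2 X + M;
   [p >= x] lifts it above [Y]. The summand [M] ensures that there are at least [M] terms. *)
pose x := (Y + 1) * (2 * `|X| + M%:R + 1) ^+ 2 / (y / 2) + M%:R.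
exists x => p lam K p0 xp hT z w hz hw hr zX yz.
have pR : 0 < p%:R :> R by rewrite ltr0n.
have X0 : 0 <= X by apply: le_trans zX; exact: nm_ge0.
rewrite /x (ger0_norm X0) in xp.
have sq1 : 1 <= (2 * X + M%:R + 1) ^+ 2 by have : 0 <= M%:R :> R by []; nra.
have hpy : (Y + 1) * (2 * X + M%:R + 1) ^+ 2 <= p%:R * (y / 2).
  by rewrite -ler_pdivrMr; [have : 0 <= M%:R :> R by []; lra|lra].
have Mp : (M <= p)%N.
  rewrite -(ler_nat R); apply: le_trans xp; rewrite lerDr divr_ge0//; last lra.
  by rewrite mulr_ge0 ?sqr_ge0//; lra.
have [i1 i2] := rho_Im hz hw hr k4.
have yw : y / 2 <= complex.Im w by lra.
have wX : nm w <= 2 * X.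
  have iX : complex.Im z <= X by apply: le_trans zX; apply: le_trans (ler_norm _) (nm_Im _).
  suff : nm (w - z) <= complex.Im z by have := nm_sub w z; lra.
  rewrite -(ler_pXn2r (n := 2)) ?nnegrE ?nm_ge0//; last by rewrite ltW.
  move: hr; rewrite rho_le// nmB => h; apply: (le_trans h).
  have ab0 : 0 < complex.Im z * complex.Im w by rewrite mulr_gt0.
  have kab : k * (complex.Im z * complex.Im w) <= 1 / 4 * (complex.Im z * complex.Im w).
    by rewrite ler_pM2r.
  have ab : complex.Im z * complex.Im w <= complex.Im z * (2 * complex.Im z) by rewrite ler_pM2l.
  by have := sqr_ge0 (complex.Im z); lra.
have det1 : 0 < p%:Z * 1 - 0 * 0 by rewrite mulr1 mul0r subr0.
have det2 j : 0 < 1 * p%:Z - j%:Z * 0 by rewrite mul1r mulr0 subr0.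
have det3 j : 0 < 0 * j%:Z - (- p%:Z) * 1 by rewrite mul0r mulr1 opprK add0r.
have A0 : nm (F (p%:R * w) - F (p%:R * z)) <= Om / 2.
  have s1 : inSL2 1 0 0 1 by [].
  apply: ltW; have := hY _ _ _ _ s1 (p%:R * z) (p%:R * w); rewrite !mob1; apply.
    by rewrite ImM ReNat ImNat mul0r addr0; nra.
  by rewrite ImM ReNat ImNat mul0r addr0; nra.
have A1 (j : 'I_p) : nm (F ((w + j%:R) / p%:R) - F ((z + j%:R) / p%:R)) <= Om.
  by rewrite -!mob_shiftE; apply: Om_ub; [exact: inH_mob|exact: inH_mob|rewrite rho_mob].
have A2 (j : 'I_p) : (j < M)%N -> nm (F ((w + j%:R) / p%:R) - F ((z + j%:R) / p%:R)) <= Om / 2.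
  move=> jM; have s : inSL2 0 (-1) 1 0 by [].
  (* For [j < M] the point (v + j) / p is close to the cusp 0: it is the image under the inversion
     of the high point -p / (v + j). *)
  have up v : inH v -> y / 2 <= complex.Im v -> nm v <= 2 * X ->
      (v + j%:R) / p%:R = mob 0 (-1) 1 0 (mob 0 (- p%:Z) 1 j%:Z v) /\
      Y < complex.Im (mob 0 (- p%:Z) 1 j%:Z v).
    move=> hv yv vX; split.
      rewrite mob_comp// -mob_shiftE.
      have := @mob_scale R (-1) 1 j%:Z 0 p%:Z v isT => <-.
      by congr mob; ring.
    have d0 := den_neq0 hv (det3 j).
    have dn : nm (den 1 j%:Z v) <= 2 * X + M%:R + 1.
      rewrite /den mul1r; apply: le_trans (nmD _ _) _.
      rewrite nm_nat; have : j%:R <= M%:R :> R by rewrite ler_nat ltnW.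
      by lra.
    rewrite Im_mob// ltr_pdivlMr; last by rewrite exprn_gt0// nm_gt0.
    rewrite mul0r mulr1 opprK add0r /=.
    have : nm (den 1 j%:Z v) ^+ 2 <= (2 * X + M%:R + 1) ^+ 2.
      by rewrite ler_pXn2r ?nnegrE ?nm_ge0//; apply: le_trans dn; exact: nm_ge0.
    have : p%:R * (y / 2) <= p%:R * complex.Im v by rewrite ler_pM2l.
    have := sqr_ge0 (nm (den 1 j%:Z v)).
    by rewrite -[X in _ < X * _](_ : p%:R = _)//; nra.
  have yz2 : y / 2 <= complex.Im z by lra.
  have zX2 : nm z <= 2 * X by lra.
  have [-> up1] := up _ hw yw wX; have [-> up2] := up _ hz yz2 zX2.
  exact/ltW/hY.
rewrite -nmM (_ : lam * _ = TF F p w - TF F p z); last by rewrite !hT//; ring.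
rewrite /TF opprD addrACA; apply: le_trans (nmD _ _) _.
rewrite -sumrB.
apply: (@le_trans _ _ (Om / 2 + \sum_(j < p) (if (j < M)%N then Om / 2 else Om))).
  apply: lerD => //; apply: le_trans (nm_sum _ _ _) _; apply: ler_sum => j _.
  by case: ifP => [|_]; [exact: A2|exact: A1].
have -> : \sum_(j < p) (if (j < M)%N then Om / 2 else Om) = p%:R * Om - M%:R * (Om / 2).
  rewrite (eq_bigr (fun j : 'I_p => Om - (if (j < M)%N then Om / 2 else 0))); last first.
    by move=> j _; case: ifP => _; [field|rewrite subr0].
  rewrite sumrB sumr_const card_ord -big_mkcond /= mulr_natl; congr (_ - _).
  by rewrite (big_ord_narrow Mp) /= sumr_const card_ord mulr_natl.
by have := Om_gt0; lra.
Qed.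

(** A pair whose difference almost attains [Om] cannot be high in a cusp, where differences are
    below Om / 2. After reduction it lies in a compact part of the strip, where [hecke_gain]
    applies. *)
Lemma eigenvalue_own_bound (M : nat) : exists p0 : R, forall p lam K, (0 < p)%N -> p0 <= p%:R ->
  (forall z, inH z -> TF F p z = lam * F z + K) ->
  nm lam <= p%:R - M%:R / 2 + 1 / 2.
Proof.
have Om20 : 0 < Om / 2 by have := Om_gt0; lra.
have [Y Y0 hY] := F_cusp Om20.
have [x hx] : exists x, forall a b c d, inSL2 a b c d ->
   forall p lam K, (0 < p)%N -> x <= p%:R ->
  (forall z, inH z -> TF F p z = lam * F z + K) ->
  forall z w, inH z -> inH w -> rho z w <= k -> `|complex.Re z| <= 1 / 2 -> 1 / 2 <= complex.Im z ->
  complex.Im z <= 2 * Y ->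
  nm lam * nm (F (mob a b c d w) - F (mob a b c d z)) <= (p%:R - M%:R / 2 + 1 / 2) * Om.
  pose P a b c d x := forall p lam K, (0 < p)%N -> x <= p%:R ->
  (forall z, inH z -> TF F p z = lam * F z + K) ->
  forall z w, inH z -> inH w -> rho z w <= k -> `|complex.Re z| <= 1 / 2 -> 1 / 2 <= complex.Im z ->
  complex.Im z <= 2 * Y ->
  nm lam * nm (F (mob a b c d w) - F (mob a b c d z)) <= (p%:R - M%:R / 2 + 1 / 2) * Om.
  apply: (@coset_uniform R N P) => //.
  - by move=> a b c d x y xy h p lam K p0 yp; apply: h => //; apply: le_trans yp.
  - move=> a b c d a' b' c' d' x hg h' h p lam K p0 xp hT z w hz hw hr h1 h2 h3.
    have [phi hphi] := F_Gam hg.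
    rewrite -!mob_comp ?SL2_det// (hphi _ (inH_SL2 hz h')) (hphi _ (inH_SL2 hw h')).
    by rewrite opprD addrACA subrr addr0; apply: (h _ _ K).
  - move=> a b c d h; pose A : R := 1 / 2 + 2 * Y.
    pose ra : R := `|a%:~R|; pose rb : R := `|b%:~R|; pose rc : R := `|c%:~R|; pose rd : R := `|d%:~R|.
    have nmint (m : int) : nm (m%:~R : C) = `|m%:~R|.
      by rewrite -(rmorph_int (real_complex R)) nm_real.
    have A0 : 0 <= A by rewrite /A; lra.
    (* [A] bounds |z| on the truncated strip, so |c z + d| <= rc A + rd and the image has height at
       least [y]. Since also |c z + d| >= 1 / 2, the image has modulus at most 2 (ra A + rb). *)
    pose y := (1 / 2) / (rc * A + rd + 1) ^+ 2.
    have ra0 : 0 <= ra := normr_ge0 _. have rb0 : 0 <= rb := normr_ge0 _.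
    have rc0 : 0 <= rc := normr_ge0 _. have rd0 : 0 <= rd := normr_ge0 _.
    have D0 : 0 < rc * A + rd + 1 by have := mulr_ge0 rc0 A0; lra.
    have y0 : 0 < y by rewrite divr_gt0 ?exprn_gt0//; lra.
    have [x hx] := hecke_gain M (2 * (ra * A + rb)) y0.
    exists x => p lam K p0 xp hT z w hz hw hr h1 h2 h3.
    have zA : nm z <= A.
      apply: le_trans (nm_ReIm _) _; rewrite (ger0_norm (ltW hz)) /A; lra.
    have denle (m n : int) : nm (den m n z) <= `|m%:~R| * A + `|n%:~R|.
      by apply: le_trans (nmD _ _) _; rewrite nmM !nmint lerD2r ler_wpM2l.
    have denge : 1 / 2 <= nm (den c d z).
      have [c0|c0] := eqVneq c 0.
        rewrite /den c0 mul0r add0r nmint; move: h; rewrite /inSL2 c0 mulr0 subr0 => h.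
        have : (`|d| >= 1)%R by rewrite -gtz0_ge1 normr_gt0; apply: contra_eq_neq h => ->; rewrite mulr0.
        by rewrite -(ler1z R) intr_norm; lra.
      apply: le_trans (nm_Im _); rewrite /den ImD ImM ReInt !ImInt mul0r !addr0 normrM.
      rewrite (ger0_norm (ltW hz)).
      have : 1 <= `|c%:~R| :> R by rewrite -intr_norm ler1z -gtz0_ge1 normr_gt0.
      by nra.
    apply: (hx _ _ K) => //; try exact: inH_SL2.
    + by rewrite rho_mob// SL2_det.
    + rewrite mobE nmM nmV ler_pdivrMr; last by lra.
      have := denle a b; rewrite -/ra -/rb => h4.
      have : 0 <= ra * A + rb by rewrite addr_ge0// mulr_ge0.
      by nra.
    + rewrite Im_mob ?SL2_det// (_ : a * d - b * c = 1) // mul1r.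
      apply: ler_pM; rewrite ?invr_ge0 ?sqr_ge0//.
      have nd0 : 0 < nm (den c d z) by lra.
      rewrite lef_pV2 ?posrE ?exprn_gt0//.
      rewrite ler_pXn2r ?nnegrE ?nm_ge0 ?(ltW D0)//.
      by have := denle c d; rewrite -/rc -/rd; lra.
exists (Num.max x (M%:R + 1)) => p lam K p0; rewrite ge_max => /andP[xp Mp] hT.
set B := _ + 1 / 2.
have B0 : 0 < B by rewrite /B; have : 0 <= M%:R :> R by []; lra.
rewrite leNgt; apply/negP => hlt.
have l0 : 0 < nm lam by apply: lt_trans hlt.
(* The value 1 / 2 rules out cusp neighbourhoods, and [B / nm lam], less than 1 by assumption,
   contradicts the gain on the compact part. *)
pose t := Num.max (1 / 2) (B / nm lam).
have t1 : t < 1.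
  by rewrite gt_max; apply/andP; split; [lra|rewrite ltr_pdivrMr// mul1r].
have tO : t * Om < Om by rewrite -[ltRHS]mul1r ltr_pM2r.
have [z [w [hz hw hr hd]]] := Om_adh tO.
have d1 : Om / 2 < nm (F w - F z).
  apply: le_lt_trans hd; rewrite mulrC ler_pM2r ?Om_gt0// /t le_max; apply/orP; left; lra.
have d2 : B / nm lam * Om < nm (F w - F z).
  by apply: le_lt_trans hd; rewrite ler_pM2r ?Om_gt0// /t le_max lexx orbT.
have [a [b [c [d [h [hre him]]]]]] := fundamental_reduction hz.
have hV := SL2_inv h.
have zE : z = mob d (- b) (- c) a (mob a b c d z) by rewrite mobK.
have wE : w = mob d (- b) (- c) a (mob a b c d w) by rewrite mobK.
have hz' := inH_SL2 hz h; have hw' := inH_SL2 hw h.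
have hr' : rho (mob a b c d z) (mob a b c d w) <= k by rewrite rho_mob// SL2_det.
have [i1 i2] := rho_Im hz' hw' hr' k4.
have [hlow|hhigh] := leP (complex.Im (mob a b c d z)) (2 * Y); last first.
  have := hY _ _ _ _ hV (mob a b c d z) (mob a b c d w).
  rewrite -zE -wE => H; have : nm (F w - F z) < Om / 2 by apply: H; lra.
  by lra.
have := hx _ _ _ _ hV p lam K p0 xp hT _ _ hz' hw' hr' hre him hlow.
rewrite -zE -wE -/B; apply/negP; rewrite -ltNge.
by move: d2; rewrite mulrAC ltr_pdivrMr// [nm lam * _]mulrC.
Qed.

End OwnBound.

(** * Exponential growth of the q-exponents *)

Section QGrowth.
Variable R : realType.
Notation C := (R[i]).
Implicit Types (z w : C) (x y : R).

Lemma nm_qz z : nm (qz z) = expR (- (2 * pi * complex.Im z)).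
Proof.
rewrite /qz nm_cexp; congr expR; rewrite !ReImE /=; ring.
Qed.

Lemma qz_neq0 z : qz z != 0.
Proof. exact: cexp_neq0. Qed.

Lemma qz_small (e : R) : 0 < e -> exists2 Y : R, 0 <= Y & forall z, Y < complex.Im z -> nm (qz z) < e.
Proof.
move=> e0; exists (Num.max 0 (- ln e)); first by rewrite le_max lexx.
move=> z; rewrite gt_max => /andP[i0 i1]; rewrite nm_qz -[ltRHS]lnK// ltr_expR.
have := pi_ge2 R; nra.
Qed.

Lemma qz_nat_mul (p : nat) z : qz (p%:R * z) = qz z ^+ p.
Proof. by rewrite /qz mulrCA cexpMn. Qed.

Lemma qz_add z w : qz (z + w) = qz z * qz w.
Proof. by rewrite /qz mulrDr cexpD. Qed.

Lemma nm_qz_real z x : nm (qz (z + x%:C)) = nm (qz z).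
Proof. by rewrite !nm_qz ImD /= addr0. Qed.

(** The arithmetic of [exponent_growth], where a, x, y are |A|, |Re A|, |Im A|, w is |Im s|, q is
    5^(n+1) and v is r^(n+1). As 1728 = 6 * 288, the error terms add up to at most a / 2. *)
Lemma growth_arith (a x y w q v : R) : 0 <= a -> a <= x + y -> 0 <= y ->
  x <= 1 + 288 * v * a -> y * w <= 2 + 2 * (288 * v * a) -> 1 <= q -> q^-1 <= w ->
  q * v * 1728 <= 1 -> a <= 6 * q.
Proof.
move=> a0 axy y0 hx hyw q1 qw qv.
have hy : y <= q * (2 + 2 * (288 * v * a)).
  have q0 : 0 < q by lra.
  by rewrite -ler_pdivrMl//; apply: le_trans hyw; rewrite mulrC ler_wpM2l.
have := ler_wpM2r a0 qv; rewrite mul1r => qva.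
have [v0|v0] := leP 0 v; last by have := mulr_ge0 a0 (ltW (_ : 0 < - v)); nra.
have va := mulr_ge0 v0 a0.
by have := ler_wpM2r va q1; rewrite mul1r; nra.
Qed.

Lemma exponential_bound (b : nat -> R) (q : R) (n0 : nat) : (forall n, 0 <= b n) -> 0 < q ->
  (forall n, (n0 <= n)%N -> b n <= 6 * q ^+ n.+1) ->
  exists2 K : R, 1 <= K & forall n, b n <= K ^+ n.+2.
Proof.
move=> b0 q0 big; pose S := \sum_(j < n0) b j.
have S0 : 0 <= S by exact: sumr_ge0.
have K1 : 1 <= S + 6 + q by lra.
have K0 : 0 <= S + 6 + q by lra.
exists (S + 6 + q) => // n; have [nn|nn] := leqP n0 n.
  apply: le_trans (big n nn) _; rewrite [leRHS]exprS; apply: ler_pM => //; [by rewrite exprn_ge0// ltW|lra|].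
  by rewrite ler_pXn2r ?nnegrE ?(ltW q0)//; lra.
apply: (@le_trans _ _ S); first by rewrite /S (bigD1 (Ordinal nn))//= lerDl sumr_ge0.
by apply: (@le_trans _ _ (S + 6 + q)); [lra|rewrite exprS ler_peMr ?exprn_ege1].
Qed.

Lemma cexp_real x : cexp (x%:C) = (expR x)%:C.
Proof. by rewrite /cexp /reC /imC /= cos0 sin0 mulr1. Qed.

Lemma cexp_imag x : cexp (0 +i* x) = cos x +i* sin x.
Proof. by rewrite /cexp /reC /imC /= expR0 mul1r. Qed.

Lemma qz_real x : qz (x%:C) = cos (2 * pi * x) +i* sin (2 * pi * x).
Proof.
rewrite /qz -cexp_imag; congr cexp; apply: complexP; rewrite !ReImE /=; ring.
Qed.

Lemma qz_imag y : qz (0 +i* y) = (expR (- (2 * pi * y)))%:C.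
Proof.
rewrite /qz -cexp_real; congr cexp; apply: complexP; rewrite !ReImE /=; ring.
Qed.

(** (3 + 4 i)^2 = -7 + 24 i is congruent to 3 + 4 i modulo 5, hence so are all positive powers;
    their imaginary parts never vanish. *)
Lemma pythagorean_power n : exists k l : int,
  ((3 +i* 4 : C) ^+ n.+1) = (5 * k + 3)%:~R +i* (5 * l + 4)%:~R.
Proof.
elim: n => [|n [k [l IH]]]; first by exists 0, 0; rewrite expr1 !mulr0 !add0r.
exists (3 * k - 4 * l - 2), (4 * k + 3 * l + 4); rewrite exprSr IH.
by apply: complexP; rewrite /= !(rmorphD, rmorphN, rmorphM) /=; ring.
Qed.

(* The rotation by (3+4i)/5 has no power close to the real line, which turns a
   bound on the real parts at two points into a bound on the modulus. *)
Lemma rotation_Im n : (5 ^- n.+1 : R) <= `|complex.Im (((3 / 5) +i* (4 / 5) : C) ^+ n.+1)|.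
Proof.
have -> : (3 / 5) +i* (4 / 5) = (5^-1)%:C * (3 +i* 4) :> C.
  by apply: complexP; rewrite !ReImE /=; ring.
have [k [l E]] := pythagorean_power n.
rewrite exprMn E -(rmorphXn (real_complex R)) ImRM [complex.Im _]/= normrM exprVn ger0_norm ?invr_ge0 ?exprn_ge0//.
rewrite ler_peMr ?invr_ge0 ?exprn_ge0// -intr_norm ler1z; lia.
Qed.

Variables (f : C -> C) (C0 : C) (h : int) (c : nat -> C).
Hypothesis f0 : forall z, inH z -> f z != 0.
Hypothesis fq : q_exponents f C0 h c.

Definition Epart m z := \sum_(n < m) c n.+1 * LogRH (1 - qz z ^+ n.+1).

Lemma f_product : exists2 Y : R, 0 <= Y & forall z, Y < complex.Im z -> forall e : R, 0 < e ->
  exists n0 : nat, forall M, (n0 <= M)%N -> nm (C0 * qz z ^ h * cexp (Epart M z) - f z) < e.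
Proof.
have [_ [Y hY]] := fq; exists (Num.max 0 Y); first by rewrite le_max lexx.
move=> z; rewrite gt_max => /andP[hz hi] e e0.
have /cvgrPdist_lt /(_ e%:C) := hY z hz hi; rewrite ltcR => /(_ e0) [n0 _ hn].
exists n0 => M hM; have := hn M hM; rewrite /= ltr_nm nmB.
by rewrite /Epart cexp_sum.
Qed.

(** Consecutive partial products are both close to f(z), which is nonzero, so the exponential of the
    new term is close to 1. This controls its modulus, that is, only the real part of the term. *)
Lemma factor_Re_bound : exists2 Y : R, 0 <= Y & forall z, Y < complex.Im z ->
  exists n0 : nat, forall n, (n0 <= n)%N -> `|complex.Re (c n.+1 * LogRH (1 - qz z ^+ n.+1))| <= 1.
Proof.
have [Y Y0 hY] := f_product; exists Y => // z hz.
have hz' : inH z by rewrite /inH /imC; lra.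
have fz := f0 hz'.
have [|n0 hn] := hY z hz (nm (f z) * ((1 / 2) / 4)); first by rewrite mulr_gt0 ?nm_gt0//; lra.
exists n0 => n nn; have h1 := hn n nn; have h2 := hn n.+1 (leqW nn).
have := ratio_near fz _ _ h1 h2 => /(_ _ _)/= H.
have {H} : nm (C0 * qz z ^ h * cexp (Epart n.+1 z) / (C0 * qz z ^ h * cexp (Epart n z)) - 1) < 1 / 2.
  by apply: ratio_near fz _ _ h1 h2; lra.
rewrite /Epart big_ord_recr /= cexpD.
have C00 : C0 != 0 by case: fq.
set w := c n.+1 * _; rewrite (_ : _ / _ = cexp w); last first.
  field; rewrite cexp_neq0 C00 /= andbT; exact/expfz_neq0/qz_neq0.
move=> hw; have e2 := expR_ge1Dx (1 : R).
have := nm_sub (cexp w) 1; have := nm_sub 1 (cexp w); rewrite (nmB 1) nm1 nm_cexp => a1 a2.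
rewrite ler_norml; apply/andP; split.
  rewrite -ler_expR expRN; apply: (@le_trans _ _ (1 / 2)); last by lra.
  by rewrite div1r lef_pV2 ?posrE ?expR_gt0//.
by rewrite -ler_expR; lra.
Qed.

(** With LogRH (1 - q^n) replaced by -q^n, the real parts of A = c(n) r^n and of A s are bounded, at
    two points whose q have equal modulus r and arguments differing by that of (3 + 4 i) / 5. Since
    |Im s| >= 5^(-n), they bound A. *)
Lemma exponent_growth : exists2 K : R, 1 <= K & forall n, nm (c n.+1) <= K ^+ n.+2.
Proof.
have [Y Y0 hY] := factor_Re_bound.
have [Y1 _ hY1] := @qz_small (1 / 10) ltac:(lra).
have [y yY yY1] : exists2 y, Y < y & Y1 < y.
  have Ym : Num.max Y Y1 < Num.max Y Y1 + 1 by rewrite ltrDl ltr01.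
  by exists (Num.max Y Y1 + 1); apply: le_lt_trans Ym; rewrite le_max lexx ?orbT.
have [z1 [z2 [r [[i1 i2] [r0 r1] [q1 q2]]]]] : exists z1 z2 r,
    [/\ Y < complex.Im z1 /\ Y < complex.Im z2, 0 < r /\ r < 1 / 10 &
     qz z1 = r%:C /\ qz z2 = r%:C * ((3 / 5) +i* (4 / 5))].
  (* Translation by [th] multiplies [qz] by exp(i acos(3/5)) = (3 + 4 i) / 5. *)
  pose z1 : C := 0 +i* y; pose th : R := acos (3 / 5) / (2 * pi).
  have q1 : qz z1 = (nm (qz z1))%:C by rewrite nm_qz qz_imag.
  exists z1, (z1 + th%:C), (nm (qz z1)); split.
  - by rewrite ImD /= addr0.
  - by rewrite nm_gt0 qz_neq0 hY1.
  - split=> //; rewrite qz_add -q1 qz_real.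
    have -> : 2 * pi * th = acos (3 / 5).
      by rewrite /th mulrC divfK// gt_eqF// mulr_gt0// pi_gt0.
    have i35 : -1 <= (3 / 5 : R) <= 1 by apply/andP; split; lra.
    rewrite acosK// sin_acos//; congr (_ * (_ +i* _)).
    rewrite (_ : 1 - (3 / 5) ^+ 2 = (4 / 5) ^+ 2 :> R); last by field.
    by rewrite sqrtr_sqr ger0_norm//; lra.
have [n1 hn1] := hY z1 i1.
have [n2 hn2] := hY z2 i2.
have [n3 hn3] : exists n3 : nat, forall n, (n3 <= n)%N -> (5 * r) ^+ n.+1 * 1728 <= 1.
  have [n3 hn3] : exists n3 : nat, 1728 < n3%:R :> R.
    by exists (Num.Def.archi_bound (1728 : R)); apply: archi_boundP; lra.
  exists n3 => n n3n; have {}hn3 : 1728 <= 2 ^+ n.+1 :> R.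
    apply: ltW; apply: (lt_le_trans hn3); rewrite -natrX ler_nat.
    by apply: (leq_trans n3n); apply: (leq_trans (leqnSn n)); exact/ltnW/ltn_expl.
  have h0 : 0 <= 5 * r by rewrite mulr_ge0 ?(ltW r0).
  have h1 : 0 <= 5 * r * 2 by rewrite mulr_ge0.
  have h2 : 5 * r * 2 <= 1 by lra.
  apply: le_trans (ler_wpM2l _ hn3) _; first by rewrite exprn_ge0.
  by rewrite -exprMn exprn_ile1.
have big n : (maxn (maxn n1 n2) n3 <= n)%N -> nm (c n.+1) <= 6 * (5 / r) ^+ n.+1.
  rewrite !geq_max => /andP[/andP[n1n n2n] n3n].
  have r64 := hn3 n n3n.
  have rn : r ^+ n.+1 <= 1 / 12.
    apply: (@le_trans _ _ ((5 * r) ^+ n.+1)); last by lra.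
    have h1 : r <= 5 * r by lra.
    by rewrite ler_pXn2r ?nnegrE ?mulr_ge0 ?(ltW r0).
  move: (hn1 _ n1n) (hn2 _ n2n); rewrite q1 q2 exprMn -rmorphXn /=.
  set s := (_ +i* _) ^+ n.+1; set rr := r ^+ n.+1.
  have rr0 : 0 < rr by rewrite exprn_gt0.
  have s1 : nm s = 1.
    rewrite nmX /= (_ : (3 / 5) ^+ 2 + (4 / 5) ^+ 2 = 1 :> R) ?sqrtr1 ?expr1n//; by field.
  have sIm := rotation_Im n; rewrite -/s in sIm.
  have L t : nm t = 1 -> nm (LogRH (1 - rr%:C * t) + rr%:C * t) <= 288 * rr ^+ 2.
    move=> t1; have e1 : 1 - rr%:C * t - 1 = - (rr%:C * t) by ring.
    have := @LogRH_sub_le R (1 - rr%:C * t); rewrite e1 nmN opprK nmM nm_real t1 mulr1 (gtr0_norm rr0).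
    by apply.
  set A := c n.+1 * rr%:C.
  have key t : nm t = 1 -> `|complex.Re (c n.+1 * LogRH (1 - rr%:C * t))| <= 1 ->
      `|complex.Re (A * t)| <= 1 + 288 * rr * nm A.
    move=> t1 hRe; have -> : A * t = c n.+1 * (LogRH (1 - rr%:C * t) + rr%:C * t) - c n.+1 * LogRH (1 - rr%:C * t).
      by rewrite /A; ring.
    rewrite ReD ReN; apply: le_trans (ler_normB _ _) _; rewrite addrC lerD//.
    apply: le_trans (nm_Re _) _; rewrite nmM /A nmM nm_real (gtr0_norm rr0).
    rewrite (_ : 288 * rr * (nm (c n.+1) * rr) = nm (c n.+1) * (288 * rr ^+ 2)); last by ring.
    by rewrite ler_wpM2l ?nm_ge0// L.
  move=> A1 A2; have B2 := key _ s1 A2.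
  have B1 : `|complex.Re A| <= 1 + 288 * rr * nm A.
    by have := key 1; rewrite !mulr1; apply => //; exact: nm1.
  clear A1 A2.
  have a0 := nm_ge0 A; have Ale := nm_ReIm A.
  set t := 288 * rr * nm A in B1 B2.
  have sRe : `|complex.Re s| <= 1 by rewrite -s1; exact: nm_Re.
  have B3 : `|complex.Im A| * `|complex.Im s| <= 2 + 2 * t.
    rewrite -normrM; have -> : complex.Im A * complex.Im s = complex.Re A * complex.Re s - complex.Re (A * s).
      by rewrite ReM; ring.
    apply: le_trans (ler_normB _ _) _; rewrite normrM.
    apply: le_trans (lerD (ler_pM (normr_ge0 _) (normr_ge0 _) B1 sRe) B2) _.
    by clear B2; lra.
  clear hn1 hn2 L key B2 hY hY1 q1 q2.
  move: (complex.Re A) (complex.Im A) B1 B3 Ale => reA imA B1 B3 Ale.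
  move: (complex.Im s) sIm B3 => ims sIm B3.
  have f51 : 1 <= 5 ^+ n.+1 :> R by rewrite exprn_ege1// ler1n.
  have r64' : 5 ^+ n.+1 * rr * 1728 <= 1 by rewrite -exprMn.
  have B7 := growth_arith a0 Ale (normr_ge0 _) B1 B3 f51 sIm r64'.
  rewrite exprMn exprVn mulrA ler_pdivlMr//.
  by move: B7; rewrite /A nmM nm_real (gtr0_norm rr0).
have r5 : 0 < 5 / r by rewrite divr_gt0.
exact: (@exponential_bound (fun n => nm (c n.+1)) (5 / r) _ (fun n => nm_ge0 _) r5 big).
Qed.

End QGrowth.

(** * Orders of vanishing in q at infinity *)

Section QOrder.
Variable R : realType.
Notation C := (R[i]).
Implicit Types (z w : C) (x y A : R) (g : C -> C).

(** The relation g = O(q^m) at i oo; [Y >= 0] keeps all points concerned in the upper half plane. *)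
Definition qO (m : nat) g := exists A Y : R, 0 <= Y /\
  forall z, Y < complex.Im z -> nm (g z) <= A * nm (qz z) ^+ m.

Lemma qO_ge0 m g : qO m g -> exists A Y : R, [/\ 0 <= A, 0 <= Y &
  forall z, Y < complex.Im z -> nm (g z) <= A * nm (qz z) ^+ m].
Proof.
move=> [A [Y [Y0 h]]]; exists `|A|, Y; split=> // z hz; apply: le_trans (h z hz) _.
by rewrite ler_wpM2r ?exprn_ge0 ?nm_ge0// ler_norm.
Qed.

Lemma qO_eq m g g' : g =1 g' -> qO m g -> qO m g'.
Proof. by move=> E [A [Y [Y0 h]]]; exists A, Y; split=> // z hz; rewrite -E h. Qed.

Lemma qOD m g g' : qO m g -> qO m g' -> qO m (fun z => g z + g' z).
Proof.
move=> [A [Y [Y0 h]]] [A' [Y' [Y'0 h']]]; exists (A + A'), (Num.max Y Y').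
split=> [|z]; first by rewrite le_max Y0.
rewrite gt_max => /andP[/h a /h' b]; apply: le_trans (nmD _ _) _.
by rewrite mulrDl lerD.
Qed.

Lemma qOZ m (k : C) g : qO m g -> qO m (fun z => k * g z).
Proof.
move=> [A [Y [Y0 h]]]; exists (nm k * A), Y; split=> // z /h a.
by rewrite nmM -mulrA ler_wpM2l ?nm_ge0.
Qed.

Lemma qON m g : qO m g -> qO m (fun z => - g z).
Proof. by move=> /(qOZ (-1)); apply: qO_eq => z; rewrite mulN1r. Qed.

Lemma qOB m g g' : qO m g -> qO m g' -> qO m (fun z => g z - g' z).
Proof. by move=> h /qON; exact: qOD. Qed.

Lemma qO_sum m (I : eqType) (r : seq I) (gs : I -> C -> C) :
  (forall i, i \in r -> qO m (gs i)) -> qO m (fun z => \sum_(i <- r) gs i z).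
Proof.
elim: r => [|i r IH] h.
  exists 0, 0; split=> // z _; rewrite big_nil nm0 mul0r//.
have /qOD := h i (mem_head _ _) => /(_ _ (IH _)) H.
apply: qO_eq (H _) => [z|j jr]; first by rewrite big_cons.
by apply: h; rewrite inE jr orbT.
Qed.

Lemma qO_leq m m' g : (m' <= m)%N -> qO m g -> qO m' g.
Proof.
move=> mm /qO_ge0[A [Y [A0 Y0 h]]]; exists A, Y; split=> // z hz.
apply: le_trans (h z hz) _; rewrite ler_wpM2l//.
rewrite ler_wiXn2l ?nm_ge0// nm_qz -expR0 ler_expR.
have := pi_gt0 R; have : 0 < complex.Im z by lra.
by move=> a b; rewrite oppr_le0 !mulr_ge0// ltW.
Qed.

Lemma qO_mul (p m : nat) g : (0 < p)%N -> qO m g -> qO (p * m) (fun z => g (p%:R * z)).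
Proof.
move=> p0 [A [Y [Y0 h]]]; exists A, Y; split=> // z hz.
have := h (p%:R * z); rewrite qz_nat_mul nmX -exprM; apply.
rewrite ImM ReNat ImNat mul0r addr0.
have : 1 <= p%:R :> R by rewrite ler1n.
by nra.
Qed.

Lemma qO_shift m x g : qO m g -> qO m (fun z => g (z + x%:C)).
Proof.
move=> [A [Y [Y0 h]]]; exists A, Y; split=> // z hz.
by have := h (z + x%:C); rewrite nm_qz_real ImD /= addr0; apply.
Qed.

Lemma qO_coef (m : nat) (k : C) : qO m.+1 (fun z => k * qz z ^+ m) -> k = 0.
Proof.
move=> /qO_ge0[A [Y [A0 Y0 h]]]; apply/eqP; rewrite -nm_eq0 eq_le nm_ge0 andbT.
apply/ler_addgt0Pr => e e0; rewrite add0r.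
have [|Y1 Y10 h1] := @qz_small R (e / (A + 1)); first by rewrite divr_gt0//; lra.
pose z : C := 0 +i* (Num.max Y Y1 + 1).
have m1 : Y <= Num.max Y Y1 by rewrite le_max lexx.
have m2 : Y1 <= Num.max Y Y1 by rewrite le_max lexx orbT.
have zY : Y < complex.Im z by rewrite /=; lra.
have zY1 : Y1 < complex.Im z by rewrite /=; lra.
have a := h1 z zY1; have := h z zY.
have q0 : 0 < nm (qz z) by rewrite nm_gt0 qz_neq0.
rewrite nmM nmX exprS mulrA ler_pM2r ?exprn_gt0// => b; apply: (le_trans b).
move: a; rewrite ltr_pdivlMr; last lra.
by nra.
Qed.

Lemma qO_log (n : nat) : (0 < n)%N -> qO (2 * n) (fun z => LogRH (1 - qz z ^+ n) + qz z ^+ n).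
Proof.
move=> n0; have [Y Y0 hY] := @qz_small R (1 / 12) ltac:(lra).
exists 288, Y; split=> // z /hY hq; have q0 := nm_ge0 (qz z).
have qn : nm (qz z ^+ n) <= 1 / 12.
  rewrite nmX -(prednK n0) exprS; apply: le_trans (ltW hq).
  by rewrite ler_piMr// exprn_ile1//; lra.
have e1 : 1 - qz z ^+ n - 1 = - (qz z ^+ n) by ring.
have := @LogRH_sub_le R (1 - qz z ^+ n); rewrite e1 nmN opprK => /(_ qn).
by rewrite nmX mulnC exprM.
Qed.

Lemma qO_pow (n : nat) : qO n (fun z => qz z ^+ n).
Proof. by exists 1, 0; split=> // z _; rewrite mul1r nmX. Qed.

Lemma qO_log1 (n : nat) : (0 < n)%N -> qO n (fun z => LogRH (1 - qz z ^+ n)).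
Proof.
move=> n0; apply: qO_eq (qOB (qO_leq _ (qO_log n0)) (qO_pow n)) => [z|].
  by rewrite addrK.
by rewrite leq_pmull.
Qed.

Lemma qO_lt1 m g : qO m.+1 g -> forall e : R, 0 < e -> exists2 Y : R, 0 <= Y &
  forall z, Y < complex.Im z -> nm (g z) < e.
Proof.
move=> /(qO_leq (isT : (1 <= m.+1)%N))/qO_ge0[A [Y [A0 Y0 h]]] e e0.
have [|Y1 Y10 h1] := @qz_small R (e / (A + 1)); first by rewrite divr_gt0//; lra.
exists (Num.max Y Y1) => [|z]; first by rewrite le_max Y0.
rewrite gt_max => /andP[/h a /h1]; rewrite expr1 in a; rewrite ltr_pdivlMr; last lra.
have := nm_ge0 (qz z); nra.
Qed.

(** The logarithm of the factorization of 1 - x^p over the p-th roots of unity. For |x| < 1 / (12 p)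
    the p logarithms add up to at most 1 / 2, so no multiple of 2 pi i appears. *)
Lemma LogRH_root_product (p : nat) (zeta : C) : (0 < p)%N -> p.-primitive_root zeta ->
  exists2 e : R, 0 < e & forall x : C, nm x < e ->
  \sum_(j < p) LogRH (1 - zeta ^+ j * x) = LogRH (1 - x ^+ p).
Proof.
move=> p0 prz.
have z1 : nm zeta = 1.
  have := prim_expr_order prz => /(congr1 (@ComplexField.Normc.normc R)).
  rewrite nmX nm1 => /eqP; rewrite pexprn_eq1 ?nm_ge0// => /orP[|/eqP//].
  by rewrite eqn0Ngt p0.
have pR : 1 <= p%:R :> R by rewrite ler1n.
exists (12 * p%:R)^-1; first by rewrite invr_gt0; lra.
move=> x hx.
have x12 : nm x * (12 * p%:R) < 1 by rewrite -ltr_pdivlMr ?div1r//; lra.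
have xs : nm x < 1 / 12 by have := nm_ge0 x; nra.
have xp : nm (x ^+ p) <= nm x.
  by rewrite nmX -(prednK p0) exprS ler_piMr ?nm_ge0// exprn_ile1 ?nm_ge0//; lra.
have bnd t : nm t <= nm x -> 0 < complex.Re (1 - t) /\ nm (LogRH (1 - t)) <= 6 * nm x.
  move=> ht; have e1 : 1 - t - 1 = - t by ring.
  split; first by apply: Re_near1; rewrite e1 nmN; lra.
  have := @LogRH_nm_le R (1 - t); rewrite e1 nmN => h; apply: le_trans (h _) _; lra.
have bj (j : nat) : nm (zeta ^+ j * x) <= nm x by rewrite nmM nmX z1 expr1n mul1r.
apply: cexp_inj.
  rewrite cexp_sum cexp_LogRH; last by have [] := bnd _ xp.
  rewrite (eq_bigr (fun j : 'I_p => 1 - zeta ^+ j * x)); last first.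
    by move=> j _; rewrite cexp_LogRH//; have [] := bnd _ (bj j).
  have [->|xn0] := eqVneq x 0.
    by rewrite expr0n eqn0Ngt p0 /= subr0 big1// => j _; rewrite mulr0 subr0.
  have := factor_Xn_sub_1 prz => /(congr1 (fun q => q.[x^-1])).
  rewrite hornerD hornerN hornerXn hornerC horner_prod big_mkord => E.
  transitivity (x ^+ p * (x^-1 ^+ p - 1)).
    have {1}-> : x ^+ p = \prod_(j < p) x by rewrite prodr_const card_ord.
    rewrite -E -big_split; apply: eq_bigr => j _ /=.
    by rewrite hornerXsubC mulrBr mulfV// mulrC.
  by rewrite mulrBr -exprMn mulfV// expr1n mulr1.
rewrite -ImN -ImD; apply: le_lt_trans (nm_Im _) _.
apply: le_lt_trans (nmD _ _) _; rewrite nmN.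
have h1 : nm (\sum_(j < p) LogRH (1 - zeta ^+ j * x)) <= p%:R * (6 * nm x).
  apply: le_trans (nm_sum _ _ _) _.
  apply: (@le_trans _ _ (\sum_(j < p) 6 * nm x)); last by rewrite sumr_const card_ord -[leLHS]mulr_natl.
  by apply: ler_sum => j _; have [] := bnd _ (bj j).
have [_ h2] := bnd _ xp; have := pi_ge2 R; nra.
Qed.

End QOrder.

(** * The q-expansion of the logarithm F *)

Section QEigenvalue.
Variable R : realType.
Notation C := (R[i]).
Implicit Types (z w : C) (x y A : R) (g : C -> C).

Lemma qO_near m g g' (Y : R) : (forall z, Y < complex.Im z -> g z = g' z) -> qO m g -> qO m g'.
Proof.
move=> E [A [Y1 [Y10 h]]]; exists A, (Num.max Y Y1); split; first by rewrite le_max Y10 orbT.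
by move=> z; rewrite gt_max => /andP[/E <- /h].
Qed.

Lemma qz_root_primitive (p n : nat) : prime p -> (0 < n)%N -> (n < p)%N ->
  p.-primitive_root (qz ((n%:R / p%:R : R)%:C : C)).
Proof.
move=> pp n0 np; set zt := qz _.
have p0 := prime_gt0 pp; have pR : 0 < p%:R :> R by rewrite ltr0n.
have nR : 0 < n%:R :> R by rewrite ltr0n.
have npR : n%:R < p%:R :> R by rewrite ltr_nat.
have qz1 : qz (1 : C) = 1.
  by rewrite -[1 in LHS](rmorph1 (real_complex R)) qz_real mulr1 mulr_natl cos2pi sin2pi.
have ztp : zt ^+ p = 1.
  rewrite /zt -qz_nat_mul -(rmorph_nat (real_complex R)) -rmorphM /= mulrC divfK ?gt_eqF//.
  by rewrite rmorph_nat -[n%:R]mulr1 qz_nat_mul qz1 expr1n.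
have zt1 : zt != 1.
  apply/eqP => h; have : (2 * pi)%:C * 'i * (n%:R / p%:R)%:C = 0 :> C.
    apply: cexp_eq1 => //; rewrite !ReImE /= !(mul0r, mulr0, mulr1, add0r, addr0, subr0).
    have pi0 := pi_gt0 R; rewrite ger0_norm; last by rewrite mulr_ge0 ?divr_ge0// mulr_ge0// ltW.
    by rewrite gtr_pMr ?mulr_gt0// ltr_pdivrMr// mul1r.
  move/eqP; rewrite !mulf_eq0 -!nm_eq0 nm_i !nm_real !normr_eq0 oner_eq0 !mulf_eq0 invr_eq0.
  by rewrite !gt_eqF ?pi_gt0.
have [m prm mp] := prim_order_exists p0 ztp.
have /primeP[_ /(_ _ mp)] := pp => /orP[/eqP m1|/eqP<-//].
by have := prim_expr_order prm; rewrite m1 expr1 => h; rewrite h eqxx in zt1.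
Qed.

Variables (f : C -> C) (C0 : C) (h : int) (c : nat -> C).
Hypothesis f0 : forall z, inH z -> f z != 0.
Hypothesis fq : q_exponents f C0 h c.
Variables (F : C -> C) (L : C).
Hypothesis L0 : L != 0.
Hypothesis hFL : exists2 Y : R, 0 <= Y & forall z, Y < complex.Im z -> cexp (F z) = f z / L.
Hypothesis hF0 : forall e : R, 0 < e -> exists2 Y : R, 0 <= Y & forall z, Y < complex.Im z -> nm (F z) < e.

Let E m z := Epart c m z.

Lemma Epart_tail : exists A Y : R, [/\ 0 <= A, 0 <= Y & forall z, Y < complex.Im z ->
  forall m M, (m <= M)%N -> nm (E M z - E m z) <= A * (A * nm (qz z)) ^+ m.+1].
Proof.
have [K K1 hK] := exponent_growth f0 fq.
have [|Y Y0 hY] := @qz_small R (1 / (12 * K)); first by rewrite divr_gt0//; lra.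
exists (12 * K), Y; split=> // [|z /hY hq m M]; first lra.
have q0 := nm_ge0 (qz z); set q := nm (qz z) in hq q0 *.
have qK : K * q < 1 / 12.
  by move: hq; rewrite ltr_pdivlMr; lra.
have q12 : q <= 1 / 12 by nra.
have term n : nm (c n.+1 * LogRH (1 - qz z ^+ n.+1)) <= 6 * K * (K * q) ^+ n.+1.
  have e1 : 1 - qz z ^+ n.+1 - 1 = - (qz z ^+ n.+1) by ring.
  have qn : q ^+ n.+1 <= 1 / 2.
    apply: (@le_trans _ _ q); last lra.
    by rewrite exprS ler_piMr// exprn_ile1//; lra.
  have := @LogRH_nm_le R (1 - qz z ^+ n.+1); rewrite e1 nmN nmX -/q => /(_ qn) hl.
  rewrite nmM; apply: le_trans (ler_pM (nm_ge0 _) (nm_ge0 _) (hK n) hl) _.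
  by rewrite exprMn (exprS K) le_eqVlt; apply/orP; left; apply/eqP; ring.
move=> /subnK <-; move: (M - m)%N => j.
set x := K * q in qK term; have x0 : 0 <= x by rewrite mulr_ge0//; lra.
(* The bound telescopes: passing from [j] to [j.+1] frees 12 K (1 - x) x^(j+m+1), more than the new
   term 6 K x^(j+m+1), because x < 1 / 12. *)
have H : nm (E (j + m)%N z - E m z) <= 12 * K * (x ^+ m.+1 - x ^+ (j + m).+1).
  elim: j => [|j IH]; first by rewrite add0n !subrr nm0 mulr0.
  rewrite addSn {1}/E /Epart big_ord_recr /= -/(Epart c (j + m) z) -/(E (j + m) z) addrAC.
  apply: le_trans (nmD _ _) _; apply: le_trans (lerD IH (term _)) _.
  rewrite (exprS x (j + m).+1); have xn : 0 <= x ^+ (j + m).+1 by rewrite exprn_ge0.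
  have : 0 <= K * x ^+ (j + m).+1 by rewrite mulr_ge0//; lra.
  move: (x ^+ (j + m).+1) xn => t t0 Kt.
  have : x * (K * t) <= 1 / 12 * (K * t) by rewrite ler_wpM2r// ltW.
  by lra.
apply: (le_trans H); have xj : 0 <= x ^+ (j + m).+1 by rewrite exprn_ge0.
rewrite ler_wpM2l//; first lra.
apply: (@le_trans _ _ (x ^+ m.+1)); first lra.
have -> : 12 * K * q = 12 * x by rewrite /x mulrA.
by rewrite [leRHS]exprMn ler_peMl ?exprn_ge0// exprn_ege1//; lra.
Qed.

(** The tail bound is uniform in [M] and so survives the limit of the partial products. Convergence
    at each single point suffices, as the constants do not depend on that point. *)
Lemma f_Epart_ratio m : exists A Y : R, [/\ 0 <= A, 0 <= Y & forall z, Y < complex.Im z ->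
  nm (f z / (C0 * qz z ^ h * cexp (E m z)) - 1) <= A * nm (qz z) ^+ m.+1].
Proof.
have [A [Y [A0 Y0 hA]]] := Epart_tail; have [Y1 Y10 hY1] := f_product fq.
have [|Y2 Y20 hY2] := @qz_small R (1 / (2 * (A + 1) ^+ 2)); first by rewrite divr_gt0// mulr_gt0// exprn_gt0//; lra.
exists (5 * A * A ^+ m.+1), (Num.max Y (Num.max Y1 Y2)); split=> [||z].
- by rewrite !mulr_ge0// exprn_ge0.
- by rewrite le_max Y0.
rewrite !gt_max => /and3P[/hA {}hA /hY1 {}hY1 /hY2 hq].
have C00 : C0 != 0 by case: fq.
set D := C0 * qz z ^ h; have D0 : D != 0 by rewrite mulf_neq0//; exact/expfz_neq0/qz_neq0.
set Em := E m z; set B := D * cexp Em.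
have B0 : B != 0 by rewrite mulf_neq0// cexp_neq0.
apply/ler_addgt0Pr => e e0.
have [|n0 hn0] := hY1 (e * nm B); first by rewrite mulr_gt0// nm_gt0.
pose M := maxn n0 m; have {hn0}hn : nm (D * cexp (E M z) - f z) < e * nm B := hn0 M (leq_maxl _ _).
have hM := hA m M (leq_maxr _ _).
have q0 := nm_ge0 (qz z).
have small : nm (E M z - Em) <= 1 / 2.
  apply: (le_trans hM); rewrite exprS.
  have sq : 0 < 2 * (A + 1) ^+ 2 by rewrite mulr_gt0// exprn_gt0//; lra.
  rewrite ltr_pdivlMr// in hq.
  have Aq : A * nm (qz z) <= 1 by nra.
  apply: (@le_trans _ _ (A * (A * nm (qz z)))).
    by rewrite ler_wpM2l// ler_piMr ?mulr_ge0// exprn_ile1// mulr_ge0.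
  by nra.
have E1 : f z / B - 1 = (cexp (E M z - Em) - 1) - (D * cexp (E M z) - f z) / B.
  by rewrite cexpB /B; field; rewrite D0 cexp_neq0.
rewrite E1; apply: le_trans (nmD _ _) _; apply: lerD; last first.
  by rewrite nmN nmM nmV ler_pdivrMr ?nm_gt0// ltW.
have := cexp_sub1_sub_le small; set t := E M z - Em in small hM * => ht.
have -> : cexp t - 1 = (cexp t - 1 - t) + t by ring.
apply: le_trans (nmD _ _) _.
have t0 := nm_ge0 t.
have t2 := ler_wpM2r t0 small; rewrite -expr2 in t2.
apply: (@le_trans _ _ (5 * nm t)); first by lra.
by rewrite -!mulrA ler_wpM2l// -exprMn.
Qed.

Lemma q_leading : h = 0 /\ C0 = L.
Proof.
have C00 : C0 != 0 by case: fq.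
have hfL (e : R) : 0 < e -> exists2 Y : R, 0 <= Y & forall z, Y < complex.Im z -> nm (f z / L - 1) < e.
  move=> e0; pose e' := Num.min (1 / 2) (e / 5).
  have e'0 : 0 < e' by rewrite lt_min; apply/andP; split; lra.
  have [Y Y0 hY] := hF0 e'0; have [Y1 Y10 hY1] := hFL.
  exists (Num.max Y Y1) => [|z]; first by rewrite le_max Y0.
  rewrite gt_max => /andP[/hY + /hY1 <-]; rewrite lt_min => /andP[h1 h2].
  have := cexp_sub1_sub_le (ltW h1); set t := F z in h1 h2 * => ht.
  rewrite (_ : cexp t - 1 = (cexp t - 1 - t) + t); last by ring.
  have t2 := ler_wpM2r (nm_ge0 t) (ltW h1); rewrite -expr2 in t2.
  by apply: le_lt_trans (nmD _ _) _; lra.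
have hfC (e : R) : 0 < e -> exists2 Y : R, 0 <= Y & forall z, Y < complex.Im z -> nm (f z / (C0 * qz z ^ h) - 1) < e.
  move=> e0; have [A [Y [A0 Y0 hY]]] := f_Epart_ratio 0.
  have [|Y1 Y10 hY1] := @qz_small R (e / (A + 1)); first by rewrite divr_gt0//; lra.
  exists (Num.max Y Y1) => [|z]; first by rewrite le_max Y0.
  rewrite gt_max => /andP[/hY + /hY1]; rewrite /E /Epart big_ord0 cexp0 mulr1 expr1.
  move=> a; rewrite ltr_pdivlMr; last lra.
  by move=> b; apply: (le_lt_trans a); have := nm_ge0 (qz z); nra.
(* f / L and f / (C0 q^h) both tend to 1. *)
have quot (e : R) : 0 < e -> e <= 1 -> exists2 Y : R, 0 <= Y & forall z, Y < complex.Im z ->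
    nm (C0 * qz z ^ h / L - 1) < e.
  move=> e0 e1; have e40 : 0 < e / 4 by lra.
  have [Y Y0 hY] := hfL _ e40; have [Y1 Y10 hY1] := hfC _ e40.
  exists (Num.max Y Y1) => [|z]; first by rewrite le_max Y0.
  rewrite gt_max => /andP[/[dup] zY /hY a /hY1 b].
  have fz : f z != 0 by apply: f0; rewrite /inH /imC; lra.
  have D0 : C0 * qz z ^ h != 0 by rewrite mulf_neq0//; exact/expfz_neq0/qz_neq0.
  rewrite (_ : C0 * qz z ^ h / L = (f z / L) / (f z / (C0 * qz z ^ h))); last first.
    by move: (C0 * _) D0 => D D0; field; rewrite fz L0 D0.
  apply: (@ratio_near R 1) => //; rewrite ?oner_neq0 ?nm1 ?mul1r//.
have h0 : h = 0.
  have [Y Y0 hY] := quot (1 / 2) ltac:(lra) ltac:(lra).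
  have LC : 0 < nm L / nm C0 by rewrite divr_gt0 ?nm_gt0.
  have LC2 : 0 < nm C0 / nm L by rewrite divr_gt0 ?nm_gt0.
  have [|Y1 Y10 hY1] := @qz_small R (Num.min 1 (Num.min (nm L / nm C0 / 4) (nm C0 / nm L / 4))).
    by rewrite !lt_min ltr01 !divr_gt0 ?nm_gt0.
  pose z : C := 0 +i* (Num.max Y Y1 + 1).
  have m1 : Y <= Num.max Y Y1 by rewrite le_max lexx.
  have m2 : Y1 <= Num.max Y Y1 by rewrite le_max lexx orbT.
  have zY : Y < complex.Im z by rewrite /=; lra.
  have zY1 : Y1 < complex.Im z by rewrite /=; lra.
  have := hY _ zY; have := hY1 _ zY1; rewrite !lt_min => /and3P[q1 q2 q3] a.
  have q0 : 0 < nm (qz z) by rewrite nm_gt0 qz_neq0.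
  have qn n : nm (qz z) ^+ n.+1 <= nm (qz z).
    by rewrite exprS ler_piMr ?(ltW q0)// exprn_ile1// ltW.
  have b1 := nm_sub (C0 * qz z ^ h / L) 1; have b2 := nm_sub 1 (C0 * qz z ^ h / L).
  rewrite (nmB 1) nm1 in b2; rewrite nm1 in b1.
  move: b1 b2 a; rewrite !nmM nmV; set u := nm (C0 * qz z ^ h / L - 1).
  have L1 : 0 < nm L by rewrite nm_gt0. have C1 : 0 < nm C0 by rewrite nm_gt0.
  have r1 : nm C0 / nm L * (nm L / nm C0) = 1 by field; rewrite !gt_eqF.
  case: (h) => [[|n]|n] //= b1 b2 a; exfalso.
  - have {b1 b2} : 1 / 2 < nm C0 / nm L * nm (qz z) ^+ n.+1.
      by rewrite mulrAC -nmX; change (nm (qz z ^ n.+1)) with (nm (qz z ^+ n.+1)) in b2; lra.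
    apply/negP; rewrite -leNgt; apply: le_trans (ler_wpM2l (ltW LC2) (qn n)) _.
    by apply: le_trans (ler_wpM2l (ltW LC2) (ltW q2)) _; rewrite mulrA r1; lra.
  - have {b1 b2} : nm C0 / nm L * (nm (qz z) ^+ n.+1)^-1 < 3 / 2.
      by rewrite mulrAC -nmX -nmV; change (nm (qz z ^ Negz n)) with (nm (qz z ^+ n.+1)^-1) in b1; lra.
    rewrite ltr_pdivrMr ?exprn_gt0//; apply/negP; rewrite -leNgt.
    apply: le_trans (ler_wpM2l _ (qn n)) _ => //.
    apply: le_trans (ler_wpM2l _ (ltW q3)) _ => //.
    by rewrite mulrCA; have := LC2; lra.
split=> //; apply/eqP; rewrite -subr_eq0 -nm_eq0 eq_le nm_ge0 andbT.
apply/ler_addgt0Pr => e e0; rewrite add0r.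
pose e' := Num.min 1 (e / nm L).
have e'0 : 0 < e' by rewrite lt_min ltr01 divr_gt0 ?nm_gt0.
have [|Y Y0 hY] := quot e' e'0; first by rewrite ge_min lexx.
have := hY (0 +i* (Y + 1)); rewrite /= ltrDl ltr01 => /(_ isT).
rewrite h0 expr0z mulr1 lt_min => /andP[_].
rewrite ltr_pdivlMr ?nm_gt0// -nmM mulrBl divfK// mul1r; exact: ltW.
Qed.

(** F and [E m] both tend to 0, so the imaginary part of their difference is below pi, and this
    difference is exactly [LogRH] of the quotient estimated before. *)
Lemma F_Epart m : qO m.+1 (fun z => F z - E m z).
Proof.
have [h0 CL] := q_leading.
have [A [Y [A0 Y0 hY]]] := f_Epart_ratio m.
have Em1 : qO 1 (E m).
  apply: qO_eq (@qO_sum R 1 _ (index_enum 'I_m) (fun n z => c n.+1 * LogRH (1 - qz z ^+ n.+1)) _) => // n _.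
  by apply: qOZ; apply: qO_leq (qO_log1 _ _).
have one : 0 < (1 : R) by [].
have [Y1 Y10 hY1] := qO_lt1 Em1 one; have [Y2 Y20 hY2] := hF0 one.
have [Y3 Y30 hY3] := hFL.
have [|Y4 Y40 hY4] := @qz_small R (1 / (2 * (A + 1))); first by rewrite divr_gt0//; lra.
exists (6 * A), (Num.max (Num.max Y Y1) (Num.max (Num.max Y2 Y3) Y4)); split.
  by rewrite !le_max Y0.
move=> z; rewrite !gt_max => /andP[/andP[/hY a /hY1 b] /andP[/andP[/hY2 d /hY3 e] /hY4 q]].
have q0 := nm_ge0 (qz z).
have Aq : A * nm (qz z) ^+ m.+1 <= 1 / 2.
  move: q; rewrite ltr_pdivlMr; last lra. move=> q.
  have q1 : nm (qz z) <= 1 by nra.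
  have : nm (qz z) ^+ m.+1 <= nm (qz z) by rewrite exprS ler_piMr// exprn_ile1.
  by nra.
have C00 : C0 != 0 by case: fq.
have rE : f z / (C0 * qz z ^ h * cexp (E m z)) = cexp (F z - E m z).
  by rewrite cexpB e h0 expr0z mulr1 CL invfM mulrA.
rewrite rE in a.
have re : 0 < complex.Re (cexp (F z - E m z)) by apply: Re_near1; lra.
have im : `|complex.Im (F z - E m z)| <= pi.
  apply: le_trans (nm_Im _) _; apply: le_trans (nmD _ _) _; rewrite nmN.
  by have := pi_ge2 R; lra.
rewrite -(LogRHK re im); apply: le_trans (LogRH_nm_le _) _; first lra.
by rewrite -mulrA ler_wpM2l.
Qed.

End QEigenvalue.

(** * Comparison of coefficients in the Hecke relation *)

Section QHecke.
Variable R : realType.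
Notation C := (R[i]).
Lemma qz_real_pow (x : R) (j : nat) : qz (x%:C : C) ^+ j = qz ((j%:R * x)%:C).
Proof. by rewrite -qz_nat_mul rmorphM /= rmorph_nat. Qed.

Lemma qz_nat (j : nat) : qz (j%:R%:C : C) = 1.
Proof.
have q1 : qz ((1 : R)%:C : C) = 1 by rewrite qz_real mulr1 mulr_natl cos2pi sin2pi.
by rewrite -[j%:R]mulr1 -qz_real_pow q1 expr1n.
Qed.

Variables (f : C -> C) (C0 : C) (h : int) (c : nat -> C).
Hypothesis f0 : forall z, inH z -> f z != 0.
Hypothesis fq : q_exponents f C0 h c.
Variables (F : C -> C) (L : C).
Hypothesis L0 : L != 0.
Hypothesis hFL : exists2 Y : R, 0 <= Y & forall z, Y < complex.Im z -> cexp (F z) = f z / L.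
Hypothesis hF0 : forall e : R, 0 < e -> exists2 Y : R, 0 <= Y & forall z, Y < complex.Im z -> nm (F z) < e.

Let FE := F_Epart f0 fq L0 hFL hF0.

(** Translation by j / p multiplies q^n by the j-th power of a p-th root of unity. For n < p it is
    primitive and the sum collapses by [LogRH_root_product]; for n = p it is 1 and p equal terms
    remain. *)
Lemma Epart_translates (p : nat) : prime p -> exists Y : R, forall z, Y < complex.Im z ->
  \sum_(j < p) Epart c p (z + (j%:R / p%:R : R)%:C) =
  \sum_(n < p.-1) c n.+1 * LogRH (1 - qz z ^+ (n.+1 * p)) + p%:R * (c p * LogRH (1 - qz z ^+ p)).
Proof.
move=> pp; have p0 := prime_gt0 pp.
have pR : p%:R != 0 :> R by rewrite pnatr_eq0 -lt0n.
have pE : p = p.-1.+1 by rewrite prednK.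
have term n : (n < p.-1)%N -> exists Y : R, forall z, Y < complex.Im z ->
    \sum_(j < p) LogRH (1 - qz (z + (j%:R / p%:R : R)%:C) ^+ n.+1) = LogRH (1 - qz z ^+ (n.+1 * p)).
  move=> np; have np' : (n.+1 < p)%N by rewrite [X in (_ < X)%N]pE ltnS.
  have prz := @qz_root_primitive R p n.+1 pp isT np'.
  have [e e0 he] := LogRH_root_product p0 prz.
  have [Y Y0 hY] := qO_lt1 (qO_pow R n.+1) e0.
  exists Y => z /hY /he; rewrite -exprM => <-; apply: eq_bigr => j _.
  have -> : qz ((n.+1%:R / p%:R : R)%:C : C) ^+ j = qz ((j%:R / p%:R : R)%:C : C) ^+ n.+1.
    rewrite (qz_real_pow (n.+1%:R / p%:R) j) (qz_real_pow (j%:R / p%:R) n.+1).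
    by have -> : j%:R * (n.+1%:R / p%:R) = n.+1%:R * (j%:R / p%:R) :> R by ring.
  by rewrite qz_add exprMn (mulrC (qz z ^+ n.+1)).
have [Y hY] : exists Y : R, forall z, Y < complex.Im z -> forall n : 'I_p.-1,
    \sum_(j < p) LogRH (1 - qz (z + (j%:R / p%:R : R)%:C) ^+ n.+1) = LogRH (1 - qz z ^+ (n.+1 * p)).
  have T (n : 'I_p.-1) := cid (term n (ltn_ord n)).
  exists (\big[Num.max/0]_n sval (T n)) => z hz n; apply: (svalP (T n)).
  by apply: le_lt_trans hz; exact: le_bigmax.
exists Y => z /hY hz; rewrite /Epart exchange_big /=.
have qp (j : 'I_p) : qz (z + (j%:R / p%:R : R)%:C) ^+ p = qz z ^+ p.
  rewrite qz_add exprMn (qz_real_pow (j%:R / p%:R) p).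
  have -> : p%:R * (j%:R / p%:R) = j%:R :> R by field.
  by rewrite qz_nat mulr1.
have split (G : nat -> C) : \sum_(n < p) G n = \sum_(n < p.-1) G n + G p.-1.
  by case: p p0 {pp pR pE term Y hY hz qp} => // m _; rewrite big_ord_recr.
rewrite (split (fun n => \sum_(j < p) c n.+1 * LogRH (1 - qz (z + (j%:R / p%:R : R)%:C) ^+ n.+1))).
rewrite -pE; congr (_ + _).
  by apply: eq_bigr => n _; rewrite -mulr_sumr hz.
rewrite (eq_bigr (fun _ => c p * LogRH (1 - qz z ^+ p))); last by move=> j _; rewrite qp.
by rewrite sumr_const card_ord mulr_natl.
Qed.

(** The relation is read at p z, so that every term is a function of q, and compared modulo q^(p+1).
    The term F(p^2 z) is negligible, the translates contribute c(1) + p c(p), and lam F(p z)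
    contributes lam c(1), each times LogRH (1 - q^p). *)
Lemma hecke_eigenvalue_exponent (p : nat) (lam : C) : prime p ->
  (forall z, inH z -> TF F p z = lam * F z) ->
  c 1 + p%:R * c p = lam * c 1.
Proof.
move=> pp hT; have p0 := prime_gt0 pp; have p1 := prime_gt1 pp.
have pR : p%:R != 0 :> C by rewrite pnatr_eq0 -lt0n.
have E0 : qO 1 F.
  by apply: qO_eq (FE 0) => z; rewrite /Epart big_ord0 subr0.
have G1 : qO p.+1 (fun z => F (p%:R * (p%:R * z))).
  by apply: qO_leq (qO_mul p0 (qO_mul p0 E0)); rewrite muln1; nia.
have G2 : qO p.+1 (fun z => \sum_(j < p) (F (z + (j%:R / p%:R : R)%:C) - Epart c p (z + (j%:R / p%:R : R)%:C))).
  by apply: qO_sum => j _; apply: (qO_shift _ (FE p)).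
have G3 : qO p.+1 (fun z => F (p%:R * z) - Epart c 1 (p%:R * z)).
  by apply: qO_leq (qO_mul p0 (FE 1)); nia.
have G4 : qO p.+1 (fun z => \sum_(n < p.-1) (if (n == 0 :> nat)%N then 0 else c n.+1 * LogRH (1 - qz z ^+ (n.+1 * p)))).
  apply: qO_sum => n _; case: (nat_of_ord n) => [|m] /=.
    by exists 0, 0; split=> // z _; rewrite nm0 mul0r.
  by apply: qOZ; apply: qO_leq (qO_log1 _ _); nia.
set k := c 1 + p%:R * c p - lam * c 1.
suff : k = 0 by move=> /eqP; rewrite subr_eq0 => /eqP.
have [Y hY] := Epart_translates pp.
apply: (@qO_coef R p).
have G5 : qO p.+1 (fun z => k * (LogRH (1 - qz z ^+ p) + qz z ^+ p)).
  by apply: qOZ; apply: qO_leq (qO_log R p0); lia.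
have G6 := qOB G5 (qON (qOD (qOD G1 G2) (qOB G4 (qOZ lam G3)))).
apply: (qO_near (Y := Num.max 0 Y)) G6 => z; rewrite gt_max => /andP[hz /hY hE].
have hz' : inH (p%:R * z) by exact: inH_scale.
have := hT _ hz'; rewrite /TF.
have -> : \sum_(j < p) F ((p%:R * z + j%:R) / p%:R) = \sum_(j < p) F (z + (j%:R / p%:R : R)%:C).
  apply: eq_bigr => j _; congr F; rewrite mulrDl mulrAC divff// mul1r; congr (_ + _).
  by rewrite rmorphM fmorphV !rmorph_nat.
rewrite sumrB hE.
have -> : Epart c 1 (p%:R * z) = c 1 * LogRH (1 - qz z ^+ p).
  by rewrite /Epart big_ord1 expr1 qz_nat_mul.
have -> : \sum_(n < p.-1) c n.+1 * LogRH (1 - qz z ^+ (n.+1 * p)) =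
   c 1 * LogRH (1 - qz z ^+ p) + \sum_(n < p.-1) (if (n == 0 :> nat)%N then 0 else c n.+1 * LogRH (1 - qz z ^+ (n.+1 * p))).
  have : (0 < p.-1)%N by lia.
  by case: p.-1 => // m _; rewrite !big_ord_recl /= add0r mul1n.
move: (LogRH _) => l; move: (\sum_(n < p.-1) _) => s4 /eqP; rewrite -subr_eq0 => /eqP H.
rewrite /k; move: H; move: (F (p%:R * (p%:R * z))) (\sum_(j < p) _) (F (p%:R * z)) => a b d H.
have -> : a = lam * d - b by apply/eqP; rewrite eq_sym subr_eq -subr_eq0 -oppr_eq0 opprB H.
ring.
Qed.

End QHecke.

(** * Real antiderivatives on an interval *)

Section Antiderivative.
Variable R : realType.
Implicit Types (g G : R -> R) (a b p q x : R).

Lemma continuous_for_eps g x : (forall e : R, 0 < e -> exists2 d : R, 0 < d &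
  forall x', `|x' - x| < d -> `|g x' - g x| < e) -> {for x, continuous g}.
Proof.
move=> H; apply/cvgrPdist_lt => e e0; have [d d0 hd] := H e e0.
near=> y; rewrite distrC; apply: hd.
near: y; apply/nbhs_ballP; exists d => //= y; rewrite /ball /= distrC; exact.
Unshelve. all: by end_near. Qed.

Definition antiderivative g a b G := forall x, a < x < b -> is_derive x 1 G (g x).

Lemma antiderivative_exists g a b : a < b -> (forall x, a <= x <= b -> {for x, continuous g}) ->
  exists G, antiderivative g a b G.
Proof.
move=> ab cg; exists (fun x => (\int[lebesgue_measure]_(t in [set` `[a, x]]) g t)%R) => x /andP[ax xb].
have gi : (@lebesgue_measure R).-integrable `[a, b] (EFin \o g).
  apply: continuous_compact_integrable; first exact: segment_compact.
  apply: continuous_in_subspaceT => y; rewrite inE/= in_itv/= => yab.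
  exact: cg.
have cx : {for x, continuous g} by apply: cg; rewrite !ltW.
have [d1 d2] := @continuous_FTC1_closed R g a x b xb gi ax cx.
move: d1 d2; move: (fun x => (\int[lebesgue_measure]_(t in [set` `[a, x]]) g t)%R) => G0 d1 d2.
by apply: DeriveDef; [exact: d1|rewrite -derive1E; exact: d2].
Qed.

Lemma antiderivative_MVT g a b G p q : antiderivative g a b G -> a < p -> p < q -> q < b ->
  exists2 c, p < c < q & G q - G p = g c * (q - p).
Proof.
move=> hG ap pq qb.
have [] := @MVT R G g p q pq.
- move=> x; rewrite in_itv/= => /andP[px xq]; apply: hG.
  by rewrite (lt_trans ap px) (lt_trans xq qb).
- apply: derivable_within_continuous => x; rewrite in_itv/= => /andP[px xq].
  by have [] : is_derive x 1 G (g x) by apply: hG; rewrite (lt_le_trans ap px) (le_lt_trans xq qb).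
- by move=> c; rewrite in_itv/=; exists c.
Qed.

End Antiderivative.

(** * Goursat's theorem for rectangles *)

Section Goursat.
Variable R : realType.
Notation C := (R[i]).
Implicit Types (x y s : R).
Variables (G : C -> C) (xa xb ya yb : R).
Hypothesis xab : xa < xb.
Hypothesis yab : ya < yb.
Hypothesis hG : forall x y, xa <= x <= xb -> ya <= y <= yb -> exists l, cdiff G (x +i* y) l.

Lemma cdiff_cont_horizontal x y (l : C) : cdiff G (x +i* y) l ->
  {for x, continuous (fun x => complex.Im (G (x +i* y)))}.
Proof.
move=> /cdiff_cont hc; apply: continuous_for_eps => e /hc[d d0 hd]; exists d => // x' hx'.
have := hd (x' +i* y); rewrite (_ : _ - _ = (x' - x)%:C); last first.
  by apply: complexP; rewrite !ReImE /=; ring.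
by rewrite nm_real => /(_ hx') h; apply: le_lt_trans h; rewrite -ImN -ImD nm_Im.
Qed.

Lemma cdiff_cont_vertical x y (l : C) : cdiff G (x +i* y) l ->
  {for y, continuous (fun y => complex.Re (G (x +i* y)))}.
Proof.
move=> /cdiff_cont hc; apply: continuous_for_eps => e /hc[d d0 hd]; exists d => // y' hy'.
have := hd (x +i* y'); rewrite (_ : _ - _ = (y' - y)%:C * 'i); last first.
  by apply: complexP; rewrite !ReImE /=; ring.
by rewrite nmM nm_i mulr1 nm_real => /(_ hy') h; apply: le_lt_trans h; rewrite -ReN -ReD nm_Re.
Qed.

Variables (H V : R -> R -> R).
Hypothesis HH : forall y, ya <= y <= yb -> antiderivative (fun x => complex.Im (G (x +i* y))) xa xb (H y).
Hypothesis HV : forall x, xa <= x <= xb -> antiderivative (fun y => complex.Re (G (x +i* y))) ya yb (V x).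

(* Only the imaginary part of the contour integral is needed. *)
Definition contour x1 x2 y1 y2 : R :=
  (H y1 x2 - H y1 x1) - (H y2 x2 - H y2 x1) + (V x2 y2 - V x2 y1) - (V x1 y2 - V x1 y1).

(** The mean value theorem is applied to the difference of opposite sides, so both sides share one
    intermediate point. With l1 = Re l the linear parts then give l1 (y1 - y2) (x2 - x1) + l1 (x2 -
    x1) (y2 - y1) = 0, and only the remainder counts. *)
Lemma contour_near x0 y0 (l : C) e d x1 x2 y1 y2 :
  (forall w, nm (w - (x0 +i* y0)) < d -> nm (G w - G (x0 +i* y0) - l * (w - (x0 +i* y0))) <= e * nm (w - (x0 +i* y0))) ->
  0 <= e -> xa < x1 -> x1 < x2 -> x2 < xb -> ya < y1 -> y1 < y2 -> y2 < yb ->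
  x1 <= x0 <= x2 -> y1 <= y0 <= y2 -> (x2 - x1) + (y2 - y1) < d ->
  `|contour x1 x2 y1 y2| <= 2 * e * ((x2 - x1) + (y2 - y1)) ^+ 2.
Proof.
move=> hl e0 xa1 x12 x2b ya1 y12 y2b /andP[x10 x02] /andP[y10 y02] hd.
set D := _ + (y2 - y1) in hd *.
have D0 : 0 < D by rewrite /D; lra.
have near x y : x1 <= x <= x2 -> y1 <= y <= y2 ->
    nm (G (x +i* y) - G (x0 +i* y0) - l * ((x +i* y) - (x0 +i* y0))) <= e * D.
  move=> /andP[h1 h2] /andP[h3 h4].
  have hw : nm ((x +i* y) - (x0 +i* y0)) <= D.
    apply: le_trans (nm_ReIm _) _; rewrite !ReImE /= /D.
    have : `|x - x0| <= x2 - x1 by rewrite ler_norml; apply/andP; split; lra.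
    have : `|y - y0| <= y2 - y1 by rewrite ler_norml; apply/andP; split; lra.
    by lra.
  by apply: le_trans (hl _ (le_lt_trans hw hd)) _; rewrite ler_wpM2l.
have [xi /andP[xi1 xi2] EH] : exists2 xi, x1 < xi < x2 &
    (H y1 x2 - H y1 x1) - (H y2 x2 - H y2 x1) =
    (complex.Im (G (xi +i* y1)) - complex.Im (G (xi +i* y2))) * (x2 - x1).
  have A : antiderivative (fun x => complex.Im (G (x +i* y1)) - complex.Im (G (x +i* y2))) xa xb (H y1 \- H y2).
    move=> x hx; apply: is_deriveB; apply: HH => //; lra.
  by have [c hc E] := antiderivative_MVT A xa1 x12 x2b; exists c => //; rewrite -E /=; ring.
have [et /andP[et1 et2] EV] : exists2 et, y1 < et < y2 &
    (V x2 y2 - V x2 y1) - (V x1 y2 - V x1 y1) =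
    (complex.Re (G (x2 +i* et)) - complex.Re (G (x1 +i* et))) * (y2 - y1).
  have A : antiderivative (fun y => complex.Re (G (x2 +i* y)) - complex.Re (G (x1 +i* y))) ya yb (V x2 \- V x1).
    move=> y hy; apply: is_deriveB; apply: HV => //; lra.
  by have [c hc E] := antiderivative_MVT A ya1 y12 y2b; exists c => //; rewrite -E /=; ring.
rewrite /contour -addrA EH EV.
have i1 := near xi y1; have i2 := near xi y2; have i3 := near x2 et; have i4 := near x1 et.
have bx : x1 <= xi <= x2 by rewrite !ltW.
have by' : y1 <= et <= y2 by rewrite !ltW.
have bx1 : x1 <= x1 <= x2 by rewrite lexx ltW.
have bx2 : x1 <= x2 <= x2 by rewrite lexx ltW.
have by1 : y1 <= y1 <= y2 by rewrite lexx ltW.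
have by2 : y1 <= y2 <= y2 by rewrite lexx ltW.
have {}i1 := le_trans (nm_Im _) (i1 bx by1).
have {}i2 := le_trans (nm_Im _) (i2 bx by2).
have {}i3 := le_trans (nm_Re _) (i3 bx2 by').
have {}i4 := le_trans (nm_Re _) (i4 bx1 by').
clear near hl EH EV.
rewrite !(ImD, ImN, ImM) /= in i1 i2; rewrite !(ReD, ReN, ReM) /= in i3 i4.
move: (complex.Im (G (xi +i* y1))) (complex.Im (G (xi +i* y2))) i1 i2 => b1 b2 i1 i2.
move: (complex.Re (G (x2 +i* et))) (complex.Re (G (x1 +i* et))) i3 i4 => a2 a1 i3 i4.
move: (complex.Im (G _)) (complex.Re (G _)) (complex.Re l) (complex.Im l) i1 i2 i3 i4 => b0 a0 l1 l2 i1 i2 i3 i4.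
have u1 : `|b1 - b2 - l1 * (y1 - y2)| <= 2 * (e * D).
  move: i1 i2; rewrite !ler_norml => /andP[? ?] /andP[? ?]; apply/andP; split; lra.
have u2 : `|a2 - a1 - l1 * (x2 - x1)| <= 2 * (e * D).
  move: i3 i4; rewrite !ler_norml => /andP[? ?] /andP[? ?]; apply/andP; split; lra.
rewrite (_ : _ + _ = (b1 - b2 - l1 * (y1 - y2)) * (x2 - x1) + (a2 - a1 - l1 * (x2 - x1)) * (y2 - y1)); last by ring.
apply: le_trans (ler_normD _ _) _; rewrite !normrM (gtr0_norm (_ : 0 < x2 - x1)) ?subr_gt0// (gtr0_norm (_ : 0 < y2 - y1)) ?subr_gt0//.
have x0' : 0 <= x2 - x1 by lra. have y0' : 0 <= y2 - y1 by lra.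
have := ler_wpM2r x0' u1; have := ler_wpM2r y0' u2.
rewrite (_ : 2 * e * D ^+ 2 = 2 * (e * D) * (x2 - x1) + 2 * (e * D) * (y2 - y1)); first lra.
by rewrite /D; ring.
Qed.

Lemma goursat x1 x2 y1 y2 : xa < x1 -> x1 < x2 -> x2 < xb -> ya < y1 -> y1 < y2 -> y2 < yb ->
  contour x1 x2 y1 y2 = 0.
Proof.
move=> xa1 x12 x2b ya1 y12 y2b.
pose al := x2 - x1; pose be := y2 - y1.
have al0 : 0 < al by rewrite subr_gt0. have be0 : 0 < be by rewrite subr_gt0.
have q0 : 0 < 2 * (al + be) ^+ 2 by rewrite mulr_gt0// exprn_gt0// addr_gt0.
apply/eqP; rewrite -normr_eq0 eq_le normr_ge0 andbT; apply/ler_addgt0Pr => e e0; rewrite add0r.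
(* The rectangle is parametrized affinely by the unit square, since the induction subdivides
   squares. *)
pose X t := x1 + al * t; pose Y t := y1 + be * t.
pose P (x y s : R) := 0 <= x -> x + s <= 1 -> 0 <= y -> y + s <= 1 ->
  `|contour (X x) (X (x + s)) (Y y) (Y (y + s))| <= e * s ^+ 2.
suff : P 0 0 1.
  rewrite /P add0r !lexx expr1n mulr1 => /(_ isT isT isT isT).
  by rewrite /X /Y !mulr0 !mulr1 !addr0 /al /be !subrKC.
apply: square_induction => //.
- move=> x y s s0 h1 h2 h3 h4 hx hxs hy hys.
  have e1 : x + s / 2 + s / 2 = x + s by field.
  have e2 : y + s / 2 + s / 2 = y + s by field.
  rewrite /P e1 in h2 h4; rewrite /P e2 in h3 h4.
  have {}h1 := h1 hx ltac:(lra) hy ltac:(lra).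
  have {}h2 := h2 ltac:(lra) hxs hy ltac:(lra).
  have {}h3 := h3 hx ltac:(lra) ltac:(lra) hys.
  have {}h4 := h4 ltac:(lra) hxs ltac:(lra) hys.
  have -> : contour (X x) (X (x + s)) (Y y) (Y (y + s)) =
      contour (X x) (X (x + s / 2)) (Y y) (Y (y + s / 2)) +
      contour (X (x + s / 2)) (X (x + s)) (Y y) (Y (y + s / 2)) +
      contour (X x) (X (x + s / 2)) (Y (y + s / 2)) (Y (y + s)) +
      contour (X (x + s / 2)) (X (x + s)) (Y (y + s / 2)) (Y (y + s)).
    by rewrite /contour; ring.
  have N4 (a b c d : R) : `|a + b + c + d| <= `|a| + `|b| + `|c| + `|d|.
    by do 2 (apply: le_trans (ler_normD _ _) _; rewrite lerD2r); exact: ler_normD.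
  apply: le_trans (N4 _ _ _ _) _.
  apply: le_trans (lerD (lerD (lerD h1 h2) h3) h4) _.
  by rewrite le_eqVlt; apply/orP; left; apply/eqP; field.
- rewrite !add0r => x0 y0 /andP[x00 x01] /andP[y00 y01].
  have Xin t : 0 <= t -> t <= 1 -> x1 <= X t /\ X t <= x2.
    by move=> t0 t1; rewrite /X /al; split; nra.
  have Yin t : 0 <= t -> t <= 1 -> y1 <= Y t /\ Y t <= y2.
    by move=> t0 t1; rewrite /Y /be; split; nra.
  have [X01 X02] := Xin _ x00 x01; have [Y01 Y02] := Yin _ y00 y01.
  have [|| l hl] := @hG (X x0) (Y y0); [by apply/andP; split; lra|by apply/andP; split; lra|].
  have e10 : 0 < e / (2 * (al + be) ^+ 2) by rewrite divr_gt0.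
  have [d d0 hd] := hl _ e10.
  exists (d / (al + be)); first by rewrite divr_gt0// addr_gt0.
  move=> x y s s0; rewrite ltr_pdivlMr; last exact: (addr_gt0 al0 be0).
  move=> sd /andP[xl xr] /andP[yl yr] hx hxs hy hys.
  have xs1 : x <= 1 by lra. have xs0 : 0 <= x + s by lra.
  have ys1 : y <= 1 by lra. have ys0 : 0 <= y + s by lra.
  have [a1 _] := Xin x hx xs1; have [_ a2] := Xin (x + s) xs0 hxs.
  have [b1 _] := Yin y hy ys1; have [_ b2] := Yin (y + s) ys0 hys.
  have eX : X (x + s) - X x = al * s by rewrite /X; ring.
  have eY : Y (y + s) - Y y = be * s by rewrite /Y; ring.
  have as0 : 0 < al * s by rewrite mulr_gt0. have bs0 : 0 < be * s by rewrite mulr_gt0.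
  have cX : X x <= X x0 <= X (x + s) by rewrite /X !lerD2l !ler_pM2l// xl xr.
  have cY : Y y <= Y y0 <= Y (y + s) by rewrite /Y !lerD2l !ler_pM2l// yl yr.
  have near := contour_near hd (ltW e10) (lt_le_trans xa1 a1) _ (le_lt_trans a2 x2b)
    (lt_le_trans ya1 b1) _ (le_lt_trans b2 y2b) cX cY.
  have dX : X x < X (x + s) by rewrite -subr_gt0 eX.
  have dY : Y y < Y (y + s) by rewrite -subr_gt0 eY.
  rewrite eX eY -mulrDl [_ * s]mulrC in near.
  apply: le_trans (near dX dY _) _; first by rewrite mulrC in sd; lra.
  rewrite [s * _]mulrC.
  rewrite exprMn !mulrA mulrAC -!mulrA [leLHS](_ : _ = e * s ^+ 2 * (2 * (al + be) ^+ 2 / (2 * (al + be) ^+ 2))).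
    by rewrite divff ?mulr1// gt_eqF.
  by rewrite invfM; ring.
Qed.

End Goursat.

(** * The maximum principle for Gamma_0(N)-invariant functions *)

Section MaximumPrinciple.
Variable R : realType.
Notation C := (R[i]).
Implicit Types (z w : C) (x y : R).

Lemma cdiff_cexp z : cdiff (@cexp R) z (cexp z).
Proof.
move=> e e0; have m0 : 0 < nm (cexp z) by rewrite nm_gt0 cexp_neq0.
exists (Num.min (1 / 2) (e / (8 * nm (cexp z)))).
  by rewrite lt_min; apply/andP; split; [lra|rewrite divr_gt0 ?mulr_gt0].
move=> w; rewrite lt_min => /andP[h1]; rewrite ltr_pdivlMr ?mulr_gt0// => h2.
rewrite (_ : _ - _ - _ = cexp z * (cexp (w - z) - 1 - (w - z))); last first.
  by rewrite cexpB; field; rewrite cexp_neq0.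
have h3 := cexp_sub1_sub_le (ltW h1); have h4 := ler_wpM2l (ltW m0) h3.
rewrite nmM; apply: le_trans h4 _.
have := nm_ge0 (w - z) => n0.
rewrite [leLHS](_ : _ = nm (w - z) * (8 * nm (cexp z)) * nm (w - z)); last by ring.
by rewrite ler_wpM2r// ltW.
Qed.

Lemma cexp_2pi x : cexp (x +i* (2 * pi)) = cexp (x +i* 0) :> C.
Proof. by rewrite /cexp /reC /imC /= mulr_natl cos2pi sin2pi cos0 sin0. Qed.

(** A choice depending only on [g], [a] and [b]: equal integrands have equal antiderivatives, so the
    sides at angles 0 and 2 pi cancel without an additive constant. *)
Definition prim (g : R -> R) (a b : R) : R -> R :=
  xget (fun=> 0) [set G | antiderivative g a b G]%classic.

Lemma primP (g : R -> R) (a b : R) : a < b -> (forall x, a <= x <= b -> {for x, continuous g}) ->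
  antiderivative g a b (prim g a b).
Proof.
move=> ab cg; have [G hG] := antiderivative_exists ab cg.
exact: (@xgetPex _ (fun=> 0) [set G | antiderivative g a b G]%classic (ex_intro _ G hG)).
Qed.

(* The mean value property over the circle of radius Im z0 / 2, in the coordinate
   zeta |-> z0 + exp zeta, forces a maximum of |F| to be attained on the whole circle. *)
Lemma maximum_climbs (F : C -> C) z0 : (forall z, inH z -> exists l, cdiff F z l) -> inH z0 ->
  (forall z, inH z -> nm (F z) <= nm (F z0)) ->
  exists2 z1, inH z1 & complex.Im z0 * (11 / 8) <= complex.Im z1 /\ nm (F z1) = nm (F z0).
Proof.
move=> hF hz0 hmax; have I0 : 0 < complex.Im z0 by [].
set m := nm (F z0) in hmax *.
have [m0|mn0] := eqVneq m 0.
  exists (z0 + (complex.Im z0)%:C * 'i).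
    by rewrite /inH /imC ImD ImRM /= mulr1; lra.
  split; first by rewrite ImD ImRM /= mulr1; lra.
  apply/eqP; rewrite eq_le hmax/= ?m0 ?nm_ge0//.
  by rewrite /inH /imC ImD ImRM /= mulr1; lra.
have F00 : F z0 != 0 by rewrite -nm_eq0.
(* The rotation that makes [om * F z0] equal to the positive real [m], so that real parts
   suffice. *)
pose om := (F z0)^-1 * m%:C.
have mgt : 0 < m by rewrite nm_gt0.
have om1 : nm om = 1 by rewrite nmM nmV nm_real gtr0_norm// mulVf.
pose G (ze : C) := om * F (z0 + cexp ze).
pose I := complex.Im z0; pose s2 := ln (I / 2); pose xb := ln (3 / 4 * I).
have I2 : 0 < I / 2 by rewrite /I; lra.
have I34 : 0 < 3 / 4 * I by rewrite /I; lra.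
have s2b : s2 < xb by rewrite ltr_ln ?posrE//; lra.
have inD x y : x <= xb -> inH (z0 + cexp (x +i* y)).
  move=> hx; have : nm (cexp (x +i* y) : C) <= 3 / 4 * I.
    by rewrite nm_cexp /= -(lnK I34) ler_expR.
  move=> h; have := le_trans (nm_Im _) h; rewrite ler_norml => /andP[h1 h2].
  by rewrite /inH /imC ImD; rewrite /I in h1; lra.
have hG x y : x <= xb -> exists l, cdiff G (x +i* y) l.
  move=> hx; have [l hl] := hF _ (inD x y hx).
  exists (om * (l * (cexp (x +i* y) + 0))).
  apply: cdiffZ; apply: (@cdiff_comp R F (fun ze => z0 + cexp ze)) => //.
  rewrite (_ : (fun ze => _) = (fun ze => cexp ze + z0)); last by apply/funext => ze; rewrite addrC.
  by apply: cdiffD; [exact: cdiff_cexp|exact: cdiff_cst].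
have ReG x y : x <= xb -> complex.Re (G (x +i* y)) <= m.
  move=> hx; apply: le_trans (ler_norm _) _; apply: le_trans (nm_Re _) _.
  by rewrite nmM om1 mul1r; apply: hmax; exact: inD.
pose ya : R := - 1; pose yb : R := 2 * pi + 1.
have pi0 := pi_gt0 R; have pi2 := pi_ge2 R.
have yab : ya < yb by rewrite /ya /yb; lra.
pose V x := prim (fun y => complex.Re (G (x +i* y))) ya yb.
have HV x : x <= xb -> antiderivative (fun y => complex.Re (G (x +i* y))) ya yb (V x).
  by move=> hx; apply: primP; [exact: yab|move=> y _]; have [l] := hG x y hx; exact: cdiff_cont_vertical.
(* Goursat's theorem over [x1, s2] x [0, 2 pi]: the horizontal sides cancel by periodicity, so the
   circle integral does not depend on the radius. *)
have indep x1 : x1 < s2 -> V s2 (2 * pi) - V s2 0 = V x1 (2 * pi) - V x1 0.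
  move=> x1s; pose xa := x1 - 1.
  have xab : xa < xb by rewrite /xa; lra.
  pose H y := prim (fun x => complex.Im (G (x +i* y))) xa xb.
  have HH y : antiderivative (fun x => complex.Im (G (x +i* y))) xa xb (H y).
    by apply: primP; [exact: xab|move=> x /andP[_ hx]]; have [l] := hG x y hx; exact: cdiff_cont_horizontal.
  have : contour H V x1 s2 0 (2 * pi) = 0.
    apply: (@goursat R G xa xb ya yb) => //.
    - by move=> x y /andP[_ hx] _; exact: hG.
    - by move=> x /andP[_ hx]; exact: HV.
    - by rewrite /xa; lra.
    - by rewrite /ya; lra.
    - by rewrite mulr_gt0.
    - by rewrite /yb; lra.
  have -> : H = (fun y => H y) by [].
  have HE : H (2 * pi) = H 0.
    rewrite /H; congr prim; apply/funext => x; rewrite /G.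
    by rewrite cexp_2pi.
  by rewrite /contour HE; lra.
(* The circle of radius exp x1 <= d / 2 is shrunk to [z0], where Re G is close to [m]. *)
have total : V s2 (2 * pi) - V s2 0 = m * (2 * pi).
  apply/eqP; rewrite -subr_eq0 -normr_eq0 eq_le normr_ge0 andbT.
  apply/ler_addgt0Pr => e e0; rewrite add0r.
  have e1 : 0 < e / (2 * pi) by rewrite divr_gt0// mulr_gt0.
  have [l hl] := hF _ hz0; have [d d0 hd] := cdiff_cont hl e1.
  pose x1 := Num.min (ln (d / 2)) (s2 - 1).
  have x1s : x1 < s2 by rewrite gt_min; apply/orP; right; lra.
  have x1d : x1 <= ln (d / 2) by rewrite ge_min lexx.
  rewrite (indep _ x1s).
  have hx1 : x1 <= xb by lra.
  have ya0 : ya < 0 by rewrite /ya; lra.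
  have pb : 2 * pi < yb by rewrite /yb; lra.
  have p20 : 0 < 2 * pi :> R by rewrite mulr_gt0.
  have [et _ ->] := antiderivative_MVT (HV _ hx1) ya0 p20 pb.
  rewrite subr0 -mulrBl normrM (gtr0_norm p20) -ler_pdivlMr//.
  apply: le_trans (ltW (hd (z0 + cexp (x1 +i* et)) _)); last first.
    rewrite addrAC subrr add0r nm_cexp /=; apply: (@le_lt_trans _ _ (d / 2)); last lra.
    by rewrite -[leRHS]lnK ?posrE ?ler_expR//; lra.
  have -> : complex.Re (G (x1 +i* et)) - m = complex.Re (om * (F (z0 + cexp (x1 +i* et)) - F z0)).
    rewrite mulrBr ReD ReN -/(G _); congr (_ - _).
    by rewrite /om mulrAC mulVf// mul1r.
  by apply: le_trans (nm_Re _) _; rewrite nmM om1 mul1r.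
(* Since Re G <= m elsewhere and the total is 2 pi m, the average over the window [t1, t2] is [m],
   and it is attained there. In the window sin >= 3 / 4, so the height rises by at least (I / 2) (3
   / 4) = 3 I / 8. *)
pose t1 : R := pi / 2 - 1 / 2; pose t2 : R := pi / 2.
have hs2 : s2 <= xb by exact: ltW.
have grow p q : ya < p -> p < q -> q < yb -> V s2 q - V s2 p <= m * (q - p).
  move=> h1 h2 h3; have [c _ ->] := antiderivative_MVT (HV _ hs2) h1 h2 h3.
  by rewrite ler_wpM2r ?ReG// subr_ge0 ltW.
have t10 : 0 < t1 by rewrite /t1; lra.
have t12 : t1 < t2 by rewrite /t1 /t2; lra.
have t2p : t2 < 2 * pi by rewrite /t2; lra.
have g1 : V s2 t1 - V s2 0 <= m * (t1 - 0) by apply: grow => //; rewrite /ya ?/yb; lra.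
have g3 : V s2 (2 * pi) - V s2 t2 <= m * (2 * pi - t2) by apply: grow => //; rewrite /ya ?/yb; lra.
have yat : ya < t1 by rewrite /ya; lra.
have ybt : t2 < yb by rewrite /yb; lra.
have [et /andP[et1 et2] Eet] := antiderivative_MVT (HV _ hs2) yat t12 ybt.
have gm : complex.Re (G (s2 +i* et)) = m.
  apply/eqP; rewrite eq_le ReG//= -(ler_pM2r (_ : 0 < t2 - t1)) ?subr_gt0//.
  by rewrite -Eet; lra.
exists (z0 + cexp (s2 +i* et)); first exact: inD.
have ces : cexp (s2 +i* et) = (I / 2)%:C * (cos et +i* sin et).
  by rewrite /cexp /reC /imC /= lnK.
split.
  rewrite ImD ces ImRM /=.
  have sn : 3 / 4 <= sin et.
    have -> : sin et = cos (pi / 2 - et) by rewrite cosB cos_pihalf sin_pihalf mul0r add0r mul1r.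
    have := abs_cos_sub1_le (pi / 2 - et).
    have : (pi / 2 - et) ^+ 2 <= 1 / 4.
      have -> : 1 / 4 = (1 / 2) ^+ 2 :> R by field.
      by rewrite ler_pXn2r ?nnegrE//; rewrite /t1 /t2 in et1 et2; lra.
    by rewrite ler_norml => a /andP[b _]; lra.
  rewrite -/I; have : I / 2 * (3 / 4) <= I / 2 * sin et by rewrite ler_pM2l.
  by lra.
apply/le_anti/andP; split; first by apply: hmax; exact: inD.
rewrite -[X in X <= _]gm.
apply: le_trans (ler_norm _) _; apply: le_trans (nm_Re _) _.
by rewrite nmM om1 mul1r.
Qed.

(** If F is nonzero somewhere, |F| attains its supremum, since it is small near all cusps and the
    rest is compact modulo Gamma_0(N). Repeated climbing then reaches arbitrary heights with |F|
    still maximal, against the smallness at i oo. *)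
Lemma invariant_vanishing (N : nat) (F : C -> C) : (0 < N)%N ->
  (forall z, inH z -> exists l, cdiff F z l) ->
  (forall a b c d z, inGamma0 N a b c d -> inH z -> F (mob a b c d z) = F z) ->
  (forall e : R, 0 < e -> exists2 Y : R, 0 <= Y & forall a b c d, inSL2 a b c d ->
     forall z, Y < complex.Im z -> nm (F (mob a b c d z)) < e) ->
  forall z, inH z -> F z = 0.
Proof.
move=> N0 hF inv cusp zs hzs; apply/eqP/negP => /negP Fs.
have ms0 : 0 < nm (F zs) by rewrite nm_gt0.
have ms20 : 0 < nm (F zs) / 2 by lra.
have [Y Y0 hY] := cusp _ ms20.
pose S : set R := [set nm (F z) | z in [set z | inH z]]%classic.
have Fcont z : inH z -> ccont F z by move=> /hF[l /cdiff_cont].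
have [B hB] : exists B, forall a b c d, inSL2 a b c d -> forall z, inH z ->
   `|complex.Re z| <= 1 / 2 -> 1 / 2 <= complex.Im z -> complex.Im z <= Y + 1 -> nm (F (mob a b c d z)) <= B.
  apply: (@coset_uniform R N (fun a b c d B => forall z, inH z ->
   `|complex.Re z| <= 1 / 2 -> 1 / 2 <= complex.Im z -> complex.Im z <= Y + 1 -> nm (F (mob a b c d z)) <= B)) => //.
  - by move=> a b c d x y xy h z hz h1 h2 h3; apply: le_trans xy; exact: h.
  - move=> a b c d a' b' c' d' x hg h' h z hz h1 h2 h3.
    by rewrite -mob_comp ?SL2_det// inv ?h//; exact: inH_SL2.
  - move=> a b c d h.
    have [|||b' hb] := @square_bounded R (fun b' z => nm (F (mob a b c d z)) <= b') (- (Y + 1)) (1 / 2) (2 * (Y + 1)).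
    + by lra.
    + by move=> z x y xy h1; exact: le_trans xy.
    + move=> z [_ /andP[hz _]]; have {}hz : inH z by rewrite /inH /imC; lra.
      have [d' d'0 hd] := ccont_comp (mob_cont hz (SL2_det h)) (Fcont _ (inH_SL2 hz h)) (@ltr01 R).
      exists d' => //; exists (nm (F (mob a b c d z)) + 1) => w /hd hw.
      by have := nm_sub (F (mob a b c d w)) (F (mob a b c d z)); lra.
    exists b' => z hz /ler_normlP[h1 h2] h3 h4; apply: hb; split; apply/andP; split; lra.
have reduce z : inH z -> exists a b c d z', [/\ inSL2 a b c d, inH z', z = mob a b c d z',
    `|complex.Re z'| <= 1 / 2 & 1 / 2 <= complex.Im z'].
  move=> hz; have [a [b [c [d [h [h1 h2]]]]]] := fundamental_reduction hz.
  exists d, (- b), (- c), a, (mob a b c d z); split=> //; [exact: SL2_inv|exact: inH_SL2|by rewrite mobK].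
have Sub : has_ubound S.
  exists (Num.max B (nm (F zs) / 2)) => _ [z hz <-].
  have [a [b [c [d [z' [h hz' -> h1 h2]]]]]] := reduce _ hz.
  have [h3|h3] := leP (complex.Im z') (Y + 1); first by rewrite le_max hB.
  by rewrite le_max; apply/orP; right; apply/ltW/hY => //; lra.
have sub z : inH z -> nm (F z) <= sup S by move=> hz; apply: (@ub_le_sup _ S) => //; exists z.
have sups : nm (F zs) <= sup S by exact: sub.
(* Otherwise |F| stays away from its supremum on the compact part and near the cusps. *)
have [z0 hz0 z0max] : exists2 z0, inH z0 & nm (F z0) = sup S.
  apply: contrapT => nomax.
  have lt z : inH z -> nm (F z) < sup S.
    move=> hz; rewrite lt_neqAle sub// andbT; apply/eqP => E; apply: nomax; by exists z.
  (* A gap 1 / x below the supremum, so that a larger [x] is a weaker claim and constants can be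
     made uniform. *)
  pose T (g : C -> C) (x : R) z := 0 < x /\ nm (g z) <= sup S - x^-1.
  have Tmono g z x y : x <= y -> T g x z -> T g y z.
    move=> xy [x0 h]; have y0 : 0 < y by exact: lt_le_trans xy.
    by split=> //; apply: (le_trans h); rewrite lerD2l lerN2 lef_pV2.
  have [x hx] : exists x, forall a b c d, inSL2 a b c d -> forall z, inH z ->
     `|complex.Re z| <= 1 / 2 -> 1 / 2 <= complex.Im z -> complex.Im z <= Y + 1 -> T (fun z => F (mob a b c d z)) x z.
    apply: (@coset_uniform R N (fun a b c d x => forall z, inH z ->
     `|complex.Re z| <= 1 / 2 -> 1 / 2 <= complex.Im z -> complex.Im z <= Y + 1 -> T (fun z => F (mob a b c d z)) x z)) => //.
    - by move=> a b c d x y xy h z hz h1 h2 h3; apply: (Tmono _ _ _ _ xy); exact: h.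
    - move=> a b c d a' b' c' d' x hg h' h z hz h1 h2 h3; have [x0 hx0] := h z hz h1 h2 h3; split=> //.
      by rewrite -mob_comp ?SL2_det// inv//; exact: inH_SL2.
    - move=> a b c d h.
      have [|||b' hb] := @square_bounded R (T (fun z => F (mob a b c d z))) (- (Y + 1)) (1 / 2) (2 * (Y + 1)).
      + by lra.
      + by move=> z x y xy; exact: Tmono.
      + move=> z [_ /andP[hz _]]; have {}hz : inH z by rewrite /inH /imC; lra.
        have g0 : 0 < (sup S - nm (F (mob a b c d z))) / 2.
          by rewrite divr_gt0// subr_gt0 lt// ; exact: inH_SL2.
        have [d' d'0 hd] := ccont_comp (mob_cont hz (SL2_det h)) (Fcont _ (inH_SL2 hz h)) g0.
        exists d' => //; exists ((sup S - nm (F (mob a b c d z))) / 2)^-1 => w /hd hw.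
        split; first by rewrite invr_gt0.
        rewrite invrK; have := nm_sub (F (mob a b c d w)) (F (mob a b c d z)); lra.
      exists b' => z hz /ler_normlP[h1 h2] h3 h4; apply: hb; split; apply/andP; split; lra.
  have x0 : 0 < x.
    have s1 : inSL2 1 0 0 1 by [].
    by have [] := hx _ _ _ _ s1 'i; rewrite ?/inH ?/imC /= ?normr0//; lra.
  have : sup S <= Num.max (sup S - x^-1) (nm (F zs) / 2).
    apply: ge_sup; first by exists (nm (F zs)), zs.
    move=> _ [z hz <-]; have [a [b [c [d [z' [h hz' -> h1 h2]]]]]] := reduce _ hz.
    have [h3|h3] := leP (complex.Im z') (Y + 1).
      by have [_ hh] := hx _ _ _ _ h z' hz' h1 h2 h3; rewrite le_max hh.
    by rewrite le_max; apply/orP; right; apply/ltW/hY => //; lra.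
  have : 0 < x^-1 by rewrite invr_gt0.
  by rewrite le_max => ? /orP[?|?]; lra.
have climb n : exists2 z, inH z & complex.Im z0 * (1 + n%:R * (3 / 8)) <= complex.Im z /\ nm (F z) = sup S.
  elim: n => [|n [z hz [h1 h2]]]; first by exists z0 => //; rewrite mul0r addr0 mulr1.
  have [z1 hz1 [h3 h4]] := @maximum_climbs F z hF hz (fun w hw => eq_ind_r (fun t => nm (F w) <= t) (sub w hw) h2).
  exists z1 => //; split; last by rewrite h4.
  have I0 : 0 < complex.Im z0 by []. have n0 : 0 <= n%:R * (3 / 8) :> R by rewrite mulr_ge0//; lra.
  rewrite -natr1; apply: le_trans h3; nra.
have I0 : 0 < complex.Im z0 by [].
pose n := Num.Def.archi_bound (Y / (complex.Im z0 * (3 / 8))).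
have q0 : 0 < complex.Im z0 * (3 / 8) by rewrite mulr_gt0//; lra.
have hn : Y / (complex.Im z0 * (3 / 8)) < n%:R by apply: archi_boundP; rewrite divr_ge0// ltW.
have [z hz [h1 h2]] := climb n.
rewrite ltr_pdivrMr// in hn.
have s1 : inSL2 1 0 0 1 by [].
have zY : Y < complex.Im z by lra.
by have := hY _ _ _ _ s1 z zY; rewrite mob1 h2; lra.
Qed.

End MaximumPrinciple.

(** * The normalized logarithm and the final estimate *)

Section Assembly.
Variable R : realType.
Notation C := (R[i]).

Lemma bernoulli_le (t : R) n : 0 <= t -> t <= 1 -> 1 - n%:R * t <= (1 - t) ^+ n.
Proof.
move=> t0 t1; elim: n => [|n IH]; first by rewrite mul0r subr0 expr0.
have n0 : 0 <= n%:R :> R by [].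
rewrite exprS -natr1; apply: le_trans (ler_wpM2l _ IH); last lra.
have := mulr_ge0 n0 (mulr_ge0 t0 t0); lra.
Qed.

(** With t = 2 / P, Bernoulli gives x <= (1 - t)^(d+1), so the product is at most (1 - t) (1 -
    t^2)^d < 1. *)
Lemma eigenvalue_norm_contra (x P : R) (d : nat) : 2 <= P ->
  x <= (P - 2 * d.+1%:R) / P -> 0 <= x -> 1 <= x * ((P + 2) / P) ^+ d -> False.
Proof.
move=> P2 hx x0; apply/negP; rewrite -ltNge.
have P0 : 0 < P by lra.
pose t := 2 / P; have t0 : 0 < t by rewrite divr_gt0.
have t1 : t <= 1 by rewrite ler_pdivrMr// mul1r.
have e1 : (P + 2) / P = 1 + t by rewrite mulrDl divff ?gt_eqF.
have hx2 : x <= (1 - t) ^+ d.+1.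
  apply: (le_trans hx); apply: le_trans (bernoulli_le d.+1 (ltW t0) t1).
  rewrite mulrBl divff ?gt_eqF//.
  by rewrite lerD2l lerN2 /t mulrA [_ * 2]mulrC.
rewrite e1; apply: le_lt_trans (ler_wpM2r _ hx2) _; first by rewrite exprn_ge0//; lra.
rewrite exprS -mulrA -exprMn.
apply: le_lt_trans (_ : (1 - t) * 1 < 1); last lra.
rewrite ler_wpM2l//; first lra.
by rewrite exprn_ile1//; nra.
Qed.

Variables (N : nat) (f : C -> C) (C0 : C) (h : int) (c : nat -> C).
Hypothesis N0 : (0 < N)%N.
Hypothesis f_gmf : GMF0 N f.
Hypothesis f_div : div_zero f.
Hypothesis f_nc : nonconstant_on_H f.
Hypothesis fq : q_exponents f C0 h c.

Let f0 := f_neq0 f_div.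

Lemma normalized_log : exists (F : C -> C) (k : R) (u : int -> int -> C),
  [/\ 0 < k, k <= 1 / 4,
    forall z w, inH z -> inH w -> rho z w <= k ->
      nm (f w / f z - 1) < 1 / 2 /\ F w - F z = LogRH (f w / f z),
    forall a b c d, 0 < a * d - b * c -> cusp_lim F a b c d (u a c) & u 1 0 = 0].
Proof.
have e0 : 0 < 1 / 2 :> R by lra.
have [kap kap0 hk] := ratio_uniform N0 f_gmf f_div e0.
have [F0 [k k0 [k4 hF]]] := log_lift f0 kap0 hk.
have s1 : inSL2 1 0 0 1 by [].
have [U hU] := cusp_lim_SL2 f_div k0 hF s1.
pose F z := F0 z - U.
have hF' z w : inH z -> inH w -> rho z w <= k ->
   nm (f w / f z - 1) < 1 / 2 /\ F w - F z = LogRH (f w / f z).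
  by move=> hz hw hr; have [h1 <-] := hF z w hz hw hr; split=> //; rewrite /F; ring.
have hu a c' : {v : C | forall b d, 0 < a * d - b * c' -> cusp_lim F a b c' d v}.
  apply: cid; apply: cusp_lim_col => {a c'} a b c' d hs.
  exact: (cusp_lim_SL2 f_div k0 hF' hs).
exists F, k, (fun a c' => sval (hu a c')); split=> //.
  by move=> a b c' d; exact: (svalP (hu a c')).
have d1 : 0 < 1 * 1 - 0 * 0 :> int by [].
have l1 := svalP (hu 1 0) 0 1 d1.
apply: (ilim_unique l1).
have := ilimD hU (ilim_cst (- U)); rewrite subrr.
by apply: ilim_eq.
Qed.

Variables (F : C -> C) (k : R) (u : int -> int -> C).
Hypothesis k0 : 0 < k.
Hypothesis k4 : k <= 1 / 4.
Hypothesis hF : forall z w, inH z -> inH w -> rho z w <= k ->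
      nm (f w / f z - 1) < 1 / 2 /\ F w - F z = LogRH (f w / f z).
Hypothesis hu : forall a b c d, 0 < a * d - b * c -> cusp_lim F a b c d (u a c).
Hypothesis u10 : u 1 0 = 0.

Let inHi : inH ('i : C). Proof. by rewrite /inH /imC /= ltr01. Qed.

Let hGamma a b c' d (hg : inGamma0 N a b c' d) := F_Gamma f_gmf k0 hF hg.

Lemma F_locally_nonconstant : exists z w, [/\ inH z, inH w, rho z w <= k & F z != F w].
Proof.
apply: contrapT => H; have [z1 [z2 [h1 [h2 /eqP]]]] := f_nc; apply.
apply: (@local_cst_cst R _ f 0 k) => // z w hz hw hr.
have [h3 E] := hF hz hw hr.
have FF : F z = F w by apply/eqP/negP => /negP n; apply: H; exists z, w.
have : cexp (LogRH (f w / f z)) = f w / f z by apply/cexp_LogRH/Re_near1; lra.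
rewrite -E FF subrr cexp0 => /esym h4; apply/esym.
by rewrite -[RHS]mul1r -h4 divfK ?f0.
Qed.

Lemma F_exp : exists2 L : C, L != 0 & forall z, inH z -> cexp (F z) = f z / L.
Proof.
exists (f 'i / cexp (F 'i)); first by rewrite mulf_neq0 ?f0// invr_neq0// cexp_neq0.
move=> z hz; suff E : cexp (F z) / f z = cexp (F 'i) / f 'i.
  apply: (mulIf (invr_neq0 (f0 hz))); rewrite E.
  by field; rewrite !f0// cexp_neq0.
apply: (@local_cst_cst R _ (fun z => cexp (F z) / f z) 0 k) => // {hz}z w hz hw hr.
have [h3 E] := hF hz hw hr.
have := cexp_LogRH (Re_near1 (lt_trans h3 (_ : 1 / 2 < 1))); rewrite -E cexpB => /(_ ltac:(lra)) h4.
have zn := f0 hz; have wn := f0 hw.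
have -> : cexp (F w) = f w / f z * cexp (F z) by rewrite -h4 divfK// cexp_neq0.
by field; rewrite zn wn.
Qed.

Lemma F_vanishes_at_infinity (e : R) : 0 < e -> exists2 Y : R, 0 <= Y &
  forall z, Y < complex.Im z -> nm (F z) < e.
Proof.
have d1 : 0 < 1 * 1 - 0 * 0 :> int by [].
move=> /(hu d1)[Y hY]; exists (Num.max 0 Y) => [|z]; first by rewrite le_max lexx.
rewrite gt_max => /andP[z0 zY]; have := hY z z0 zY.
by rewrite mob1 u10 subr0.
Qed.

Lemma u_nonzero : exists a c', ((a != 0) || (c' != 0)) /\ u a c' != 0.
Proof.
apply: contrapT => H.
have uz a c' : (a != 0) || (c' != 0) -> u a c' = 0.
  by move=> ac; apply/eqP/negP => /negP n; apply: H; exists a, c'.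
(* The additive constant of a matrix of Gamma_0(N) is the difference of the limits of F at the image
   of i oo and at i oo, both zero here. *)
have inv a b c' d z : inGamma0 N a b c' d -> inH z -> F (mob a b c' d z) = F z.
  move=> hg hz; have [phi hphi] := hGamma hg.
  have [phi' hphi'] := u_Gamma hu hGamma hg.
  have lim1 : cusp_lim F a b c' d (u 1 0 + phi).
    have d1 : 0 < 1 * 1 - 0 * 0 :> int by [].
    apply: ilim_eq (ilimD (hu d1) (ilim_cst phi)) => w hw.
    by rewrite mob1 hphi.
  have hs : inSL2 a b c' d by case: hg.
  have := ilim_unique lim1 (hu (SL2_det hs)); rewrite u10 add0r uz; last by have [] := SL2_col hs.
  by move=> phi0; rewrite hphi// phi0 addr0.
have Fz : forall z, inH z -> F z = 0.
  apply: (@invariant_vanishing R N F N0) => //.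
  - by move=> z hz; exists (cderiv f z / f z); exact: (F_cdiff f_gmf f_div k0 hF).
  - move=> e e0; have e20 : 0 < e / 2 by lra.
    have [Y Y0 hY] := F_cusp_uniform N0 f_gmf f_div k0 hF e20.
    exists Y => // a b c' d hs z hz.
    have [Y1 hY1] := hu (SL2_det hs) e20; rewrite uz in hY1; last by have [] := SL2_col hs.
    pose w : C := 0 +i* (Num.max Y Y1 + 1).
    have m1 : Y <= Num.max Y Y1 by rewrite le_max lexx.
    have m2 : Y1 <= Num.max Y Y1 by rewrite le_max lexx orbT.
    have wY : Y < complex.Im w by rewrite /=; lra.
    have wY1 : Y1 < complex.Im w by rewrite /=; lra.
    have hw : inH w by rewrite /inH /imC; lra.
    have := hY1 w hw wY1; rewrite subr0 => A.
    have B := hY _ _ _ _ hs w z wY hz.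
    by have := nm_sub (F (mob a b c' d z)) (F (mob a b c' d w)); lra.
have [z [w [hz hw _ /eqP]]] := F_locally_nonconstant; apply.
by rewrite !Fz.
Qed.

Lemma u_Gamma_sub a b c' d a' b' c'' d' : inGamma0 N a b c' d -> inSL2 a' b' c'' d' ->
  u (a * a' + b * c'') (c' * a' + d * c'') - u (a * b' + b * d') (c' * b' + d * d') = u a' c'' - u b' d'.
Proof.
move=> hg hs; have [phi E] := u_Gamma hu hGamma hg; have [e1 e2] := SL2_col hs.
by rewrite !E//; ring.
Qed.

(** At the column (1, 0) every term of the Hecke relation is a multiple of that column, where [u]
    vanishes. *)
Lemma hecke_constant_zero (p : nat) (lam K : C) : (0 < p)%N ->
  (forall z, inH z -> TF F p z = lam * F z + K) -> K = 0.
Proof.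
move=> p0 hT; have := u_hecke hu p0 hT (a := 1) (c := 0) isT.
have pZ : p%:Z != 0 by rewrite eqz_nat -lt0n.
have up : u (p%:Z * 1) 0 = 0 by rewrite -(mulr0 p%:Z) (u_scale hu)// u10.
rewrite up u10 (mulr0 lam) !add0r => <-; rewrite big1// => j _.
by rewrite !mulr0 addr0 u10.
Qed.

End Assembly.

Theorem mainTheorem10 (R : realType) (N : nat) (f : R[i] -> R[i])
    (C0 : R[i]) (h : int) (c : nat -> R[i]) :
  (0 < N)%N ->
  GMF0 N f ->
  div_zero f ->
  nonconstant_on_H f ->
  q_exponents f C0 h c ->
  normalized_hecke_eigenform N (logderiv f) c ->
  exists B : nat, forall p : nat,
    prime p -> c p != 0 -> alg_integer (c p) -> (p < B)%N.
Proof.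
move=> N0 f_gmf f_div f_nc fq [b1 heig].
have [F [k [u [k0 k4 hF hu u10]]]] := normalized_log N0 f_gmf f_div.
have f0 := f_neq0 f_div.
have hGamma a b c' d (hg : inGamma0 N a b c' d) := F_Gamma f_gmf k0 hF hg.
have c1 : c 1 = -1.
  by move: b1; rewrite /bcoef (_ : divisors 1 = [:: 1%N])// big_seq1 mul1r => <-; rewrite opprK.
have [d hd] := @norm_bound R N u N0 (fun g a c' g0 ac => u_scale hu g0 ac) u10
  (u_Gamma_sub f_gmf k0 hF hu) (u_nonzero N0 f_gmf f_div f_nc k0 hF hu u10).
have Fb : exists B : R, forall z w, inH z -> inH w -> rho z w <= k -> nm (F w - F z) <= B.
  exists 3 => z w hz hw hr; have [h1 ->] := hF z w hz hw hr.
  by apply/LogRH_mono_near1/ltW.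
(* With M = 4 d + 8 one gets |1 - lam| <= 1 + p - (2 d + 4) + 1 / 2 <= p - 2 (d + 1), as
   [eigenvalue_norm_contra] demands. *)
have [p0 hp0] := eigenvalue_own_bound N0 k4 Fb (F_locally_nonconstant f_div f_nc k0 hF) hGamma
  (F_cusp_uniform N0 f_gmf f_div k0 hF) (4 * d + 8).
(* From here on p does not divide N, p is at least 3, and p exceeds the threshold [p0] of the
   improved bound. *)
exists (maxn (maxn N.+1 3) (Num.Def.archi_bound p0).+1) => p pp cp0 cpi.
rewrite ltnNge; apply/negP; rewrite !geq_max => /andP[/andP[pN p3] pb].
have pN' : ~~ (p %| N)%N by apply/negP => /(dvdn_leq N0); rewrite leqNgt pN.
have pgt0 := prime_gt0 pp.
have [lam hlam] := heig p pp.
have [K hT] := TF_eigen f_gmf f_div k0 hF pp pN' hlam.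
have K0 := hecke_constant_zero hu u10 pgt0 hT.
have hT0 z : inH z -> TF F p z = lam * F z by move=> /hT ->; rewrite K0 addr0.
have [L L0 hL] := F_exp f_div k0 hF.
have hFL : exists2 Y : R, 0 <= Y & forall z, Y < complex.Im z -> cexp (F z) = f z / L.
  by exists 0 => // z hz; exact: hL.
have E := hecke_eigenvalue_exponent f0 fq L0 hFL (F_vanishes_at_infinity hu u10) pp hT0.
have pC : p%:R != 0 :> R[i] by rewrite pnatr_eq0 -lt0n.
have cpE : c p = (1 - lam) / p%:R.
  apply: (mulIf pC); rewrite divfK// mulrC; move: E; rewrite c1 mulrN1 => /eqP.
  by rewrite addrC subr_eq addrC => /eqP.
rewrite cpE in cp0 cpi.
have hecke a c' : (a != 0) || (c' != 0) ->
     u (p%:Z * a) c' + \sum_(j < p) u (a + j%:Z * c') (p%:Z * c') = lam * u a c'.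
  by move=> ac; rewrite (u_hecke hu pgt0 hT)// K0 addr0.
have big := hd p lam pp hecke cpi cp0.
have pb' : p0 <= p%:R.
  have [h0|h0] := leP 0 p0; last by apply: le_trans (ltW h0) _.
  by apply: ltW; apply: lt_le_trans (archi_boundP h0) _; rewrite ler_nat ltnW.
have own := hp0 p lam K pgt0 pb' hT.
apply: (@eigenvalue_norm_contra R (nm ((1 - lam) / p%:R)) p%:R d) big.
- by rewrite ler_nat ltnW.
- rewrite nmM nmV nm_nat ler_wpM2r ?invr_ge0//.
  apply: le_trans (nmD _ _) _; rewrite nmN nm1.
  move: own; rewrite natrD natrM -natr1; lra.
- exact: nm_ge0.
Qed.
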